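(* Let $\vec\beta\in(0,\infty)^d$, $\vec r\in[1,\infty]^d$, $\vec L\in(0,\infty)^d$ and $M>0$ be fixed. (i) There exists $c>0$ such that $$\liminf_{n\to\infty}\Big\{\Big(\frac{L_\beta\alpha_n}{n}\Big)^{-\nu}\inf_{\tilde f}\mathcal R_p^{(n)}\big[\tilde f;\mathbb N_{\vec r,d}(\vec\beta,\vec L,M)\big]\Big\}\ge c,\qquad\forall p\in[1,\infty),$$ where the infimum is taken over all possible estimators $\tilde f$ based on $X_1,\dots,X_n$. If $\min_{j=1,\dots,d}L_j\ge L_0>0$ then in the cases $p\le s(2+1/\beta)$, or $p\ge s(2+1/\beta)$ and $s<1$, the constant $c$ is independent of $\vec L$. (ii) Let $p=\infty$ and $s\le1$; then there is no consistent estimator, i.e., for some $c>0$ $$\liminf_{n\to\infty}\inf_{\tilde f}\sup_{f\in\mathbb N_{\vec r,d}(\vec\beta,\vec L,M)}\mathbb E_f\|\tilde f-f\|_\infty>c .$$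
   Context: $X_1,\dots,X_n$ are i.i.d. in $\mathbb R^d$ with density $f$, expectation $\mathbb E_f$. For a class $\Sigma$, $\mathcal R_p^{(n)}[\tilde f;\Sigma]=\sup_f\big(\mathbb E_f\|\tilde f-f\|_p^p\big)^{1/p}$; all suprema over classes are over the probability densities $f$ in the class, and $\|\cdot\|_p$ is the $\mathbb L_p(\mathbb R^d)$-norm. Nikol'skii class. $\Delta_{u,j}g(x)=g(x+ue_j)-g(x)$ ($e_j$ canonical basis vector, $u\in\mathbb R$), $\Delta^k_{u,j}=\Delta_{u,j}\Delta^{k-1}_{u,j}$. For $r_j\in[1,\infty]$, $\beta_j>0$, $L_j>0$, a function $g:\mathbb R^d\to\mathbb R$ belongs to $\mathbb N_{\vec r,d}(\vec\beta,\vec L)$ if for every $j=1,\dots,d$: $\|g\|_{r_j}\le L_j$, and there is a natural number $k_j>\beta_j$ with $\|\Delta^{k_j}_{u,j}g\|_{r_j}\le L_j|u|^{\beta_j}$ for all $u\in\mathbb R$. Put $\mathbb N_{\vec r,d}(\vec\beta,\vec L,M)=\mathbb N_{\vec r,d}(\vec\beta,\vec L)\cap\{f:\|f\|_\infty\le M\}$. $\frac1\beta=\sum_{j=1}^d\frac1{\beta_j}$, $\frac1s=\sum_{j=1}^d\frac1{\beta_jr_j}$ (with $1/\infty=0$), $L_\beta=\prod_{j=1}^dL_j^{1/\beta_j}$, $$\nu=\begin{cases}\dfrac{1-1/p}{1-1/s+1/\beta},&p<\frac{2+1/\beta}{1+1/s},\\[2mm]\dfrac{\beta}{2\beta+1},&\frac{2+1/\beta}{1+1/s}\le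 p\le s(2+1/\beta),\\[2mm] s/p,&p>s(2+1/\beta),\ s<1,\\[1mm]\dfrac{1-1/s+1/(p\beta)}{2-2/s+1/\beta},&p>s(2+1/\beta),\ s\ge1,\end{cases}\qquad\alpha_n=\begin{cases}\ln n,&p>s(2+1/\beta),\ s\ge1,\\1,&\text{otherwise.}\end{cases}$$
   Formalization: The class is additionally assumed to contain at least one probability density; this excludes only the case r_j = 1 and L_j < 1 for some j, where no density lies in the class, the supremum is over the empty set and the bounds fail. *)

(* Defs.v *)
From HB Require Import structures.
From mathcomp Require Import all_boot all_order all_algebra.
From mathcomp Require Import all_classical all_reals all_analysis.
From mathcomp Require Import measurable_realfun.

Set Implicit Arguments.
Unset Strict Implicit.
Unset Printing Implicit Defensive.

Import Order.TTheory GRing.Theory Num.Theory.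
Import numFieldNormedType.Exports.

Local Open Scope classical_set_scope.
Local Open Scope ring_scope.
Local Open Scope ereal_scope.

Section tuple_measure.
Context (dT : measure_display) (T : measurableType dT) (R : realType).

Definition tuple_cons (n : nat) (x : T * n.-tuple T) : n.+1.-tuple T :=
  [tuple of x.1 :: x.2].

Definition tuple_uncons (n : nat) (t : n.+1.-tuple T) : T * n.-tuple T :=
  (thead t, [tuple of behead t]).

Lemma measurable_tuple_cons n : measurable_fun setT (@tuple_cons n).
Proof. exact: (measurable_cons measurable_fst measurable_snd). Qed.

Lemma measurable_tuple_uncons n : measurable_fun setT (@tuple_uncons n).
Proof.
apply/measurable_fun_pairP; split.
  exact: (measurable_tnth (T := T) (n := n.+1) ord0).
exact: measurable_behead.
Qed.

Lemma tuple_consK n : cancel (@tuple_cons n) (@tuple_uncons n).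
Proof. by case=> x t; rewrite /tuple_uncons /= theadE; congr pair; apply/val_inj. Qed.

Lemma tuple_unconsK n : cancel (@tuple_uncons n) (@tuple_cons n).
Proof. by move=> t; rewrite [RHS]tuple_eta; apply/val_inj. Qed.

Section tuple_measureS.
Context (n : nat) (m : {sigma_finite_measure set T -> \bar R})
  (m' : {sigma_finite_measure set (n.-tuple T) -> \bar R}).

Definition tuple_measureS : set (n.+1.-tuple T) -> \bar R :=
  pushforward (m \x m') (@tuple_cons n).

Let preim_measurable (A : set (n.+1.-tuple T)) :
  measurable A -> measurable (@tuple_cons n @^-1` A).
Proof. by move=> mA; rewrite -[X in measurable X]setTI; exact: measurable_tuple_cons. Qed.

Let tuple_measureS0 : tuple_measureS set0 = 0.
Proof. by rewrite /tuple_measureS /pushforward preimage_set0 measure0. Qed.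

Let tuple_measureS_ge0 A : 0 <= tuple_measureS A.
Proof. by rewrite /tuple_measureS /pushforward measure_ge0. Qed.

Let tuple_measureS_sigma_additive : semi_sigma_additive tuple_measureS.
Proof.
move=> F mF tF mUF; rewrite /tuple_measureS /pushforward preimage_bigcup.
apply: measure_semi_sigma_additive.
- by move=> k; exact: preim_measurable.
- apply/trivIsetP => /= i j _ _ ij; rewrite -preimage_setI.
  by move/trivIsetP : tF => /(_ _ _ _ _ ij) ->//; rewrite preimage_set0.
- by rewrite -preimage_bigcup; exact: preim_measurable.
Qed.

HB.instance Definition _ := isMeasure.Build _ _ _ tuple_measureS
  tuple_measureS0 tuple_measureS_ge0 tuple_measureS_sigma_additive.

Let tuple_measureS_sigma_finite : sigma_finite setT tuple_measureS.
Proof.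
have /sigma_finiteP[F [TF ndF Foo]] := sigma_finiteT m.
have /sigma_finiteP[G [TG ndG Goo]] := sigma_finiteT m'.
have consE A : @tuple_cons n @^-1` (@tuple_uncons n @^-1` A) = A.
  by rewrite -comp_preimage (_ : _ \o _ = idfun)//; apply/funext; exact: tuple_consK.
exists (fun k => @tuple_uncons n @^-1` (F k `*` G k)).
  rewrite -preimage_bigcup -[LHS](@preimage_setT _ _ (@tuple_uncons n)).
  congr (_ @^-1` _); rewrite -setXTT TF TG predeqE => -[x y]; split.
    move=> [/= [a _ Fax] [b _ Gby]]; exists (maxn a b) => //; split.
    - by move: x Fax; exact/subsetPset/ndF/leq_maxl.
    - by move: y Gby; exact/subsetPset/ndG/leq_maxr.
  by move=> [a _ []/= ? ?]; split; exists a.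
move=> k; have [mF Fkoo] := Foo k; have [mG Gkoo] := Goo k; split.
  rewrite -[X in measurable X]setTI; apply: measurable_tuple_uncons => //.
  exact: measurableX.
rewrite /tuple_measureS /pushforward consE product_measure1E//.
by rewrite lte_mul_pinfty// ge0_fin_numE.
Qed.

HB.instance Definition _ := Measure_isSigmaFinite.Build _ _ _ tuple_measureS
  tuple_measureS_sigma_finite.

End tuple_measureS.

(* The n-fold product of [m] on [n.-tuple T]. *)
Fixpoint tuple_measure (m : {sigma_finite_measure set T -> \bar R}) (n : nat) :
    {sigma_finite_measure set (n.-tuple T) -> \bar R} :=
  if n is n'.+1 return {sigma_finite_measure set (n.-tuple T) -> \bar R}
  then tuple_measureS m (tuple_measure m n')
  else dirac ([tuple] : 0.-tuple T).

Lemma tuple_measure_box (m : {sigma_finite_measure set T -> \bar R}) (n : nat)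
    (A : 'I_n -> set T) : (forall i, measurable (A i)) ->
  tuple_measure m n [set t | forall i, A i (tnth t i)] = \prod_(i < n) m (A i).
Proof.
elim: n A => [|n IHn] A mA.
  by rewrite big_ord0 /= diracE mem_set//= => -[].
rewrite big_ord_recl /= /tuple_measureS /pushforward.
set B := [set t : n.-tuple T | forall i, A (lift ord0 i) (tnth t i)].
have -> : @tuple_cons n @^-1` [set t | forall i, A i (tnth t i)] = A ord0 `*` B.
  apply/seteqP; split => -[x t] /= AB.
    split => [|i]; first exact: (AB ord0).
    by have := AB (lift ord0 i); rewrite tnthS.
  move=> i; have [->|] := eqVneq i ord0; first exact: AB.1.
  move: i; case; case => // i ilt _.
  rewrite (_ : Ordinal _ = lift ord0 (Ordinal (ilt : (i < n)%N))); last exact/val_inj.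
  by rewrite tnthS; exact: AB.2.
have mB : measurable B.
  rewrite (_ : B = \bigcap_(i in [set: 'I_n])
      ((@tnth n T)^~ i @^-1` A (lift ord0 i))); last first.
    by apply/seteqP; split => t /= Bt; [move=> i _; exact: Bt|move=> i; exact: (Bt i I)].
  apply: fin_bigcap_measurable; first exact: finite_finset.
  by move=> i _; rewrite -[X in measurable X]setTI; exact: measurable_tnth.
by rewrite product_measure1E//; congr (_ * _); exact: IHn.
Qed.

End tuple_measure.

Section density_estimation.
Context (R : realType) (d : nat).

(* R^d, with the product of the Borel sigma-algebras. *)
Definition Rn := d.-tuple (measurableTypeR R).

Definition lebesgue : {sigma_finite_measure set Rn -> \bar R} :=
  tuple_measure (@lebesgue_measure R) d.

Definition Lp_norm (p : \bar R) (g : Rn -> R) : \bar R :=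
  'N[lebesgue]_p[EFin \o g].

Record density := Density {
  density_fun :> Rn -> R ;
  density_measurable : measurable_fun setT density_fun ;
  density_ge0 : forall x, (0 <= density_fun x)%R ;
  density_integral : \int[lebesgue]_x (density_fun x)%:E = 1 }.

Section law.
Variable f : density.

Definition law (A : set Rn) : \bar R := \int[lebesgue]_(x in A) (f x)%:E.

Let law0 : law set0 = 0.
Proof. by rewrite /law integral_set0. Qed.

Let law_ge0 A : 0 <= law A.
Proof. by apply: integral_ge0 => x _; rewrite lee_fin density_ge0. Qed.

Let law_sigma_additive : semi_sigma_additive law.
Proof.
move=> F mF tF mUF; rewrite /law ge0_integral_bigcup//=.
- apply: is_cvg_ereal_nneg_natsum_cond => n _ _.
  by apply: integral_ge0 => x _; rewrite lee_fin density_ge0.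
- apply/measurable_EFinP; apply: measurable_funS (density_measurable f) => //.
- by move=> x _; rewrite lee_fin density_ge0.
Qed.

HB.instance Definition _ := isMeasure.Build _ _ _ law
  law0 law_ge0 law_sigma_additive.

Let law_setT : law setT = 1.
Proof. exact: density_integral. Qed.

HB.instance Definition _ := Measure_isProbability.Build _ _ R law law_setT.

End law.

(* The joint law of an i.i.d. sample X_1, ..., X_n with density f; the X_i are
   the coordinates of [n.-tuple Rn]. *)
Definition sample_law (f : density) (n : nat) :
  {sigma_finite_measure set (n.-tuple Rn) -> \bar R} := tuple_measure (law f) n.

(* Joint measurability in the sample and in the point of R^d makes the losses
   below measurable functions of the sample; losses may be infinite. *)
Definition estimators (n : nat) : set (n.-tuple Rn -> Rn -> R) :=
  [set ft | measurable_fun setT (fun z : n.-tuple Rn * Rn => ft z.1 z.2)].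

Definition Lp_loss (p : \bar R) n (ft : n.-tuple Rn -> Rn -> R) (f : density)
    (x : n.-tuple Rn) : \bar R :=
  Lp_norm p (fun t => ft x t - f t)%R.

Definition Lp_risk (p : R) n (ft : n.-tuple Rn -> Rn -> R) (Sigma : set (Rn -> R)) :
    \bar R :=
  ereal_sup [set (\int[sample_law f n]_x (Lp_loss p%:E ft f x `^ p)) `^ p^-1
            | f in [set f : density | Sigma f]].

Definition Linf_risk n (ft : n.-tuple Rn -> Rn -> R) (Sigma : set (Rn -> R)) :
    \bar R :=
  ereal_sup [set \int[sample_law f n]_x Lp_loss +oo ft f x
            | f in [set f : density | Sigma f]].

Definition minimax_Lp_risk (p : R) n (Sigma : set (Rn -> R)) : \bar R :=
  ereal_inf [set Lp_risk p ft Sigma | ft in @estimators n].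

Definition minimax_Linf_risk n (Sigma : set (Rn -> R)) : \bar R :=
  ereal_inf [set Linf_risk ft Sigma | ft in @estimators n].

Definition shift (u : R) (j : 'I_d) (x : Rn) : Rn :=
  [tuple (tnth x i + (if i == j then u else 0))%R | i < d].

Definition difference (u : R) (j : 'I_d) (g : Rn -> R) : Rn -> R :=
  fun x => (g (shift u j x) - g x)%R.

Definition nikolskii (r : 'I_d -> \bar R) (beta L : 'I_d -> R) : set (Rn -> R) :=
  [set g | measurable_fun setT g /\
    forall j, Lp_norm (r j) g <= (L j)%:E /\
      exists k : nat, (beta j < k%:R)%R /\
        forall u : R, Lp_norm (r j) (iter k (difference u j) g)
                      <= (L j * `|u| `^ beta j)%:E].

Definition nikolskii_bounded (r : 'I_d -> \bar R) (beta L : 'I_d -> R) (M : R) :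
    set (Rn -> R) :=
  nikolskii r beta L `&` [set g | Lp_norm +oo g <= M%:E].

End density_estimation.

Section rates.
Local Open Scope ring_scope.
Context (R : realType) (d : nat) (beta : 'I_d -> R) (r : 'I_d -> \bar R).

(* 1/beta *)
Definition inv_beta : R := \sum_(j < d) (beta j)^-1.

Definition mean_beta : R := inv_beta^-1.

(* 1/s *)
Definition inv_s : R := \sum_(j < d) (beta j)^-1 * fine (r j)^-1%E.

(* +oo when all the r_j are infinite *)
Definition s_index : \bar R := (inv_s%:E)^-1%E.

Definition L_beta (L : 'I_d -> R) : R := \prod_(j < d) L j `^ (beta j)^-1.

(* s (2 + 1/beta) *)
Definition sparse_threshold : \bar R := (s_index * (2 + inv_beta)%:E)%E.

Definition nu (p : R) : R :=
  if p < (2 + inv_beta) / (1 + inv_s) then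
    (1 - 1 / p) / (1 - inv_s + inv_beta)
  else if (p%:E <= sparse_threshold)%E then
    mean_beta / (2 * mean_beta + 1)
  else if (s_index < 1)%E then
    fine s_index / p
  else
    (1 - inv_s + 1 / p * inv_beta) / (2 - 2 * inv_s + inv_beta).

Definition alpha (p : R) (n : nat) : R :=
  if (sparse_threshold < p%:E)%E && (1 <= s_index)%E then ln n%:R else 1.

End rates.

(* Main.v *)
Require Import Defs.
From HB Require Import structures.
From mathcomp Require Import all_boot all_order all_algebra.
From mathcomp Require Import all_classical all_reals all_analysis.
From mathcomp Require Import measurable_realfun ess_sup_inf hoelder.
From mathcomp Require Import ring lra.

(** The lower bounds come from one family of densities, to which a form of
Fano's inequality is applied one position at a time.

In a cube of side [a] carrying a fixed smooth density [base], one places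
[S * K] disjoint boxes with the same sides [h j]: [S] positions with [K]
boxes each. A word [w] of length [S] over [K] letters picks one box per
position, and [perturbed w] is the density obtained by putting a bump of height
[A] on each picked box and scaling the base down accordingly. The bumps are
translates of one another, so they have the same mass, and the total mass stays
one whatever [w] is.

Membership in the class. The bumps are products of a one-dimensional profile
whose differences of order [k] are bounded by [|u|^b] for all [b <= k]
([bump_profile_exists]). If [tau] bounds the total volume of the picked boxes, the
[k]-th difference of the sum of the bumps in direction [j] has an [L_r] norm of
order [A (|u| / h j)^b tau^(1/r)] ([Lp_norm_difference_bump_sum]), because the
number of bumps that overlap after the shifts does not depend on [S].

Indistinguishability. Changing one letter of [w] alters the density on two boxes of
volume [V], where it is at least of order [a^-d]; hence a chi-square divergence of
order [A^2 V a^d] ([chi2_perturbed]). As long as its [n]-fold compounding stays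
below a fraction of [K], the [K] choices at one position cannot be told apart
([fano_cell]). Averaging over all words gives one word for which the estimator fails
at a fraction of the positions ([average_cell_loss]), with a loss of order
[A^p V] at each of them. The minimax risk is therefore at least of order
[A (S V)^(1/p)] ([minimax_Lp_lower]).

Rates. The best sides are [h j = (A tau^(1/r_j) / L_j)^(1/beta_j)], up to constants,
which gives [V = A^(1/beta) tau^(1/s) / L_beta]. With [K = 2] and [y = L_beta / n] it
remains to choose [A], [tau] and [a] subject to [n A^2 V a^d] being bounded
([assouad_bound]):
 - [a] and [tau] constant, [A] of order [y^(1/(2 + 1/beta))] ([middle_zone]);
 - [a] and [A] constant, [tau] of order [y^s], if [s < 1] ([sparse_zone]);
 - [a^d] and [tau] of order [1/A], [A] of order [y^(1/(1 - 1/s + 1/beta))]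
   ([tail_zone]).
For [s >= 1] and large [p] a single bump ([S = 1]) in one of [K] boxes, [K] of
order [1/V], is harder to find: the information [n A^2 V] may then be as large as
[ln K], that is, of order [ln n] ([log_zone]). Finally, if [s <= 1], a single bump
of constant height is supported in a box of volume at most [1/n], so that it is missed
by the sample with positive probability and the sup-norm risk does not vanish
([sup_zone]). *)

Set Implicit Arguments.
Unset Strict Implicit.
Unset Printing Implicit Defensive.

Import Order.TTheory GRing.Theory Num.Theory.
Import numFieldNormedType.Exports.

Local Open Scope classical_set_scope.
Local Open Scope ring_scope.

(** * Integrals over products and under densities *)

Section tuple_integrals.
Context (dT : measure_display) (T : measurableType dT) (R : realType).
Implicit Types m : {sigma_finite_measure set T -> \bar R}.
Local Open Scope ereal_scope.

(** The recursion on the number of factors that defines [tuple_measure], read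
through Tonelli's theorem. *)
Lemma ge0_integral_tuple_measureS m (n : nat) (g : n.+1.-tuple T -> \bar R) :
  measurable_fun setT g -> (forall t, 0 <= g t) ->
  \int[tuple_measure m n.+1]_t g t =
  \int[m]_x \int[tuple_measure m n]_t g (tuple_cons (x, t)).
Proof.
move=> mg g0.
rewrite (_ : \int[_]_t g t = \int[pushforward (m \x tuple_measure m n)
  (@tuple_cons _ T n)]_t g t) //.
rewrite (ge0_integral_pushforward (@measurable_tuple_cons _ T n))//.
rewrite preimage_setT fubini_tonelli1//; last by move=> z; exact: g0.
by apply: measurableT_comp => //; exact: measurable_tuple_cons.
Qed.

Lemma measurable_prod_tnth n (G : 'I_n -> T -> R) :
  (forall i, measurable_fun setT (G i)) ->
  measurable_fun setT (fun t : n.-tuple T => \prod_(i < n) G i (tnth t i))%R.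
Proof.
move=> mG; apply: measurable_prod => i _.
by apply: (measurableT_comp (mG i)); exact: measurable_tnth.
Qed.

(** The density is changed one factor at a time. That [rho] is a density of [m']
is expressed by integrals, which keeps Radon-Nikodym derivatives out. *)
Lemma ge0_integral_tuple_density m m' (rho : T -> R) :
  measurable_fun setT rho -> (forall x, 0 <= rho x)%R ->
  (forall g : T -> \bar R, measurable_fun setT g -> (forall x, 0 <= g x) ->
     \int[m']_x g x = \int[m]_x (g x * (rho x)%:E)) ->
  forall n (g : n.-tuple T -> \bar R),
    measurable_fun setT g -> (forall t, 0 <= g t) ->
    \int[tuple_measure m' n]_t g t =
    \int[tuple_measure m n]_t (g t * (\prod_(i < n) rho (tnth t i))%:E).
Proof.
move=> mrho rho0 m'E; elim => [|n IHn] g mg g0.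
  by apply: eq_integral => t _; rewrite big_ord0 mule1.
have mgc (x : T) : measurable_fun setT (fun t => g (tuple_cons (x, t))).
  apply: (measurableT_comp mg).
  exact: (measurableT_comp (@measurable_tuple_cons _ T n) (pair1_measurable x)).
have mP k : measurable_fun setT
    (fun t : k.-tuple T => (\prod_(i < k) rho (tnth t i))%:E).
  by apply/measurable_EFinP; apply: (@measurable_prod_tnth k (fun=> rho)).
have P0 k (t : k.-tuple T) : 0 <= (\prod_(i < k) rho (tnth t i))%:E.
  by rewrite lee_fin; apply: prodr_ge0 => i _.
rewrite !ge0_integral_tuple_measureS//; last 2 first.
  - exact: emeasurable_funM mg (mP n.+1).
  - by move=> t; rewrite mule_ge0.
under eq_integral do rewrite IHn//.
rewrite m'E; last 2 first.
- apply: (@measurable_fun_fubini_tonelli_F _ _ _ _ _ (tuple_measure m n)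
    (fun z => g (tuple_cons z) * (\prod_(i < n) rho (tnth z.2 i))%:E)).
  + apply: emeasurable_funM.
      by apply: (measurableT_comp mg); exact: measurable_tuple_cons.
    by apply: (measurableT_comp (mP n)); exact: measurable_snd.
  + by move=> z; rewrite mule_ge0.
- by move=> x; apply: integral_ge0 => t _; rewrite mule_ge0.
apply: eq_integral => x _.
rewrite -ge0_integralZr//; last 3 first.
- exact: emeasurable_funM (mgc x) (mP n).
- by move=> t _; rewrite mule_ge0.
- by rewrite lee_fin.
apply: eq_integral => t _.
rewrite big_ord_recl /= -muleA -EFinM mulrC; congr (_ * (_ * _)%:E)%E.
by apply: eq_bigr => i _; rewrite tnthS.
Qed.

Lemma ge0_integral_tuple_prod m n (G : 'I_n -> T -> R) :
  (forall i, measurable_fun setT (G i)) -> (forall i x, 0 <= G i x)%R ->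
  \int[tuple_measure m n]_t (\prod_(i < n) G i (tnth t i))%:E =
  \prod_(i < n) \int[m]_x (G i x)%:E.
Proof.
elim: n G => [|n IHn] G mG G0.
  rewrite big_ord0; under eq_integral do rewrite big_ord0.
  by rewrite integral_cst//= diracE mem_set// mul1e.
have mP k (H : 'I_k -> T -> R) : (forall i, measurable_fun setT (H i)) ->
    measurable_fun setT (fun t : k.-tuple T => (\prod_(i < k) H i (tnth t i))%:E).
  by move=> mH; apply/measurable_EFinP; exact: measurable_prod_tnth.
rewrite ge0_integral_tuple_measureS//; last 2 first.
- exact: (mP n.+1 G).
- by move=> t; rewrite lee_fin; apply: prodr_ge0 => i _.
rewrite big_ord_recl -IHn// muleC -ge0_integralZl//; last 3 first.
- by apply/measurable_EFinP.
- by move=> x _; rewrite lee_fin.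
- by apply: integral_ge0 => t _; rewrite lee_fin; apply: prodr_ge0 => i _.
apply: eq_integral => x _; rewrite muleC -ge0_integralZl//; last 3 first.
- exact: (mP n (fun i => G (lift ord0 i))).
- by move=> t _; rewrite lee_fin; apply: prodr_ge0 => i _.
- by rewrite lee_fin.
apply: eq_integral => t _; rewrite -EFinM big_ord_recl; congr (_ * _)%:E%R.
by apply: eq_bigr => i _; rewrite tnthS.
Qed.

End tuple_integrals.

(** [law f] is given by its values on sets; [f] agrees almost everywhere with its
Radon-Nikodym derivative, whose change of variables formula is then available. *)
Lemma ge0_integral_law (R : realType) (d : nat) (f : density R d)
    (g : Rn R d -> \bar R) : measurable_fun setT g -> (forall t, 0 <= g t)%E ->
  (\int[law f]_x g x = \int[lebesgue R d]_x (g x * (f x)%:E))%E.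
Proof.
move=> mg g0.
have mf : measurable_fun setT (EFin \o f).
  by apply/measurable_EFinP; exact: density_measurable.
have intf : (lebesgue R d).-integrable setT (EFin \o f).
  apply/integrableP; split => //.
  under eq_integral do rewrite /= ger0_norm ?density_ge0//.
  by rewrite density_integral ltry.
have dom : law f `<< lebesgue R d.
  apply/null_content_dominatesP => A mA A0.
  by rewrite /law null_set_integral//; exact: measurable_funS mf.
set h := Radon_Nikodym_SigmaFinite.f (law f) (lebesgue R d).
have h0 : forall x, (0 <= h x)%E := Radon_Nikodym_SigmaFinite.f_ge0 dom.
have inth := Radon_Nikodym_SigmaFinite.f_integrable dom.
have mh : measurable_fun setT h := measurable_int _ inth.
have fh : ae_eq (lebesgue R d) setT (EFin \o f) h.
  apply: integral_ae_eq => //= E _ mE.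
  by rewrite -(Radon_Nikodym_SigmaFinite.f_integral dom).
rewrite -(Radon_Nikodym_SigmaFinite.change_of_variables dom)//.
apply: ge0_ae_eq_integral => //.
- exact: emeasurable_funM.
- exact: emeasurable_funM mg mf.
- by move=> x _; rewrite mule_ge0.
- by move=> x _; rewrite mule_ge0// lee_fin density_ge0.
- by apply: ae_eqe_mul2l; exact: ae_eq_sym.
Qed.

(** * Telling many densities apart *)
Section fano.
Context (dT : measure_display) (T : measurableType dT) (R : realType).
Local Open Scope ereal_scope.

(** By the separation of the losses at most one of them, [a b0], is below
[delta / 2], so all the likelihoods but [L b0] contribute in full. The missing one
is at most [K / 4 + L b0 ^ 2 / K], and the average of the second term is governed
by chi-square divergences: second moments play here the role of the entropy in
Fano's inequality. *)
Lemma fano_pointwise (K : nat) (K0 : (0 < K)%N) (L : 'I_K -> R) (a : 'I_K -> \bar R)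
    (delta : R) :
  (0 <= delta)%R -> (forall b, 0 <= L b)%R -> (forall b, 0 <= a b) ->
  (forall b c, b != c -> delta%:E <= a b + a c) ->
  (delta / 2 * \sum_b L b)%:E <= \sum_b (L b)%:E * a b +
    (delta / 2 * (K%:R / 4 + (\sum_b L b ^+ 2) / K%:R))%:E.
Proof.
move=> d0 L0 a0 ad.
have KR : (0 < K%:R :> R)%R by rewrite ltr0n.
have [b0 Hb0] : exists b0, forall b, b != b0 -> (delta / 2)%:E <= a b.
  have [/existsP[b0 ab0]|/existsPn h] :=
    boolP [exists b : 'I_K, a b < (delta / 2)%:E]; last first.
    by exists (Ordinal K0) => b _; rewrite leNgt.
  exists b0 => b bb0; rewrite leNgt; apply/negP => ab.
  have := ad _ _ bb0; rewrite leNgt => /negP; apply.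
  by rewrite [X in X%:E]splitr EFinD lteD.
have H1 : (delta / 2 * \sum_(b | b != b0) L b)%:E <= \sum_b (L b)%:E * a b.
  rewrite [leRHS](bigD1 b0)//= mulr_sumr -sumEFin.
  apply: (@le_trans _ _ (\sum_(i < K | i != b0) (L i)%:E * a i)).
    apply: lee_sum => b bb0; rewrite mulrC EFinM lee_wpmul2l ?lee_fin//.
    exact: Hb0.
  by rewrite leeDr// mule_ge0// lee_fin.
apply: (le_trans _ (leeD2r _ H1)).
rewrite -EFinD lee_fin -mulrDr ler_wpM2l ?divr_ge0//.
rewrite (bigD1 b0)//= addrC lerD2l.
apply: (@le_trans _ _ (K%:R / 4 + L b0 ^+ 2 / K%:R)%R).
  rewrite -subr_ge0.
  have -> : (K%:R / 4 + L b0 ^+ 2 / K%:R - L b0 = (L b0 - K%:R / 2) ^+ 2 / K%:R)%R.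
    by field; rewrite gt_eqF.
  by rewrite divr_ge0 ?sqr_ge0 ?ltW.
rewrite lerD2l ler_pM2r ?invr_gt0// (bigD1 b0)//= lerDl.
by apply: sumr_ge0 => i _; exact: sqr_ge0.
Qed.

(** The sum of the likelihoods has mean [K], of which the pointwise bound gives up
[K / 4 + X]: when the second moments [X] are below a fraction of [K], the total
loss is of order [delta * K]. *)
Lemma fano_integral (mu : {measure set T -> \bar R}) (K : nat) (K0 : (0 < K)%N)
    (L : 'I_K -> T -> R) (a : 'I_K -> T -> \bar R) (delta X : R) :
  mu setT = 1 -> (0 <= delta)%R ->
  (forall b, measurable_fun setT (L b)) -> (forall b x, 0 <= L b x)%R ->
  (forall b, \int[mu]_x (L b x)%:E = 1) ->
  (forall b, \int[mu]_x (L b x ^+ 2)%:E <= X%:E) ->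
  (forall b, measurable_fun setT (a b)) -> (forall b x, 0 <= a b x) ->
  (forall b c x, b != c -> delta%:E <= a b x + a c x) ->
  (delta / 2 * (3 / 4 * K%:R - X))%:E <=
    \sum_b \int[mu]_x (a b x * (L b x)%:E).
Proof.
move=> mu1 d0 mL L0 L1 L2 ma a0 ad.
have KR : (0 < K%:R :> R)%R by rewrite ltr0n.
have mLE b : measurable_fun setT (fun x => (L b x)%:E).
  exact/measurable_EFinP.
have mL2 b : measurable_fun setT (fun x => (L b x ^+ 2)%:E).
  by apply/measurable_EFinP; exact: measurable_funX.
have maL b : measurable_fun setT (fun x => a b x * (L b x)%:E).
  exact: emeasurable_funM.
have H : \int[mu]_x (delta / 2 * \sum_b L b x)%:E <=
    \int[mu]_x ((\sum_b a b x * (L b x)%:E) +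
      (delta / 2 * (K%:R / 4 + (\sum_b L b x ^+ 2) / K%:R))%:E).
  apply: ge0_le_integral => //.
  - by move=> x _; rewrite lee_fin mulr_ge0 ?divr_ge0// sumr_ge0.
  - by apply/measurable_EFinP; apply: measurable_funM => //; apply: measurable_sum.
  - apply: emeasurable_funD; first exact: emeasurable_sum.
    apply/measurable_EFinP; apply: measurable_funM => //.
    apply: measurable_funD => //; apply: measurable_funM => //.
    by apply: measurable_sum => b; exact: measurable_funX.
  - move=> x _; rewrite (eq_bigr (fun b => (L b x)%:E * a b x)); last by move=> b _; rewrite muleC.
    by apply: fano_pointwise => // b c bc; exact: ad.
have S0 : 0 <= \sum_b \int[mu]_x (a b x * (L b x)%:E).
  by apply: sume_ge0 => b _; apply: integral_ge0 => x _; rewrite mule_ge0// lee_fin.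
move: H; under eq_integral do rewrite EFinM -sumEFin.
rewrite ge0_integralZl ?lee_fin ?divr_ge0//; last 2 first.
- exact: emeasurable_sum.
- by move=> x _; apply: sume_ge0 => b _; rewrite lee_fin.
rewrite ge0_integral_sum//; last by move=> b x _; rewrite lee_fin.
under eq_bigr do rewrite L1.
rewrite ge0_integralD//; last 4 first.
- by move=> x _; apply: sume_ge0 => b _; rewrite mule_ge0// lee_fin.
- exact: emeasurable_sum.
- move=> x _; rewrite lee_fin mulr_ge0 ?divr_ge0// addr_ge0 ?divr_ge0//.
  by apply: sumr_ge0 => b _; exact: sqr_ge0.
- apply/measurable_EFinP; apply: measurable_funM => //.
  apply: measurable_funD => //; apply: measurable_funM => //.
  by apply: measurable_sum => b; exact: measurable_funX.
rewrite ge0_integral_sum//; last by move=> b x _; rewrite mule_ge0// lee_fin.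
have splitE x : (delta / 2 * (K%:R / 4 + (\sum_b L b x ^+ 2) / K%:R))%:E =
    (delta / 2)%:E * ((K%:R / 4)%:E + (K%:R^-1)%:E * \sum_b (L b x ^+ 2)%:E).
  rewrite sumEFin -(EFinM K%:R^-1) -EFinD -EFinM; congr (_ * (_ + _))%:E; exact: mulrC.
under [X in _ + X]eq_integral do rewrite splitE.
rewrite ge0_integralZl ?lee_fin ?divr_ge0//; last 2 first.
- apply: emeasurable_funD => //; apply: emeasurable_funM => //.
  exact: emeasurable_sum.
- move=> x _; rewrite adde_ge0 ?lee_fin ?divr_ge0// mule_ge0 ?lee_fin ?invr_ge0//.
  by apply: sume_ge0 => b _; rewrite lee_fin sqr_ge0.
rewrite ge0_integralD//; last 2 first.
- move=> x _; rewrite mule_ge0 ?lee_fin ?invr_ge0//.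
  by apply: sume_ge0 => b _; rewrite lee_fin sqr_ge0.
- by apply: emeasurable_funM => //; exact: emeasurable_sum.
rewrite integral_cst// mu1 mule1 ge0_integralZl ?lee_fin ?invr_ge0//; last 2 first.
- exact: emeasurable_sum.
- by move=> x _; apply: sume_ge0 => b _; rewrite lee_fin sqr_ge0.
rewrite ge0_integral_sum//; last by move=> b x _; rewrite lee_fin sqr_ge0.
set S := \sum_b \int[mu]_x (a b x * _).
move=> H.
have {H} : (delta / 2 * K%:R)%:E <= S + (delta / 2 * (K%:R / 4 + X))%:E.
  move: H; rewrite sumEFin sumr_const card_ord -(EFinM _ K%:R) => /le_trans; apply.
  apply: leeD2l; rewrite [leRHS]EFinM; apply: lee_wpmul2l.
    by rewrite lee_fin divr_ge0.
  rewrite [leRHS]EFinD; apply: leeD2l.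
  apply: (@le_trans _ _ ((K%:R^-1)%:E * \sum_(b < K) X%:E)).
    by apply: lee_wpmul2l; [rewrite lee_fin invr_ge0|exact: lee_sum].
  by rewrite sumEFin sumr_const card_ord -EFinM -(mulr_natl X) mulKf// gt_eqF.
rewrite -leeBlDr// -EFinB; apply: le_trans; rewrite lee_fin -mulrBr.
by rewrite ler_wpM2l ?divr_ge0//; lra.
Qed.

End fano.

Section likelihood.
Context (R : realType) (d : nat).
Implicit Types f g : density R d.
Local Open Scope ereal_scope.

Lemma measurable_likelihood f g : measurable_fun setT (fun x => f x / g x)%R.
Proof.
rewrite (_ : (fun x => _) = (fun x => f x * (g x `^ (-1)))%R); last first.
  by apply/funext => x; rewrite powR_inv1// density_ge0.
apply: measurable_funM; first exact: density_measurable.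
apply: (measurableT_comp (measurable_powR _)); exact: density_measurable.
Qed.

Lemma likelihood_ge0 f g x : (0 <= f x / g x)%R.
Proof. by rewrite divr_ge0 ?density_ge0. Qed.

(** A change of measure by the likelihood ratio. It needs [f] to vanish with [g],
for the quotient is [0] where [g] is. *)
Lemma ge0_integral_sample_law f g n (a : n.-tuple (Rn R d) -> \bar R) :
  (forall x, g x = 0 -> f x = 0)%R ->
  measurable_fun setT a -> (forall t, 0 <= a t) ->
  \int[sample_law f n]_t a t =
  \int[sample_law g n]_t (a t * (\prod_(i < n) (f (tnth t i) / g (tnth t i)))%:E).
Proof.
move=> fg ma a0; apply: (@ge0_integral_tuple_density _ _ _ (law g) (law f) (fun x => f x / g x)%R) => //.
- exact: measurable_likelihood.
- exact: likelihood_ge0.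
- move=> b mb b0; rewrite !ge0_integral_law//; last 2 first.
  + apply: emeasurable_funM => //; apply/measurable_EFinP.
    exact: measurable_likelihood.
  + by move=> x; rewrite mule_ge0// lee_fin likelihood_ge0.
  apply: eq_integral => x _; rewrite -muleA -EFinM; congr (_ * _%:E).
  by have [gx|gx] := eqVneq (g x) 0%R; [rewrite fg// !mul0r|rewrite divfK].
Qed.

Lemma sample_law_setT f n : sample_law f n setT = 1.
Proof.
rewrite -[LHS]mul1e -integral_cst//.
transitivity (\int[sample_law f n]_t (\prod_(i < n) (1 : R))%:E).
  by apply: eq_integral => t _; rewrite big1.
rewrite (@ge0_integral_tuple_prod _ _ _ (law f) n (fun _ _ => 1%R))// big1// => i _.
by rewrite integral_cst// mul1e; exact: density_integral.
Qed.

Lemma integral_sample_likelihood f g n : (forall x, g x = 0 -> f x = 0)%R ->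
  \int[sample_law g n]_t (\prod_(i < n) (f (tnth t i) / g (tnth t i)))%:E = 1.
Proof.
move=> fg; rewrite -[RHS](sample_law_setT f n) -[RHS]mul1e -integral_cst//.
rewrite (ge0_integral_sample_law fg)//.
by apply: eq_integral => t _; rewrite mul1e.
Qed.

Lemma integral_sample_likelihood_sqr f g n (X : R) :
  \int[law g]_x ((f x / g x) ^+ 2)%:E <= X%:E ->
  \int[sample_law g n]_t ((\prod_(i < n) (f (tnth t i) / g (tnth t i))) ^+ 2)%:E
    <= (X ^+ n)%:E.
Proof.
move=> fgX.
under eq_integral do rewrite -prodrXl.
rewrite (@ge0_integral_tuple_prod _ _ _ (law g) n (fun _ x => (f x / g x) ^+ 2)%R)//; last 2 first.
- by move=> i; apply: measurable_funX; exact: measurable_likelihood.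
- by move=> i x; exact: sqr_ge0.
have I0 : 0 <= \int[law g]_x ((f x / g x) ^+ 2)%:E.
  by apply: integral_ge0 => x _; rewrite lee_fin sqr_ge0.
elim: n => [|n IHn]; first by rewrite big_ord0.
rewrite big_ord_recl exprS EFinM; apply: lee_pmul => //.
by apply: prode_ge0.
Qed.

(** After [g] is added to both sides, [f ^ 2 / g + g = 2 f + (f - g) ^ 2 / g] where
[g] does not vanish, and the last term lives on [D]. Adding [g] keeps all the
integrands nonnegative. *)
Lemma chi2_le f g (D : set (Rn R d)) (A N W : R) :
  measurable D -> lebesgue R d D <= W%:E -> (0 < N)%R ->
  (forall x, D x -> N <= g x)%R ->
  (forall x, D x -> `|f x - g x| <= A)%R -> (forall x, ~ D x -> f x = g x) ->
  \int[law g]_x ((f x / g x) ^+ 2)%:E <= (1 + A ^+ 2 / N * W)%:E.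
Proof.
move=> mD DW N0 gN fgA fgE.
have mfg2 : measurable_fun setT (fun x => ((f x / g x) ^+ 2)%:E).
  by apply/measurable_EFinP; apply: measurable_funX; exact: measurable_likelihood.
have mE (h : density R d) : measurable_fun setT (fun x => (h x)%:E).
  by apply/measurable_EFinP; exact: density_measurable.
rewrite ge0_integral_law//; last by move=> x; rewrite lee_fin sqr_ge0.
set I := \int[_]_x _.
suff : I + 1 <= 2%:E + (A ^+ 2 / N * W)%:E.
  rewrite -leeBrDr// => /le_trans; apply.
  by rewrite -!EFinD lee_fin; lra.
rewrite -(density_integral g) /I -ge0_integralD//; last 3 first.
- by move=> x _; rewrite mule_ge0// lee_fin ?sqr_ge0 ?density_ge0.
- exact: emeasurable_funM mfg2 (mE g).
- by move=> x _; rewrite lee_fin density_ge0.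
have h0 x : (0 <= A ^+ 2 / N * \1_D x)%R by rewrite mulr_ge0// divr_ge0 ?sqr_ge0// ltW.
apply: (@le_trans _ _ (\int[lebesgue R d]_x (2%:E * (f x)%:E + (A ^+ 2 / N)%:E * (\1_D x)%:E))).
  apply: ge0_le_integral => //.
  - by move=> x _; rewrite adde_ge0// ?mule_ge0// ?lee_fin ?sqr_ge0 ?density_ge0.
  - by apply: emeasurable_funD; [exact: emeasurable_funM mfg2 (mE g)|exact: (mE g)].
  - apply: emeasurable_funD.
      by apply: emeasurable_funM => //; exact: (mE f).
    by apply: emeasurable_funM => //; apply/measurable_EFinP.
  - move=> x _; rewrite -!EFinM -!EFinD lee_fin.
    have [Dx|nDx] := pselect (D x).
      rewrite indicE mem_set// mulr1.
      have gx := lt_le_trans N0 (gN _ Dx).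
      have -> : ((f x / g x) ^+ 2 * g x + g x = 2 * f x + (f x - g x) ^+ 2 / g x)%R.
        by field; rewrite gt_eqF.
      rewrite lerD2l; apply: ler_pM; first exact: sqr_ge0.
      - by rewrite invr_ge0 ltW.
      - rewrite -(real_normK (num_real (f x - g x))); apply: lerXn2r.
        + by rewrite nnegrE.
        + by rewrite nnegrE (le_trans _ (fgA _ Dx)).
        + exact: fgA.
      - by rewrite lef_pV2 ?posrE// gN.
    rewrite indicE memNset// mulr0 addr0 fgE//.
    have [->|gx] := eqVneq (g x) 0%R; first by rewrite !mulr0 addr0.
    by rewrite divff// expr1n; lra.
rewrite ge0_integralD//; last 4 first.
- by move=> x _; rewrite -EFinM lee_fin mulr_ge0// density_ge0.
- by apply: emeasurable_funM => //; exact: (mE f).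
- by move=> x _; rewrite -EFinM lee_fin.
- by apply: emeasurable_funM => //; apply/measurable_EFinP.
rewrite ge0_integralZl//; last by move=> x _; rewrite lee_fin density_ge0.
rewrite density_integral mule1 ge0_integralZl//; last 2 first.
- by apply/measurable_EFinP.
- by rewrite lee_fin divr_ge0 ?sqr_ge0// ltW.
rewrite integral_indic// setIT (EFinM _ W); apply: leeD2l; apply: lee_wpmul2l => //.
by rewrite lee_fin divr_ge0 ?sqr_ge0// ltW.
Qed.

Lemma fano_densities (K : nat) (K0 : (0 < K)%N) (f_ : 'I_K -> density R d)
    (g : density R d) n (a : 'I_K -> n.-tuple (Rn R d) -> \bar R) (delta X : R) :
  (0 <= delta)%R -> (forall b x, g x = 0 -> f_ b x = 0)%R ->
  (forall b, \int[law g]_x ((f_ b x / g x) ^+ 2)%:E <= X%:E) ->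
  (forall b, measurable_fun setT (a b)) -> (forall b t, 0 <= a b t) ->
  (forall b c t, b != c -> delta%:E <= a b t + a c t) ->
  (delta / 2 * (3 / 4 * K%:R - X ^+ n))%:E <=
    \sum_b \int[sample_law (f_ b) n]_t a b t.
Proof.
move=> d0 gf gX ma a0 ad.
under eq_bigr do rewrite (ge0_integral_sample_law (gf _))//.
apply: (fano_integral K0 (L := fun b t => \prod_(i < n) (f_ b (tnth t i) / g (tnth t i)))%R) => //.
- exact: sample_law_setT.
- by move=> b; apply: (@measurable_prod_tnth _ _ _ n (fun _ x => f_ b x / g x)%R) => i; exact: measurable_likelihood.
- by move=> b t; apply: prodr_ge0 => i _; exact: likelihood_ge0.
- by move=> b; apply: integral_sample_likelihood; exact: gf.
- by move=> b; exact: integral_sample_likelihood_sqr.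
Qed.

End likelihood.

(** * A smooth bump on the line *)

Section one_dimensional_profile.
Context (R : realType).
Implicit Types (t u : R) (f g : R -> R).

Definition difference1 u f : R -> R := fun t => f (t + u) - f t.

Definition pospow (m : nat) t : R := Num.max t 0 ^+ m.

(** A quadratic remainder also across the origin: the squared positive part is
differentiable at its kink. *)
Lemma pospow2_expansion t h :
  `|pospow 2 (h + t) - pospow 2 t - 2 * Num.max t 0 * h| <= h ^+ 2.
Proof.
rewrite /pospow ler_norml.
have [t0|t0] := leP t 0; have [ht|ht] := leP (h + t) 0.
- by rewrite expr0n/= !mulr0 mul0r !subr0 oppr_le0 sqr_ge0.
- by rewrite expr0n/= !mulr0 mul0r !subr0; apply/andP; split; nra.
- by apply/andP; split; rewrite expr0n/=; nra.
- by apply/andP; split; nra.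
Qed.

Lemma is_derive_pospow m t : is_derive t (1 : R) (pospow m.+2) (m.+2%:R * pospow m.+1 t).
Proof.
have d2 : is_derive t (1 : R) (pospow 2) (2 * pospow 1 t).
  have H : (fun h : R => h^-1 *: ((pospow 2 \o shift t) (h *: (1 : R)) - pospow 2 t))
      @ 0^' --> (2 * pospow 1 t : R).
    apply/cvgrPdist_le => e e0; near=> h.
    have h0 : h != 0 by near: h; exact: nbhs_dnbhs_neq.
    have he : `|h| <= e.
      by near: h; apply: (@dnbhs0_le R R).
    rewrite /= /shift/= /GRing.scale/= mulr1 distrC.
    have -> : h^-1 * (pospow 2 (h + t) - pospow 2 t) - 2 * pospow 1 t =
       h^-1 * (pospow 2 (h + t) - pospow 2 t - 2 * Num.max t 0 * h).
      by rewrite /pospow; field.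
    rewrite normrM normfV ler_pdivrMl ?normr_gt0//.
    rewrite (le_trans (pospow2_expansion t h))//.
    by rewrite -real_normK ?num_real// expr2 ler_wpM2l.
  by apply: DeriveDef; [apply/cvg_ex; eexists; exact: H|exact/cvg_lim].
elim: m => [|m IHm]; first exact: d2.
have -> : pospow m.+3 = id * pospow m.+2.
  apply/funext => x; rewrite /pospow /= [RHS]/GRing.mul/=.
  by have [x0|x0] := leP x 0; [rewrite !expr0n/= mulr0|rewrite exprS].
apply: is_derive_eq.
rewrite /pospow /GRing.scale/=.
have [x0|x0] := leP t 0; first by rewrite !expr0n/= !mulr0 mul0r addr0.
by rewrite (exprS _ m.+1); ring.
Unshelve. all: by end_near. Qed.

(** The differences of [f'] are the derivatives of those of [f], so the mean value
theorem trades one difference for a factor [u] and a derivative. *)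
Lemma iter_difference1_MVT k u f f' t :
  (forall x, is_derive x (1 : R) f (f' x)) ->
  exists x, iter k.+1 (difference1 u) f t = u * iter k (difference1 u) f' x.
Proof.
move=> ff'.
have der j (x : R) : is_derive x (1 : R) (iter j (difference1 u) f) (iter j (difference1 u) f' x).
  elim: j x => [|j IHj] x /=; first exact: ff'.
  apply: (@is_deriveB _ _ _ (iter j (difference1 u) f \o shift u)).
  rewrite -[X in is_derive _ _ _ X]mulr1.
  have dj := IHj (x + u).
  have ds : is_derive x (1 : R) (shift u) 1 := is_derive_shift x 1 u.
  exact: (@is_derive1_comp _ (iter j (difference1 u) f) (shift u) x _ _ dj ds).
have cnt j : continuous (iter j (difference1 u) f).
  by move=> x; apply/differentiable_continuous/derivable1_diffP; have [] := der j x.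
have -> : iter k.+1 (difference1 u) f t =
  iter k (difference1 u) f (t + u) - iter k (difference1 u) f t by [].
have mvt a b : a <= b -> exists x, iter k (difference1 u) f b -
    iter k (difference1 u) f a = iter k (difference1 u) f' x * (b - a).
  move=> ab.
  have [|c _ E] := @MVT_segment R _ (iter k (difference1 u) f') a b ab (fun x _ => der k x).
    exact: continuous_subspaceT.
  by exists c.
have [u0|u0] := leP 0 u.
  have [|x E] := mvt t (t + u); first by rewrite lerDl.
  by exists x; rewrite E mulrC; congr (_ * _); ring.
have [|x E] := mvt (t + u) t; first by rewrite gerDl ltW.
by exists x; rewrite -opprB E; ring.
Qed.

Lemma iter_difference1B k u a b f g t :
  iter k (difference1 u) (fun x => a * f x - b * g x) t =
  a * iter k (difference1 u) f t - b * iter k (difference1 u) g t.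
Proof.
elim: k t => [//|k IHk] t.
rewrite iterS {1}/difference1 !IHk [in RHS]iterS [in X in _ = _ - X]iterS.
by rewrite /difference1; ring.
Qed.

(** For positive exponents it is supported in the unit interval, and derivatives are
combinations of functions of the same form, at the end points included. *)
Definition spline (i j : nat) t : R := pospow i t * pospow j (1 - t).

Lemma is_derive_spline i j t :
  is_derive t (1 : R) (spline i.+2 j.+2)
    (i.+2%:R * spline i.+1 j.+2 t - j.+2%:R * spline i.+2 j.+1 t).
Proof.
have d1 : is_derive t (1 : R) (fun x : R => 1 - x) (0 - 1).
  exact: is_deriveB.
have dj := @is_derive1_comp _ (pospow j.+2) (fun x => 1 - x) t _ _
  (is_derive_pospow j (1 - t)) d1.
have H : is_derive t (1 : R) (spline i.+2 j.+2) _ := is_deriveM (is_derive_pospow i t) dj.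
apply: (trigger_derive H).
by rewrite /spline /GRing.scale/=; ring.
Qed.

Lemma pospow_ge0 m t : 0 <= pospow m t.
Proof. by apply: exprn_ge0; rewrite le_max lexx orbT. Qed.

Lemma pospow_le1 m t : t <= 1 -> pospow m t <= 1.
Proof. by move=> t1; rewrite exprn_ile1// ?ge_max ?t1 ?ler01// le_max lexx orbT. Qed.

Lemma spline_ge0 i j t : 0 <= spline i j t.
Proof. by rewrite mulr_ge0 ?pospow_ge0. Qed.

Lemma pospow0 m t : t <= 0 -> pospow m.+1 t = 0.
Proof. by move=> t0; rewrite /pospow max_r// expr0n. Qed.

Lemma spline0 i j t : t <= 0 \/ 1 <= t -> spline i.+1 j.+1 t = 0.
Proof.
by case=> h; rewrite /spline; [rewrite pospow0// mul0r|rewrite (@pospow0 _ (1 - t)) ?subr_le0// mulr0].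
Qed.

Lemma spline_le1 i j t : spline i.+1 j.+1 t <= 1.
Proof.
have [t0|t0] := leP t 0; first by rewrite spline0; [exact: ler01|left].
have [t1|t1] := leP 1 t; first by rewrite spline0; [exact: ler01|right].
rewrite /spline -[leRHS](mulr1 1) ler_pM ?pospow_ge0 ?pospow_le1 ?(ltW t1)//.
by rewrite gerBl ltW.
Qed.

(** Each use of the mean value theorem lowers one exponent, so [k] of them are
possible when both exponents exceed [k]. *)
Lemma iter_difference1_spline k i j : (k < i)%N -> (k < j)%N ->
  exists2 C, 0 <= C &
    forall u t, `|iter k (difference1 u) (spline i j) t| <= C * `|u| ^+ k.
Proof.
elim: k i j => [|k IHk] [|i] [|j]// ki kj.
  exists 1 => // u t; rewrite /= expr0 mulr1 ger0_norm ?spline_ge0//.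
  exact: spline_le1.
case: i ki => [//|i] ki; case: j kj => [//|j] kj.
have [C1 C10 H1] := IHk i.+1 j.+2 ki (ltnW kj).
have [C2 C20 H2] := IHk i.+2 j.+1 (ltnW ki) kj.
exists (i.+2%:R * C1 + j.+2%:R * C2); first by rewrite addr_ge0 ?mulr_ge0.
move=> u t.
have [x ->] := iter_difference1_MVT k u t (is_derive_spline i j).
rewrite iter_difference1B normrM exprS mulrCA ler_wpM2l//.
rewrite (le_trans (ler_normB _ _))// !normrM !normr_nat [leRHS]mulrDl -!mulrA.
by rewrite lerD// ler_wpM2l.
Qed.

Lemma iter_difference1_le2 k u f t : (forall x, 0 <= f x <= 1) ->
  `|iter k (difference1 u) f t| <= 2 ^+ k.
Proof.
move=> f01; elim: k t => [|k IHk] t.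
  by rewrite /= expr0 ger0_norm; have /andP[] := f01 t.
rewrite iterS /difference1 (le_trans (ler_normB _ _))//.
by rewrite exprS mulrDl !mul1r lerD.
Qed.

(** The one-dimensional factor of the perturbations. The Hoelder bound holds for all
exponents up to [k] at once, since the directions have different smoothness; the
lower bound on the middle half is where the densities of the family differ; the
half-open support makes adjacent translates disjoint. *)
Record bump_profile k := BumpProfile {
  profile_fun :> R -> R ;
  profile_low : R ;
  profile_holder : R ;
  measurable_profile : measurable_fun [set: R] profile_fun ;
  profile_itv : forall t, 0 <= profile_fun t <= 1 ;
  profile_out : forall t, ~~ (0 <= t < 1) -> profile_fun t = 0 ;
  profile_low_itv : 0 < profile_low <= 1 ;
  profile_lowP : forall t, 4^-1 <= t <= 3 / 4 -> profile_low <= profile_fun t ;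
  profile_holder_gt0 : 0 < profile_holder ;
  profile_holderP : forall b : R, 0 < b -> b <= k%:R -> forall u t,
    `|iter k (difference1 u) profile_fun t| <= profile_holder * `|u| `^ b }.

(** A power of [4 t (1 - t)] on the unit interval. Its smoothness gives the Hoelder
bound for [|u| <= 1], its boundedness for [|u| > 1]. *)
Lemma bump_profile_exists k : (0 < k)%N -> inhabited (bump_profile k).
Proof.
move=> k0; pose m := k.+1; pose psi t := 4 ^+ m * spline m m t.
have psiE t : 0 <= t <= 1 -> psi t = (4 * (t * (1 - t))) ^+ m.
  move=> /andP[t0 t1]; rewrite /psi /spline /pospow !max_l ?subr_ge0//.
  by rewrite !exprMn.
have psi0 t : ~~ (0 <= t < 1) -> psi t = 0.
  rewrite negb_and -ltNge -leNgt => /orP[t0|t1].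
    by rewrite /psi spline0 ?mulr0//; left; exact: ltW.
  by rewrite /psi spline0 ?mulr0//; right.
have psi01 t : 0 <= psi t <= 1.
  have [t01|t01] := boolP (0 <= t < 1); last by rewrite psi0// lexx ler01.
  have /andP[t0 /ltW t1] := t01; rewrite psiE ?t0//.
  have h0 : 0 <= 4 * (t * (1 - t)) by nra.
  have h1 : 4 * (t * (1 - t)) <= 1 by have := sqr_ge0 (2 * t - 1); rewrite expr2; lra.
  by rewrite exprn_ge0//= exprn_ile1.
have [C C0 HC] := @iter_difference1_spline k m m (ltnSn _) (ltnSn _).
split; apply: (@BumpProfile k psi ((3 / 4) ^+ m) (4 ^+ m * C + 2 ^+ k)) => //.
- apply: measurable_funM => //; apply: measurable_funM; apply: measurable_funX.
    by apply: measurable_maxr.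
  by apply: measurable_maxr => //; apply: measurable_funB.
- by rewrite exprn_gt0//= exprn_ile1//; lra.
- move=> t /andP[t1 t3]; rewrite psiE; last by apply/andP; split; lra.
  have h : 0 <= (t - 4^-1) * (3 / 4 - t) by rewrite mulr_ge0 ?subr_ge0.
  by apply: lerXn2r; rewrite ?nnegrE; lra.
- by rewrite ltr_wpDl ?mulr_ge0 ?exprn_ge0 ?exprn_gt0.
- move=> b b0 bk u t.
  have [u1|u1] := leP `|u| 1.
    have -> : psi = (fun t => 4 ^+ m * spline m m t - 0 * spline m m t).
      by apply/funext => x; rewrite mul0r subr0.
    rewrite iter_difference1B mul0r subr0 normrM ger0_norm ?exprn_ge0//.
    apply: (@le_trans _ _ (4 ^+ m * C * `|u| `^ b)); last first.
      by rewrite ler_wpM2r ?powR_ge0// lerDl exprn_ge0.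
    rewrite -mulrA ler_wpM2l ?exprn_ge0//.
    rewrite (le_trans (HC _ _))// ler_wpM2l//.
    have [->|u0] := eqVneq u 0; first by rewrite normr0 expr0n gtn_eqF// powR_ge0.
    by rewrite -powR_mulrn// ger_powR// ?normr_gt0 ?u0.
  rewrite (le_trans (iter_difference1_le2 _ _ _ psi01))//.
  apply: (@le_trans _ _ (4 ^+ m * C + 2 ^+ k)).
    by rewrite lerDr mulr_ge0 ?exprn_ge0.
  rewrite ler_peMr// ?addr_ge0 ?mulr_ge0 ?exprn_ge0//.
  have <- : (1 : R) `^ b = 1 by rewrite powR1.
  by apply: ge0_ler_powR; rewrite ?nnegrE ?ler01 ?normr_ge0 ?(ltW u1) ?(ltW b0).
Qed.

End one_dimensional_profile.

(** * Boxes, finite differences and Lebesgue norms *)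

Lemma sum_indic_le1 (T : Type) (R : numDomainType) (I : finType) (D : I -> set T) (x : T) :
  (forall m m', D m x -> D m' x -> m = m') -> \sum_m (\1_(D m) x : R) <= 1.
Proof.
move=> disj; have [[m0 xm0]|nx] := pselect (exists m, D m x); last first.
  rewrite big1 ?ler01// => m _; rewrite indicE memNset// => xm.
  by apply: nx; exists m.
rewrite (bigD1 m0)//= [X in _ + X]big1 => [|m mm0].
  by rewrite addr0 indicE; case: (_ \in _).
rewrite indicE memNset// => xm; move/eqP: mm0; apply.
exact: disj xm xm0.
Qed.

Section boxes.
Context (R : realType) (d : nat).
Implicit Types (a h : 'I_d -> R) (x : Rn R d).

Definition box a h : set (Rn R d) :=
  [set x | forall j, a j <= tnth x j < a j + h j].

Lemma boxE a h : box a h = [set x | forall j, [set` `[a j, (a j + h j)[ ] (tnth x j)].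
Proof. by apply/seteqP; split => x /= hx j; have := hx j; rewrite in_itv. Qed.

Lemma measurable_box a h : measurable (box a h).
Proof.
rewrite boxE (_ : [set x | _] = \bigcap_(i in [set: 'I_d])
    ((@tnth d (measurableTypeR R))^~ i @^-1` `[a i, (a i + h i)[%classic)); last first.
  by apply/seteqP; split => t /= Bt; [move=> i _; exact: Bt|move=> i; exact: (Bt i I)].
apply: fin_bigcap_measurable; first exact: finite_finset.
by move=> i _; rewrite -[X in measurable X]setTI; exact: measurable_tnth.
Qed.

Lemma lebesgue_box a h : (forall j, 0 <= h j) ->
  lebesgue R d (box a h) = (\prod_j h j)%:E.
Proof.
move=> h0; rewrite boxE /lebesgue.
transitivity (\prod_j (@lebesgue_measure R (`[a j, (a j + h j)%R[%classic)))%E.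
  exact: (@tuple_measure_box _ _ _ (@lebesgue_measure R) d
    (fun j => `[a j, (a j + h j)[%classic) (fun j => measurable_itv _)).
rewrite -prodEFin; apply: eq_bigr => j _.
rewrite lebesgue_measure_itv/= lte_fin; case: ifPn => [_|].
  by rewrite -EFinB addrC addKr.
by rewrite -leNgt gerDl => hj; congr _%:E; apply/eqP; rewrite eq_le h0.
Qed.

Lemma tnth_shift u j x i : tnth (Defs.shift u j x) i = tnth x i + (if i == j then u else 0).
Proof. by rewrite tnth_mktuple. Qed.

Lemma shift_shift u v j x : Defs.shift u j (Defs.shift v j x) = Defs.shift (v + u) j x.
Proof.
apply: eq_from_tnth => i; rewrite !tnth_shift -addrA; congr (_ + _).
by case: ifP => // _; rewrite addr0.
Qed.

Lemma shift0 j x : Defs.shift 0 j x = x.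
Proof. by apply: eq_from_tnth => i; rewrite tnth_shift if_same addr0. Qed.

Lemma box_shift a h u j : (fun x => Defs.shift u j x) @^-1` box a h =
  box (fun i => a i - (if i == j then u else 0)) h.
Proof.
by apply/seteqP; split => x /= hx i; have := hx i; rewrite tnth_shift;
  [rewrite lerBlDr addrAC ltrBrDr|rewrite lerBlDr addrAC ltrBrDr].
Qed.

Lemma measurable_shift u j : measurable_fun setT (Defs.shift u j : Rn R d -> Rn R d).
Proof.
apply/measurable_fun_tnthP => i.
rewrite (_ : _ \o _ = (fun x => tnth x i + (if i == j then u else 0))).
  by apply: measurable_funD => //; exact: measurable_tnth.
by apply/funext => x; rewrite /= tnth_shift.
Qed.

Lemma measurable_iter_difference k u j (g : Rn R d -> R) :
  measurable_fun setT g -> measurable_fun setT (iter k (difference u j) g).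
Proof.
move=> mg; elim: k => [//|k IHk] /=; apply: measurable_funB => //.
by apply: measurableT_comp => //; exact: measurable_shift.
Qed.

(** A [k]-th difference reads [g] at the points [x + i u e_j] with [i <= k] only. *)
Lemma iter_difference_eq0 k u j (g : Rn R d -> R) x :
  (forall i, (i <= k)%N -> g (Defs.shift (i%:R * u) j x) = 0) ->
  iter k (difference u j) g x = 0.
Proof.
elim: k g => [|k IHk] g gx; first by have := gx 0%N isT; rewrite mul0r shift0.
rewrite iterSr; apply: IHk => i ik.
rewrite /difference shift_shift gx; last exact: leqW.
by rewrite (_ : i%:R * u + u = i.+1%:R * u) ?gx ?subr0// -natr1 mulrDl mul1r.
Qed.

Lemma iter_difference_sum (I : finType) (c : R) k u j (g : I -> Rn R d -> R) x :
  iter k (difference u j) (fun x => c * \sum_m g m x) x =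
  c * \sum_m iter k (difference u j) (g m) x.
Proof.
elim: k x => [//|k IHk] x.
by rewrite iterS {1}/difference !IHk -mulrBr -sumrB.
Qed.

Lemma iter_differenceD k u j (f g : Rn R d -> R) x :
  iter k (difference u j) (fun x => f x + g x) x =
  iter k (difference u j) f x + iter k (difference u j) g x.
Proof.
elim: k x => [//|k IHk] x.
rewrite iterS {1}/difference !IHk [in RHS]iterS [in X in _ = _ + X]iterS.
by rewrite /difference; ring.
Qed.

(** The power with which the volume of a set enters the [L_r] norm of its indicator:
[1 / r], which is [0] for [r = +oo]. *)
Definition rinv (r : \bar R) : R := fine r^-1%E.

Lemma rinv_itv r : (1 <= r)%E -> 0 <= rinv r <= 1.
Proof.
case: r => [r| |]//; rewrite /rinv; last by rewrite invey lexx ler01.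
rewrite lee_fin => r1; rewrite inver gt_eqF ?(lt_le_trans ltr01)//=.
by rewrite invr_ge0 (le_trans ler01)//= invf_le1// (lt_le_trans ltr01).
Qed.

(** The support is described by a finite cover because it will be a union of
overlapping translates of boxes, of which only the total volume is known. *)
Lemma Lp_norm_le (r : \bar R) (I : finType) (D : I -> set (Rn R d)) (B W : R)
    (g : Rn R d -> R) :
  (1 <= r)%E -> measurable_fun setT g -> (forall i, measurable (D i)) ->
  (\sum_i lebesgue R d (D i) <= W%:E)%E ->
  (forall x, `|g x| <= B) -> (forall x, (forall i, ~ D i x) -> g x = 0) ->
  (Lp_norm r g <= (B * W `^ rinv r)%:E)%E.
Proof.
move=> r1 mg mD DW gB g0.
have B0 : 0 <= B.
  by apply: le_trans (gB [tuple 0 | i < d]).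
case: r r1 => [r| |]// r1; rewrite /Lp_norm unlock; last first.
  rewrite /rinv invey powRr0 mulr1; case: ifPn => [_|_]; last by rewrite lee_fin.
  by apply/ess_supP; apply: nearW => x; rewrite /= lee_fin.
have r_gt0 : 0 < r by rewrite (lt_le_trans ltr01).
have W0 : 0 <= W.
  by rewrite -lee_fin (le_trans _ DW)// sume_ge0.
rewrite /rinv inver gt_eqF//=.
have -> : (B * W `^ r^-1)%:E = ((B `^ r * W)%:E `^ r^-1)%E.
  rewrite poweR_EFin powRM ?powR_ge0// -powRrM divff ?gt_eqF// powRr1//.
apply: gt0_ler_poweR.
- by rewrite invr_ge0 ltW.
- by rewrite in_itv/= leey andbT; apply: integral_ge0 => x _; rewrite ?poweR_ge0 ?lee_fin ?powR_ge0.
- by rewrite in_itv/= leey andbT lee_fin mulr_ge0 ?powR_ge0.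
have mI i : measurable_fun setT (fun x => (\1_(D i) x : R)%:E).
  by apply/measurable_EFinP.
apply: (@le_trans _ _ (\int[lebesgue R d]_x
    ((B `^ r)%:E * \sum_i (\1_(D i) x)%:E)))%E.
  apply: ge0_le_integral => //.
  - apply/measurable_EFinP.
    apply: (measurableT_comp (measurable_powR _)).
    exact: measurableT_comp.
  - apply: emeasurable_funM => //; exact: emeasurable_sum.
  - move=> x _; rewrite sumEFin -EFinM lee_fin.
    have [[i Di]|nD] := pselect (exists i, D i x); last first.
      rewrite g0; last by move=> i Di; apply: nD; exists i.
      by rewrite normr0 powR0 ?gt_eqF// mulr_ge0 ?powR_ge0// sumr_ge0.
    apply: (@le_trans _ _ (B `^ r)).
      by apply: ge0_ler_powR; rewrite ?nnegrE// ltW.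
    rewrite ler_peMr ?powR_ge0// (bigD1 i)//= indicE mem_set// lerDl.
    by apply: sumr_ge0.
rewrite ge0_integralZl//; last 3 first.
- exact: emeasurable_sum.
- by move=> x _; apply: sume_ge0 => i _; rewrite lee_fin.
- by rewrite lee_fin powR_ge0.
rewrite EFinM; apply: lee_wpmul2l; first by rewrite lee_fin powR_ge0.
rewrite ge0_integral_sum//.
apply: le_trans DW; apply: lee_sum => i _.
by rewrite integral_indic// setIT.
Qed.

End boxes.

(** * Sums of disjoint bumps *)

(** The shifted Lebesgue measure agrees with the original one on intervals. *)
Lemma ge0_integral_translation (R : realType) (a : R) (G : R -> \bar R) :
  measurable_fun setT G -> (forall t, 0 <= G t)%E ->
  (\int[@lebesgue_measure R]_t G (t - a)%R = \int[@lebesgue_measure R]_t G t)%E.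
Proof.
move=> mG G0.
pose phi : measurableTypeR R -> measurableTypeR R := fun t => t - a.
have mphi : measurable_fun setT phi by exact: measurable_funB.
have -> : (\int[@lebesgue_measure R]_t G t =
    \int[pushforward (@lebesgue_measure R) phi]_t G t)%E.
  apply: eq_measure_integral => A mA _.
  apply: lebesgue_measure_unique => //= _ [[x y]] _ <-.
  rewrite /pushforward (_ : phi @^-1` `]x, y] = `]x + a, y + a]%classic).
    rewrite !lebesgue_measure_itv/= !lte_fin ltrD2r -!EFinD.
    by rewrite opprD addrACA subrr addr0.
  by apply/seteqP; split => t /=; rewrite !in_itv/= ltrBrDr lerBlDr.
rewrite (ge0_integral_pushforward mphi)//.
Qed.

Section bumps.
Context (R : realType) (d : nat) (k : nat) (psi : bump_profile R k).
Local Notation c0 := (profile_low psi).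
Local Notation C := (profile_holder psi).
Let mpsi := measurable_profile psi.
Let psi01 := profile_itv psi.
Let psi_out := @profile_out _ _ psi.
Let c001 := profile_low_itv psi.
Let psi_mid := @profile_lowP _ _ psi.
Let C0 := profile_holder_gt0 psi.
Let psi_diff := @profile_holderP _ _ psi.
Implicit Types (a h : 'I_d -> R) (x : Rn R d).

Definition box_bump a h x : R := \prod_j psi ((tnth x j - a j) / h j).

Lemma bump_ge0 a h x : 0 <= box_bump a h x.
Proof. by apply: prodr_ge0 => j _; have /andP[] := psi01 ((tnth x j - a j) / h j). Qed.

Lemma bump_le1 a h x : box_bump a h x <= 1.
Proof. by apply: prodr_ile1 => j _. Qed.

Lemma bump_out a h x : (forall j, 0 < h j) -> ~ box a h x -> box_bump a h x = 0.
Proof.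
move=> h0 /existsNP[j /negP nj]; rewrite /box_bump (bigD1 j)//= psi_out ?mul0r//.
apply: contra nj => /andP[p0 p1]; move: p0 p1.
by rewrite ler_pdivlMr// mul0r subr_ge0 ltr_pdivrMr// mul1r ltrBlDl => -> ->.
Qed.

(** The lower corner of the concentric box with half the sides, where a bump is at
least [profile_low ^ d]. *)
Definition mid a h : 'I_d -> R := fun j => a j + h j / 4.

Lemma bump_mid a h x : (forall j, 0 < h j) ->
  box (mid a h) (fun j => h j / 2) x -> c0 ^+ d <= box_bump a h x.
Proof.
move=> h0 bx; rewrite -[d in c0 ^+ d]card_ord -prodr_const; apply: ler_prod => j _.
have /andP[c0p _] := c001; rewrite (ltW c0p) psi_mid//.
have /andP[] := bx j; rewrite /mid => b1 b2.
rewrite ler_pdivlMr// ler_pdivrMr//; apply/andP; split; lra.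
Qed.

Lemma mid_sub a h x : (forall j, 0 < h j) ->
  box (mid a h) (fun j => h j / 2) x -> box a h x.
Proof.
move=> h0 bx j; have /andP[] := bx j; have := h0 j; rewrite /mid => hj b1 b2.
by apply/andP; split; lra.
Qed.

Let measurable_psi_affine (a h : R) : measurable_fun [set: R] (fun t : R => psi ((t - a) / h)).
Proof.
apply: (measurableT_comp mpsi); apply: measurable_funM => //.
exact: measurable_funB.
Qed.

Lemma measurable_bump a h : measurable_fun setT (box_bump a h).
Proof.
apply: measurable_prod => j _.
apply: (measurableT_comp (measurable_psi_affine (a j) (h j))).
exact: measurable_tnth.
Qed.

Lemma integral_bump_translation a h :
  (\int[lebesgue R d]_x (box_bump a h x)%:E = \int[lebesgue R d]_x (box_bump (fun=> 0) h x)%:E)%E.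
Proof.
have bE a' : (\int[lebesgue R d]_x (box_bump a' h x)%:E =
    \prod_(j < d) \int[@lebesgue_measure R]_t (psi ((t - a' j) / h j))%:E)%E.
  apply: (@ge0_integral_tuple_prod _ _ _ (@lebesgue_measure R) d
    (fun j t => psi ((t - a' j) / h j))) => [j|j t].
    exact: measurable_psi_affine.
  by have /andP[] := psi01 ((t - a' j) / h j).
rewrite !bE; apply: eq_bigr => j _.
rewrite (@ge0_integral_translation R (a j) (fun t => (psi (t / h j))%:E)); last 2 first.
- apply/measurable_EFinP; have := measurable_psi_affine 0 (h j).
  by under eq_fun do rewrite subr0.
- by move=> t; rewrite lee_fin; have /andP[] := psi01 (t / h j).
by apply: eq_integral => t _; rewrite subr0.
Qed.

(** The common integral of the translates of a bump. That it is common keeps the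
mass of a perturbed density independent of the picked boxes. *)
Definition mass h : R := fine (\int[lebesgue R d]_x (box_bump (fun=> 0) h x)%:E)%E.

Lemma mass_bounds h : (forall j, 0 < h j) ->
  [/\ (forall a, \int[lebesgue R d]_x (box_bump a h x)%:E = (mass h)%:E)%E,
      (c0 / 2) ^+ d * \prod_j h j <= mass h & mass h <= \prod_j h j].
Proof.
move=> h0.
have mb a : measurable_fun setT (fun x => (box_bump a h x)%:E).
  by apply/measurable_EFinP; exact: measurable_bump.
have /andP[c0p _] := c001.
have up : (\int[lebesgue R d]_x (box_bump (fun=> 0) h x)%:E <= (\prod_j h j)%:E)%E.
  rewrite -(@lebesgue_box R d (fun=> 0)); last by move=> j; exact: ltW.
  rewrite -[X in (_ <= lebesgue R d X)%E]setIT -integral_indic//; last exact: measurable_box.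
  apply: ge0_le_integral => //.
  - by move=> x _; rewrite lee_fin bump_ge0.
  - by apply/measurable_EFinP; apply: measurable_indic; exact: measurable_box.
  - move=> x _; rewrite lee_fin indicE.
    have [bx|bx] := pselect (box (fun=> 0) h x).
      by rewrite mem_set// bump_le1.
    by rewrite bump_out.
have fin : (\int[lebesgue R d]_x (box_bump (fun=> 0) h x)%:E \is a fin_num)%E.
  rewrite ge0_fin_numE; first exact: le_lt_trans up (ltry _).
  by apply: integral_ge0 => x _; rewrite lee_fin bump_ge0.
split.
- by move=> a; rewrite integral_bump_translation fineK.
- rewrite -lee_fin fineK// exprMn -mulrA.
  have -> : 2^-1 ^+ d * \prod_j h j = \prod_j (h j / 2).
    by rewrite big_split/= prodr_const card_ord mulrC.
  rewrite EFinM -(@lebesgue_box R d (mid (fun=> 0) h)); last first.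
    by move=> j; rewrite divr_ge0// ltW.
  rewrite -[X in (_ * lebesgue R d X <= _)%E]setIT -integral_indic//; last exact: measurable_box.
  rewrite -ge0_integralZl//; last 2 first.
  + by apply/measurable_EFinP; apply: measurable_indic; exact: measurable_box.
  + by rewrite lee_fin exprn_ge0// ltW.
  apply: ge0_le_integral => //.
  + by move=> x _; rewrite -EFinM lee_fin mulr_ge0// exprn_ge0// ltW.
  + apply: emeasurable_funM => //.
    by apply/measurable_EFinP; apply: measurable_indic; exact: measurable_box.
  + move=> x _; rewrite -EFinM lee_fin indicE.
    have [bx|bx] := pselect (box (mid (fun=> 0) h) (fun j => h j / 2) x).
      by rewrite mem_set// mulr1 bump_mid.
    by rewrite memNset// mulr0 bump_ge0.
- by rewrite -lee_fin fineK.
Qed.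

(** A difference in direction [j] acts on the [j]-th factor of the product. *)
Lemma iter_difference_bump n u j a h x :
  iter n (difference u j) (box_bump a h) x =
  (\prod_(i < d | i != j) psi ((tnth x i - a i) / h i)) *
  iter n (difference1 (u / h j)) psi ((tnth x j - a j) / h j).
Proof.
elim: n x => [|n IHn] x; first by rewrite /= /box_bump (bigD1 j)//= mulrC.
rewrite !iterS {1}/difference {1}/difference1 !IHn mulrBr; congr (_ * _ - _).
  by apply: eq_bigr => i ij; rewrite tnth_shift (negPf ij) addr0.
by congr (iter _ _ _ _); rewrite tnth_shift eqxx -mulrDl addrAC.
Qed.

Lemma iter_difference_bump_le b u j a h x : 0 < b -> b <= k%:R ->
  (forall j, 0 < h j) ->
  `|iter k (difference u j) (box_bump a h) x| <= C * (`|u| / h j) `^ b.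
Proof.
move=> b0 bk h0; rewrite iter_difference_bump normrM.
rewrite -[leRHS]mul1r ler_pM//.
  rewrite ger0_norm; first by apply: prodr_ile1 => i _; exact: psi01.
  by apply: prodr_ge0 => i _; have /andP[] := psi01 ((tnth x i - a i) / h i).
rewrite (le_trans (psi_diff b0 bk _ _))// normrM normfV (gtr0_norm (h0 j))//.
Qed.

Section sums.
Context (I : finType) (a_ : I -> 'I_d -> R) (h : 'I_d -> R) (A tau : R).
Hypothesis h0 : forall j, 0 < h j.
Hypothesis A0 : 0 <= A.
Hypothesis disj : forall m m' x, box (a_ m) h x -> box (a_ m') h x -> m = m'.
Hypothesis tauP : #|I|%:R * \prod_j h j <= tau.

Lemma box_sum_le1 x : \sum_m (\1_(box (a_ m) h) x : R) <= 1.
Proof.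
by apply: sum_indic_le1 => m m'; exact: disj.
Qed.

Lemma bump_sum_ge0 x : 0 <= \sum_m box_bump (a_ m) h x.
Proof. by apply: sumr_ge0 => m _; exact: bump_ge0. Qed.

Lemma bump_sum_le1 x : \sum_m box_bump (a_ m) h x <= 1.
Proof.
apply: le_trans (box_sum_le1 x); apply: ler_sum => m _; rewrite indicE.
have [bx|bx] := pselect (box (a_ m) h x); first by rewrite mem_set// bump_le1.
by rewrite bump_out.
Qed.

Lemma measurable_bump_sum : measurable_fun setT (fun x => A * \sum_m box_bump (a_ m) h x).
Proof.
apply: measurable_funM => //; apply: measurable_sum => m; exact: measurable_bump.
Qed.

Lemma Lp_norm_bump_sum r : (1 <= r)%E ->
  (Lp_norm r (fun x => A * \sum_m box_bump (a_ m) h x)%R <= (A * tau `^ rinv r)%:E)%E.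
Proof.
move=> r1; apply: (@Lp_norm_le R d r I (fun m => box (a_ m) h)) => //.
- exact: measurable_bump_sum.
- by move=> m; exact: measurable_box.
- under eq_bigr do rewrite (lebesgue_box _ (fun j => ltW (h0 j))).
  by rewrite sumEFin lee_fin sumr_const -[leLHS]mulr_natl.
- move=> x; rewrite ger0_norm ?mulr_ge0 ?bump_sum_ge0//.
  by rewrite ler_piMr// bump_sum_le1.
- by move=> x nx; rewrite big1 ?mulr0// => m _; rewrite bump_out.
Qed.

(** A [k]-th difference involves [k.+1] shifted copies of the sum, and in each copy
at most one bump is nonzero at a given point. So its height has a factor [k.+1],
however many bumps there are, and its support has measure at most [k.+1 * tau]. The
latter factor comes out of the power [1 / r <= 1] at a cost of at most another
[k.+1]. *)
Lemma Lp_norm_difference_bump_sum r b u j : (1 <= r)%E -> 0 < b -> b <= k%:R ->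
  (Lp_norm r (iter k (difference u j) (fun x => A * \sum_m box_bump (a_ m) h x)%R) <=
   (A * (k.+1%:R ^+ 2 * C) * (`|u| / h j) `^ b * tau `^ rinv r)%:E)%E.
Proof.
move=> r1 b0 bk.
have V0 : 0 <= \prod_j h j by apply: prodr_ge0 => i _; exact: ltW.
have tau0 : 0 <= tau by apply: le_trans tauP; rewrite mulr_ge0.
pose Bd := C * (`|u| / h j) `^ b.
have Bd0 : 0 <= Bd by rewrite mulr_ge0 ?powR_ge0// ltW.
pose D (z : 'I_k.+1 * I) := (Defs.shift (z.1%:R * u) j : Rn R d -> Rn R d) @^-1` box (a_ z.2) h.
have out m x : (forall i : 'I_k.+1, ~ D (i, m) x) ->
    iter k (difference u j) (box_bump (a_ m) h) x = 0.
  move=> nD; apply: iter_difference_eq0 => i ik; apply: bump_out => //.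
  exact: (nD (Ordinal (ik : (i < k.+1)%N))).
apply: (@le_trans _ _ ((A * (k.+1%:R * Bd)) * (k.+1%:R * tau) `^ rinv r)%:E).
  apply: (@Lp_norm_le R d r _ D) => //.
  - apply: measurable_iter_difference; exact: measurable_bump_sum.
  - by move=> [i m]; rewrite /D box_shift; exact: measurable_box.
  - under eq_bigr do rewrite /D box_shift (lebesgue_box _ (fun j => ltW (h0 j))).
    rewrite sumEFin lee_fin sumr_const card_prod card_ord -[leLHS]mulr_natl natrM -mulrA.
    by rewrite ler_wpM2l.
  - move=> x; rewrite iter_difference_sum normrM (ger0_norm A0) ler_wpM2l//.
    rewrite (le_trans (ler_norm_sum _ _ _))//.
    apply: (@le_trans _ _ (\sum_m \sum_(i < k.+1) Bd * \1_(D (i, m)) x)).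
      apply: ler_sum => m _.
      have [[i Di]|nD] := pselect (exists i, D (i, m) x); last first.
        rewrite out; last by move=> i Di; apply: nD; exists i.
        by rewrite normr0 sumr_ge0// => i _; rewrite mulr_ge0.
      rewrite (bigD1 i)//= indicE mem_set// mulr1 (le_trans (iter_difference_bump_le _ _ _ _ b0 bk h0))//.
      by rewrite lerDl sumr_ge0// => i' _; rewrite mulr_ge0.
    rewrite exchange_big/= -[k.+1 in leRHS]card_ord mulr_natl -sumr_const.
    apply: ler_sum => i _; rewrite -mulr_sumr ler_piMr//.
    exact: (box_sum_le1 (Defs.shift (i%:R * u) j x)).
  - move=> x nx; rewrite iter_difference_sum big1 ?mulr0// => m _.
    by apply: out => i; exact: (nx (i, m)).
rewrite lee_fin powRM//.
have /andP[ri0 ri1] := rinv_itv r1.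
apply: (@le_trans _ _ (A * (k.+1%:R * Bd) * (k.+1%:R * tau `^ rinv r))).
  apply: ler_wpM2l; first by rewrite mulr_ge0// mulr_ge0.
  apply: ler_wpM2r; first exact: powR_ge0.
  by rewrite -[leRHS]powRr1// ler_powR// ler1n.
by rewrite /Bd le_eqVlt; apply/orP; left; apply/eqP; ring.
Qed.

End sums.

End bumps.

(** * The family of perturbed densities *)

(** The boxes are slots of a grid in the middle cube of side [a / 2]. In each
direction the [N j] slots fill at least half of that length, hence their product
is large enough to host the total volume requested. *)
Lemma lattice_cells (R : realType) (d : nat) (I : finType) (a : R) (h : 'I_d -> R) :
  (forall j, 0 < h j) -> (forall j, h j <= a / 2) ->
  #|I|%:R * \prod_j h j <= (a / 4) ^+ d ->
  exists z : I -> 'I_d -> R,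
   (forall i j, a / 4 <= z i j /\ z i j + h j <= 3 / 4 * a) /\
   (forall m m' (x : Rn R d), box (z m) h x -> box (z m') h x -> m = m').
Proof.
move=> h0 ha cardI.
pose N j := Num.truncn (a / 2 / h j).
have Nitv j : (N j)%:R * h j <= a / 2 < (N j).+1%:R * h j.
  have /truncn_itv /andP[n1 n2] : 0 <= a / 2 / h j.
    by rewrite divr_ge0 ?(le_trans (ltW (h0 j)))// ltW.
  by rewrite -ler_pdivlMr// n1 -ltr_pdivrMr.
have N1 j : (1 <= N j)%N.
  rewrite lt0n; apply/negP => /eqP N0; have := Nitv j; rewrite N0 mul1r => /andP[_].
  by rewrite ltNge ha.
have N4 j : a / 4 <= (N j)%:R * h j.
  have /andP[_ /ltW] := Nitv j; rewrite -(@natr1 R (N j)) mulrDl mul1r => H.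
  have : h j <= (N j)%:R * h j by rewrite ler_peMl ?ler1n// ltW.
  lra.
pose T := {dffun forall j : 'I_d, 'I_(N j)}.
have cardT : #|{: T}| = (\prod_j N j)%N.
  rewrite card_dep_ffun foldrE big_map big_enum/=.
  by apply: eq_bigr => j _; rewrite card_ord.
have IT : (#|I| <= #|{: T}|)%N.
  rewrite cardT -(ler_nat R) natr_prod.
  rewrite -(ler_pM2r (_ : 0 < \prod_j h j)); last by apply: prodr_gt0 => j _.
  rewrite -big_split/= (le_trans cardI)//.
  rewrite -[d in _ ^+ d]card_ord -prodr_const; apply: ler_prod => j _.
  rewrite N4 andbT divr_ge0//.
  by have := le_trans (ltW (h0 j)) (ha j); lra.
pose f (i : I) : T := enum_val (widen_ord IT (enum_rank i)).
have finj : injective f.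
  by move=> i i' /enum_val_inj/(congr1 val)/= /val_inj/enum_rank_inj.
exists (fun i j => a / 4 + (f i j : nat)%:R * h j); split.
  move=> i j; split.
    by rewrite lerDl mulr_ge0// ltW.
  have : ((f i j : nat).+1%:R : R) * h j <= (N j)%:R * h j.
    by rewrite ler_pM2r// ler_nat ltn_ord.
  have /andP[Na _] := Nitv j.
  by rewrite -(@natr1 R (f i j)) mulrDl mul1r; lra.
have half m m' x j : box (fun j => a / 4 + (f m j : nat)%:R * h j) h x ->
   box (fun j => a / 4 + (f m' j : nat)%:R * h j) h x -> (f m j <= f m' j)%N.
  move=> /(_ j)/andP[x1 x2] /(_ j)/andP[x3 x4]; rewrite leqNgt; apply/negP => lt.
  have : ((f m' j : nat).+1%:R : R) * h j <= (f m j : nat)%:R * h j.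
    by rewrite ler_pM2r// ler_nat.
  by rewrite -(@natr1 R (f m' j)) mulrDl mul1r; lra.
move=> m m' x xm xm'; apply: finj; apply/ffunP => j; apply/val_inj/eqP.
by rewrite eqn_leq !(half _ _ x).
Qed.

(** The farther of the two values is at distance at least [c / 2]. *)
Lemma powR_separation (R : realType) (p c F P Q : R) : 0 <= p -> 0 <= c ->
  c <= `|P - Q| -> (c / 2) `^ p <= `|F - P| `^ p + `|F - Q| `^ p.
Proof.
move=> p0 c_ge0 cPQ.
have uv : c <= `|F - P| + `|F - Q|.
  rewrite (le_trans cPQ)// (_ : P - Q = (F - Q) - (F - P)); last by ring.
  by rewrite (le_trans (ler_normB _ _))// addrC.
have [huv|huv] := leP `|F - P| `|F - Q|.
  apply: (@le_trans _ _ (`|F - Q| `^ p)); last by rewrite lerDr powR_ge0.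
  by apply: ge0_ler_powR; rewrite ?nnegrE ?divr_ge0//; lra.
apply: (@le_trans _ _ (`|F - P| `^ p)); last by rewrite lerDl powR_ge0.
by apply: ge0_ler_powR; rewrite ?nnegrE ?divr_ge0//; lra.
Qed.

Lemma exists_ge_average (R : realType) (T : finType) (t0 : T) (G : T -> \bar R) (c : R) :
  ((#|T|%:R * c)%:E <= \sum_t G t)%E -> exists t, (c%:E <= G t)%E.
Proof.
move=> H.
have [t _ tmax] := @Order.TotalTheory.arg_maxP _ _ T t0 xpredT G isT.
exists t.
have T0 : (0 < #|T|)%N by apply/card_gt0P; exists t0.
have T0' : (0 < #|T|%:R%:E :> \bar R)%E by rewrite lte_fin ltr0n.
rewrite -(lee_pmul2l _ T0')//.
rewrite -EFinM (le_trans H)//.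
apply: (@le_trans _ _ (\sum_(i : T) G t)%E); first by apply: lee_sum => i _; exact: tmax.
by rewrite sumr_const mule_natl.
Qed.

(** The hypothesis averages over the letters of one position [i], the rest of the
word being fixed. As each [u i b] permutes the words, summing over all words turns
these bounds into one for the sum over positions; hence a single word is bad at all
positions together. *)
Lemma double_average (R : realType) (W I B : finType) (w0 : W) (G : I -> W -> \bar R)
    (u : I -> B -> W -> W) (c : R) :
  (0 < #|B|)%N ->
  (forall i b, injective (u i b)) -> (forall i w, 0 <= G i w)%E ->
  (forall i w, ((c * #|B|%:R)%:E <= \sum_b G i (u i b w))%E) ->
  exists w, ((#|I|%:R * c)%:E <= \sum_i G i w)%E.
Proof.
move=> B0 uinj G0 Hc; apply: exists_ge_average => //.
have B0' : (0 < #|B|%:R%:E :> \bar R)%E by rewrite lte_fin ltr0n.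
rewrite -(lee_pmul2l _ B0')//.
apply: (@le_trans _ _ (\sum_(w : W) \sum_(i : I) (c * #|B|%:R)%:E)%E).
  under eq_bigr do rewrite sumEFin sumr_const.
  rewrite sumEFin sumr_const -[in leRHS]mulr_natl -[in leRHS](mulr_natl (c * _)) -EFinM lee_fin.
  rewrite le_eqVlt; apply/orP; left; apply/eqP; ring.
apply: (@le_trans _ _ (\sum_(w : W) \sum_(i : I) \sum_b G i (u i b w))%E).
  by apply: lee_sum => w _; apply: lee_sum => i _.
have -> : (\sum_(w : W) \sum_(i : I) \sum_b G i (u i b w) =
    \sum_(i : I) \sum_(b : B) \sum_(w : W) G i w)%E.
  rewrite exchange_big/=; apply: eq_bigr => i _.
  rewrite exchange_big/=; apply: eq_bigr => b _.
  by rewrite [RHS](reindex_inj (uinj i b)).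
rewrite [in leRHS]exchange_big/= ge0_sume_distrr; last first.
  by move=> i _; exact: sume_ge0.
apply: lee_sum => i _.
by rewrite sumr_const mule_natl.
Qed.

Lemma holder_rescale (R : realType) (x E t b u a l : R) : 0 < a ->
  x * E * t <= l * a `^ b -> x * E * (`|u| / a) `^ b * t <= l * `|u| `^ b.
Proof.
move=> a0 H; rewrite mulrAC.
have -> : `|u| `^ b = a `^ b * (`|u| / a) `^ b.
  by rewrite -powRM ?divr_ge0 ?(ltW a0)// [a * _]mulrC divfK// gt_eqF.
by rewrite mulrA ler_wpM2r ?powR_ge0.
Qed.

Lemma fano_arith (R : realType) (X Y : R) : X <= 5 / 8 * Y -> Y / 8 <= 3 / 4 * Y - X.
Proof. by lra. Qed.

Section hypotheses.
Context (R : realType) (d k : nat) (psi : bump_profile R k).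
Local Notation c0 := (profile_low psi).
Local Notation C := (profile_holder psi).
Context (a A : R) (h : 'I_d -> R) (S K' : nat) (z : 'I_S * 'I_K'.+1 -> 'I_d -> R).
Local Notation K := K'.+1.
Local Notation V := (\prod_j h j).
Context (a0 : 0 < a) (A0 : 0 <= A) (h0 : forall j, 0 < h j)
  (z_in : forall i j, a / 4 <= z i j /\ z i j + h j <= 3 / 4 * a)
  (z_disj : forall m m' (x : Rn R d), box (z m) h x -> box (z m') h x -> m = m')
  (kappa_le : A * S%:R * V <= 1 / 2).

Implicit Types (w : {ffun 'I_S -> 'I_K}) (m : 'I_S) (b c : 'I_K).

Definition kappa := A * S%:R * mass psi h.

Definition base (x : Rn R d) : R :=
  box_bump psi (fun=> 0) (fun=> a) x / mass psi (fun _ : 'I_d => a).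

(** Scaling down by [1 - kappa] makes up for the mass of the bumps, which can
therefore all be nonnegative. *)
Definition perturbed (w : {ffun 'I_S -> 'I_K}) (x : Rn R d) : R :=
  (1 - kappa) * base x + A * \sum_(m < S) box_bump psi (z (m, w m)) h x.

Let c0_gt0 : 0 < c0. Proof. by have /andP[] := profile_low_itv psi. Qed.

Lemma kappa_itv : 0 <= kappa <= 1 / 2.
Proof.
have [_ m1 m2] := mass_bounds psi h0.
have V0 : 0 <= V by apply: prodr_ge0 => j _; exact: ltW.
rewrite /kappa mulr_ge0 ?mulr_ge0//=; last first.
  by apply: le_trans m1; rewrite mulr_ge0// exprn_ge0// divr_ge0// ltW.
by apply: le_trans kappa_le; rewrite ler_wpM2l// mulr_ge0.
Qed.

Lemma mass_base : (c0 / 2 * a) ^+ d <= mass psi (fun _ : 'I_d => a) <= a ^+ d.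
Proof.
have [_ m1 m2] := mass_bounds psi (h := fun _ : 'I_d => a) (fun=> a0).
by move: m1 m2; rewrite prodr_const card_ord -exprMn => -> ->.
Qed.

Lemma mass_base_gt0 : 0 < mass psi (fun _ : 'I_d => a).
Proof.
have /andP[m1 _] := mass_base; apply: lt_le_trans m1.
by rewrite exprn_gt0// mulr_gt0// divr_gt0.
Qed.

Lemma base_ge0 x : 0 <= base x.
Proof. by rewrite divr_ge0 ?bump_ge0// ltW// mass_base_gt0. Qed.

Lemma measurable_base : measurable_fun setT base.
Proof. by apply: measurable_funM => //; exact: measurable_bump. Qed.

Lemma integral_base : (\int[lebesgue R d]_x (base x)%:E = 1)%E.
Proof.
have [mE _ _] := mass_bounds psi (h := fun _ : 'I_d => a) (fun=> a0).
under eq_integral do rewrite EFinM.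
rewrite ge0_integralZr//; last 3 first.
- by apply/measurable_EFinP; exact: measurable_bump.
- by move=> x _; rewrite lee_fin bump_ge0.
- by rewrite lee_fin invr_ge0 ltW// mass_base_gt0.
by rewrite mE -EFinM divff// gt_eqF// mass_base_gt0.
Qed.

Lemma measurable_perturbed w : measurable_fun setT (perturbed w).
Proof.
apply: measurable_funD; first by apply: measurable_funM => //; exact: measurable_base.
by apply: measurable_bump_sum.
Qed.

Lemma perturbed_ge0 w x : 0 <= perturbed w x.
Proof.
have /andP[k0 k1] := kappa_itv.
by apply: addr_ge0; apply: mulr_ge0 => //; [lra|exact: base_ge0|exact: bump_sum_ge0].
Qed.

Lemma integral_perturbed w : (\int[lebesgue R d]_x (perturbed w x)%:E = 1)%E.
Proof.
have /andP[k0 k1] := kappa_itv.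
have k2 : 0 <= 1 - kappa by lra.
have mb : measurable_fun setT (EFin \o base).
  by apply/measurable_EFinP; exact: measurable_base.
under eq_integral do rewrite EFinD EFinM (EFinM A) -sumEFin.
have mB i : measurable_fun setT (fun x => (box_bump psi (z (i, w i)) h x)%:E).
  by apply/measurable_EFinP; exact: measurable_bump.
rewrite ge0_integralD//; last 4 first.
- by move=> x _; rewrite mule_ge0 ?lee_fin ?base_ge0.
- exact: emeasurable_funM.
- move=> x _; rewrite mule_ge0 ?lee_fin// sume_ge0// => i _.
  by rewrite lee_fin bump_ge0.
- by apply: emeasurable_funM => //; exact: emeasurable_sum.
rewrite ge0_integralZl//; last by move=> x _; rewrite lee_fin base_ge0.
rewrite integral_base mule1 ge0_integralZl//; last 2 first.
- exact: emeasurable_sum.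
- by move=> x _; rewrite sume_ge0// => i _; rewrite lee_fin bump_ge0.
rewrite ge0_integral_sum//; last by move=> i x _; rewrite lee_fin bump_ge0.
have [mE _ _] := mass_bounds psi h0.
under eq_bigr do rewrite mE.
rewrite sumEFin sumr_const card_ord -EFinM -EFinD -(mulr_natl (mass psi h)) mulrA.
by rewrite -/kappa subrK.
Qed.

Definition dens w : density R d :=
  Density (measurable_perturbed w) (perturbed_ge0 w) (integral_perturbed w).

(** A lower bound for the perturbed densities on the boxes, which lie in the
middle cube where [base] is not small. *)
Definition level : R := (c0 / a) ^+ d / 2.

Lemma level_gt0 : 0 < level.
Proof. by rewrite divr_gt0// exprn_gt0// divr_gt0. Qed.

Lemma perturbed_ge_level w i x : box (z i) h x -> level <= perturbed w x.
Proof.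
move=> bx; have /andP[k0 k1] := kappa_itv.
apply: (@le_trans _ _ ((1 - kappa) * base x)); last first.
  by rewrite lerDl mulr_ge0// bump_sum_ge0.
rewrite /level mulrC; apply: ler_pM.
- by rewrite invr_ge0.
- by rewrite exprn_ge0// divr_ge0 ?ltW.
- lra.
have bm : c0 ^+ d <= box_bump psi (fun=> 0) (fun=> a) x.
  apply: bump_mid => // j; have /andP[x1 x2] := bx j; have [z1 z2] := z_in i j.
  by apply/andP; split; rewrite /mid; lra.
rewrite expr_div_n ler_pM//; first by rewrite exprn_ge0// ltW.
  by rewrite invr_ge0 exprn_ge0// ltW.
have /andP[_ m2] := mass_base.
by rewrite lef_pV2 ?posrE ?mass_base_gt0 ?exprn_gt0.
Qed.

(** Letters are added modulo [K], so that [upd] permutes the words. *)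
Definition upd (w : {ffun 'I_S -> 'I_K}) (m : 'I_S) (b : 'I_K) : {ffun 'I_S -> 'I_K} :=
  [ffun i => if i == m then w m + b else w i].

Lemma upd_inj m b : injective (fun w => upd w m b).
Proof.
move=> w w' /ffunP E; apply/ffunP => i; have := E i; rewrite !ffunE.
by case: eqP => [-> /addIr|].
Qed.

Lemma updE w m b : upd w m b m = w m + b.
Proof. by rewrite ffunE eqxx. Qed.

Lemma perturbed_upd w m b x : perturbed (upd w m b) x =
  perturbed w x + A * (box_bump psi (z (m, w m + b)) h x - box_bump psi (z (m, w m)) h x).
Proof.
rewrite /perturbed -addrA -mulrDr; congr (_ + A * _).
rewrite (bigD1 m)//= [in RHS](bigD1 m)//= updE.
rewrite (eq_bigr (fun i => box_bump psi (z (i, w i)) h x)); last first.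
  by move=> i im; rewrite ffunE (negPf im).
by ring.
Qed.

Lemma perturbed_upd_out w m b x : ~ box (z (m, w m + b)) h x -> ~ box (z (m, w m)) h x ->
  perturbed (upd w m b) x = perturbed w x.
Proof. by move=> n1 n2; rewrite perturbed_upd !bump_out// subrr mulr0 addr0. Qed.

Lemma perturbed_upd0 w m b x : perturbed w x = 0 -> perturbed (upd w m b) x = 0.
Proof.
move=> w0; have [b1|n1] := pselect (box (z (m, w m + b)) h x).
  by have := perturbed_ge_level w b1; rewrite w0 leNgt level_gt0.
have [b2|n2] := pselect (box (z (m, w m)) h x).
  by have := perturbed_ge_level w b2; rewrite w0 leNgt level_gt0.
by rewrite perturbed_upd_out.
Qed.

(** A new letter moves one bump, which alters the density on two boxes. *)
Lemma chi2_perturbed w m b :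
  (\int[law (dens w)]_x ((perturbed (upd w m b) x / perturbed w x) ^+ 2)%:E <=
   (1 + A ^+ 2 / level * (2 * V))%:E)%E.
Proof.
apply: (@chi2_le R d (dens (upd w m b)) (dens w)
  (box (z (m, w m + b)) h `|` box (z (m, w m)) h)).
- by apply: measurableU; exact: measurable_box.
- have lb i : lebesgue R d (box (z i) h) = V%:E.
    by apply: lebesgue_box => j; exact: ltW.
  have /le_trans := measureU2 (lebesgue R d) (measurable_box (z (m, w m + b)) h)
    (measurable_box (z (m, w m)) h).
  apply; apply: (@le_trans _ _ (V%:E + V%:E)%E).
    by apply: leeD; [rewrite -(lb (m, w m + b))|rewrite -(lb (m, w m))].
  by rewrite -EFinD lee_fin; lra.
- exact: level_gt0.
- by move=> x [] bx /=; apply: perturbed_ge_level bx.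
- move=> x _ /=; rewrite perturbed_upd addrC addKr normrM ger0_norm//.
  rewrite ler_piMr// ler_norml.
  have := bump_ge0 psi (z (m, w m + b)) h x; have := bump_le1 psi (z (m, w m + b)) h x.
  have := bump_ge0 psi (z (m, w m)) h x; have := bump_le1 psi (z (m, w m)) h x.
  by move=> ? ? ? ?; apply/andP; split; lra.
- by move=> x /not_orP[n1 n2] /=; rewrite perturbed_upd_out.
Qed.

Section loss.
Context (n : nat) (ft : n.-tuple (Rn R d) -> Rn R d -> R) (p : R).
Context (mft : estimators ft) (p1 : 1 <= p).

(** The places where the bump of position [m] may be, cut down to where it would
not be small. *)
Definition cell (m : 'I_S) : set (Rn R d) :=
  \bigcup_(b in [set: 'I_K]) box (mid (z (m, b)) h) (fun j => h j / 2).

Definition cell_loss m w (t : n.-tuple (Rn R d)) : \bar R :=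
  (\int[lebesgue R d]_x (\1_(cell m) x * `|ft t x - perturbed w x| `^ p)%:E)%E.

Lemma measurable_cell m : measurable (cell m).
Proof.
apply: fin_bigcup_measurable; first exact: finite_finset.
by move=> b _; exact: measurable_box.
Qed.

Lemma lebesgue_cell_le m :
  (lebesgue R d (cell m) <= (K%:R * (2^-1 ^+ d * V))%:E)%E.
Proof.
have mQ b : measurable (box (mid (z (m, b)) h) (fun j => h j / 2)) by exact: measurable_box.
rewrite -[cell m]setIT -integral_indic//; last exact: measurable_cell.
apply: (@le_trans _ _ (\int[lebesgue R d]_x \sum_(b < K)
    (\1_(box (mid (z (m, b)) h) (fun j => h j / 2)) x)%:E)%E).
  apply: ge0_le_integral => //.
  - by apply/measurable_EFinP; apply: measurable_indic; exact: measurable_cell.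
  - by apply: emeasurable_sum => b; apply/measurable_EFinP.
  - move=> x _; rewrite sumEFin lee_fin indicE.
    have [[b _ bx]|nx] := pselect (cell m x); last first.
      by rewrite memNset// sumr_ge0.
    rewrite mem_set; last by exists b.
    rewrite (bigD1 b)//= indicE mem_set// lerDl; exact: sumr_ge0.
rewrite ge0_integral_sum//; last by move=> b; apply/measurable_EFinP.
apply: (@le_trans _ _ (\sum_(b < K) (2^-1 ^+ d * V)%:E)%E); last first.
  by rewrite sumEFin sumr_const card_ord mulr_natl.
apply: lee_sum => b _; rewrite integral_indic// setIT.
apply: (@le_trans _ _ (\prod_j (h j / 2))%:E).
  have E1 : lebesgue R d (box (mid (z (m, b)) h) (fun j => h j / 2)) = (\prod_j (h j / 2))%:E.
    by apply: lebesgue_box => j; rewrite divr_ge0// ltW.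
  by rewrite -E1.
by rewrite lee_fin big_split/= prodr_const card_ord mulrC.
Qed.

Lemma cell_loss_ge0 m w t : (0 <= cell_loss m w t)%E.
Proof. by apply: integral_ge0 => x _; rewrite lee_fin mulr_ge0 ?powR_ge0. Qed.

Let measurable_error w : measurable_fun setT
  (fun y : n.-tuple (Rn R d) * Rn R d => `|ft y.1 y.2 - perturbed w y.2| `^ p).
Proof.
apply: (measurableT_comp (measurable_powR _)); apply: measurableT_comp => //.
apply: measurable_funB; first exact: mft.
by apply: measurableT_comp; [exact: measurable_perturbed|exact: measurable_snd].
Qed.

Lemma measurable_cell_error m w : measurable_fun setT
  (fun y : n.-tuple (Rn R d) * Rn R d =>
    (\1_(cell m) y.2 * `|ft y.1 y.2 - perturbed w y.2| `^ p)%:E).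
Proof.
apply/measurable_EFinP; apply: measurable_funM => //.
apply: (@measurableT_comp _ _ _ _ _ _ (\1_(cell m) : Rn R d -> R)).
  by apply: measurable_indic; exact: measurable_cell.
exact: measurable_snd.
Qed.

Lemma measurable_cell_loss m w : measurable_fun setT (cell_loss m w).
Proof.
apply: (@measurable_fun_fubini_tonelli_F _ _ _ _ _ (lebesgue R d)
  (fun y => (\1_(cell m) y.2 * `|ft y.1 y.2 - perturbed w y.2| `^ p)%:E)).
- exact: measurable_cell_error.
- by move=> y; rewrite lee_fin mulr_ge0 ?powR_ge0.
Qed.

(** Half of the height of a bump near its centre, to the power [p], times the volume
on which that height is reached. *)
Definition separation : R := (A * c0 ^+ d / 2) `^ p * (2^-1 ^+ d * V).

Lemma separation_ge0 : 0 <= separation.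
Proof.
rewrite mulr_ge0 ?powR_ge0// mulr_ge0 ?exprn_ge0//.
by apply: prodr_ge0 => j _; exact: ltW.
Qed.

(** For two letters, on the middle of the box that belongs to the first one, one
density carries a bump and the other does not. *)
Lemma cell_loss_separated w m (b c : 'I_K) t : b != c ->
  (separation%:E <= cell_loss m (upd w m b) t + cell_loss m (upd w m c) t)%E.
Proof.
move=> bc.
have merr w' : measurable_fun setT
    (fun x => (\1_(cell m) x * `|ft t x - perturbed w' x| `^ p)%:E).
  exact: (measurableT_comp (measurable_cell_error m w') (pair1_measurable t)).
have err0 w' x : (0 <= (\1_(cell m) x * `|ft t x - perturbed w' x| `^ p)%:E)%E.
  by rewrite lee_fin mulr_ge0 ?powR_ge0.
rewrite /cell_loss -ge0_integralD//.
set Q := box (mid (z (m, w m + b)) h) (fun j => h j / 2).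
have mQ : measurable Q by exact: measurable_box.
have -> : separation%:E =
    (\int[lebesgue R d]_x ((A * c0 ^+ d / 2) `^ p * \1_Q x)%:E)%E.
  under eq_integral do rewrite EFinM.
  rewrite ge0_integralZl//; last 2 first.
  - by apply/measurable_EFinP.
  - by rewrite lee_fin powR_ge0.
  rewrite integral_indic// setIT.
  transitivity (((A * c0 ^+ d / 2) `^ p)%:E * (\prod_j (h j / 2))%:E)%E.
    by rewrite -EFinM /separation big_split/= prodr_const card_ord [X in _ * X]mulrC.
  congr (_ * _)%E; apply/esym/lebesgue_box => j.
  by rewrite divr_ge0// ltW.
apply: ge0_le_integral => //.
- by move=> x _; rewrite lee_fin mulr_ge0 ?powR_ge0.
- by apply/measurable_EFinP; apply: measurable_funM.
- exact: emeasurable_funD.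
move=> x _; rewrite -EFinD lee_fin -mulrDr.
have [Qx|nQx] := pselect (Q x); last first.
  by rewrite indicE memNset// mulr0 mulr_ge0 ?addr_ge0 ?powR_ge0.
rewrite !indicE !mem_set//; last by exists (w m + b).
rewrite mulr1 mul1r.
have diff : A * c0 ^+ d <= `|perturbed (upd w m b) x - perturbed (upd w m c) x|.
  rewrite !perturbed_upd.
  have -> : box_bump psi (z (m, w m + c)) h x = 0.
    apply: bump_out => // xc.
    have /(congr1 snd)/= /addrI bc' := z_disj (mid_sub h0 Qx) xc.
    by rewrite bc' eqxx in bc.
  rewrite (_ : _ - _ = A * box_bump psi (z (m, w m + b)) h x); last by ring.
  rewrite normrM (ger0_norm A0) ler_wpM2l// ger0_norm ?bump_ge0//.
  exact: bump_mid.
have Ac0 : 0 <= A * c0 ^+ d by rewrite mulr_ge0// exprn_ge0// ltW.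
by apply: powR_separation => //; rewrite (le_trans ler01).
Qed.

Context (infoP : (1 + A ^+ 2 / level * (2 * V)) ^+ n <= 5 / 8 * K%:R).

(** The reference density is that of the word [w] itself: the alternatives differ
from it by one letter, so one divergence bound serves them all. *)
Lemma fano_cell w m :
  ((separation / 16 * K%:R)%:E <=
   \sum_(b < K) \int[sample_law (dens (upd w m b)) n]_t cell_loss m (upd w m b) t)%E.
Proof.
apply: le_trans (@fano_densities R d K _ (fun b => dens (upd w m b)) (dens w) n
  (fun b => cell_loss m (upd w m b)) separation
  (1 + A ^+ 2 / level * (2 * V)) _ _ _ _ _ _) => //.
- rewrite lee_fin (_ : _ / 16 * _ = separation / 2 * (K%:R / 8)); last by field.
  apply: ler_wpM2l; first by rewrite divr_ge0 ?separation_ge0.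
  exact: fano_arith infoP.
- exact: separation_ge0.
- by move=> b x; exact: perturbed_upd0.
- by move=> b; exact: chi2_perturbed.
- by move=> b; exact: measurable_cell_loss.
- by move=> b t; exact: cell_loss_ge0.
- by move=> b c t; exact: cell_loss_separated.
Qed.

Lemma average_cell_loss : exists w,
  ((S%:R * (separation / 16))%:E <=
   \sum_(m < S) \int[sample_law (dens w) n]_t cell_loss m w t)%E.
Proof.
rewrite -[X in X%:R * _](card_ord S).
apply: (@double_average R _ _ 'I_K [ffun=> ord0]
  (fun m w => \int[sample_law (dens w) n]_t cell_loss m w t)%E (fun m b w => upd w m b)).
- by rewrite card_ord.
- by move=> m b; exact: upd_inj.
- by move=> m w; apply: integral_ge0 => t _; exact: cell_loss_ge0.
- by move=> m w; rewrite card_ord; exact: fano_cell.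
Qed.

End loss.

Section membership.
Context (beta L : 'I_d -> R) (r : 'I_d -> \bar R) (M tau : R).
Local Notation cg := ((2 / (c0 * a)) ^+ d).
Local Notation E := (k.+1%:R ^+ 2 * C).
Context (beta_itv : forall j, 0 < beta j <= k%:R) (beta_lt : forall j, beta j < k%:R)
  (r1 : forall j, (1 <= r j)%E)
  (tauP : S%:R * V <= tau)
  (normP : forall j, (r j = 1%E /\ 1 <= L j) \/
    (cg * (a ^+ d) `^ rinv (r j) <= L j / 2 /\ A * tau `^ rinv (r j) <= L j / 2))
  (smooth_base : forall j, cg * E * (a ^+ d) `^ rinv (r j) <= L j / 2 * a `^ beta j)
  (smooth_bumps : forall j, A * E * tau `^ rinv (r j) <= L j / 2 * h j `^ beta j)
  (supP : cg + A <= M).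

(** The base density is a sum of bumps as well, over a one-point index, so that the
norm bounds for bump sums cover both terms. *)
Lemma perturbedE w : perturbed w =
  (fun x => (1 - kappa) / mass psi (fun _ : 'I_d => a) *
            \sum_(m : unit) box_bump psi (fun=> 0) (fun=> a) x) \+
  (fun x => A * \sum_(m < S) box_bump psi (z (m, w m)) h x).
Proof.
apply/funext => x; rewrite /perturbed /base /= big_const card_unit /= addr0.
by congr (_ + _); rewrite mulrA mulrAC.
Qed.

Lemma base_level : 0 <= (1 - kappa) / mass psi (fun _ : 'I_d => a) <= cg.
Proof.
have /andP[k0 k1] := kappa_itv; have m0 := mass_base_gt0.
have /andP[m1 _] := mass_base.
have k2 : 0 <= 1 - kappa by lra.
rewrite divr_ge0 ?(ltW m0)//= ler_pdivrMr//.
apply: (@le_trans _ _ (cg * (c0 / 2 * a) ^+ d)).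
  rewrite -exprMn (_ : 2 / (c0 * a) * (c0 / 2 * a) = 1) ?expr1n; first lra.
  by field; rewrite (gt_eqF a0) (gt_eqF c0_gt0).
by apply: ler_wpM2l m1; rewrite exprn_ge0// divr_ge0// mulr_ge0// ltW.
Qed.

Lemma Lp_norm_perturbed w q : (1 <= q)%E ->
  (Lp_norm q (perturbed w) <= (cg * (a ^+ d) `^ rinv q + A * tau `^ rinv q)%:E)%E.
Proof.
move=> q1; have /andP[l0 l1] := base_level.
rewrite perturbedE EFinD; apply: le_trans (eminkowski _ _ _ _) _ => //.
- by apply: (measurable_bump_sum psi (fun _ : unit => fun=> 0)).
- exact: (measurable_bump_sum psi (fun m => z (m, w m))).
apply: leeD.
  apply: le_trans (Lp_norm_bump_sum psi (fun=> a0) l0 _ _ q1) _.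
  - by move=> [] [].
  - by rewrite card_unit mul1r prodr_const card_ord.
  by rewrite lee_fin ler_wpM2r ?powR_ge0.
apply: (Lp_norm_bump_sum psi h0 A0 _ _ q1).
- by move=> m m' x b1 b2; have [] := z_disj b1 b2.
- by rewrite card_ord.
Qed.

Lemma Lp_norm_difference_perturbed w j u :
  (Lp_norm (r j) (iter k (difference u j) (perturbed w)) <= (L j * `|u| `^ beta j)%:E)%E.
Proof.
have /andP[l0 l1] := base_level; have /andP[b0 bk] := beta_itv j.
have E0 : 0 <= E by rewrite mulr_ge0 ?exprn_ge0 ?ltW ?profile_holder_gt0.
rewrite perturbedE (_ : iter _ _ _ =
  iter k (difference u j) (fun x => (1 - kappa) / mass psi (fun _ : 'I_d => a) *
            \sum_(m : unit) box_bump psi (fun=> 0) (fun=> a) x) \+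
  iter k (difference u j) (fun x => A * \sum_(m < S) box_bump psi (z (m, w m)) h x)); last first.
  by apply/funext => x; rewrite iter_differenceD.
apply: le_trans (eminkowski _ _ _ _) _ => //.
- apply: measurable_iter_difference.
  by apply: (measurable_bump_sum psi (fun _ : unit => fun=> 0)).
- apply: measurable_iter_difference.
  exact: (measurable_bump_sum psi (fun m => z (m, w m))).
rewrite [in leRHS](splitr (L j)) [in leRHS]mulrDl EFinD; apply: leeD.
  apply: le_trans (Lp_norm_difference_bump_sum psi (fun=> a0) l0 _ _ u j (r1 j) b0 bk) _.
  - by move=> [] [].
  - by rewrite card_unit mul1r prodr_const card_ord.
  rewrite lee_fin; apply: holder_rescale => //.
  apply: le_trans (smooth_base j); apply: ler_wpM2r; first exact: powR_ge0.
  exact: ler_wpM2r.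
apply: le_trans (Lp_norm_difference_bump_sum psi (tau := tau) h0 A0 _ _ u j (r1 j) b0 bk) _.
- by move=> m m' x b1 b2; have [] := z_disj b1 b2.
- by rewrite card_ord.
by rewrite lee_fin; apply: holder_rescale.
Qed.

(** If [r j = 1] the norm to be bounded is exactly one, and [1 <= L j] is the best
possible condition; the triangle inequality would lose a constant. *)
Lemma perturbed_nikolskii w : nikolskii_bounded r beta L M (perturbed w).
Proof.
split; last first.
  rewrite /=; apply: le_trans (Lp_norm_perturbed w (leey _)) _.
  by rewrite /rinv invey !powRr0 !mulr1 lee_fin.
split; first exact: measurable_perturbed.
move=> j; split; last first.
  by exists k; split => // u; exact: Lp_norm_difference_perturbed.
case: (normP j) => [[-> L1]|[n1 n2]].
  rewrite /Lp_norm Lnorm1.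
  under eq_integral do rewrite /= ger0_norm ?perturbed_ge0//.
  by rewrite integral_perturbed lee_fin.
by apply: le_trans (Lp_norm_perturbed w (r1 j)) _; rewrite lee_fin; lra.
Qed.

End membership.
End hypotheses.

(** * From the family to the minimax risks *)

(** The integral of a nonnegative function is a supremum over the simple functions
below it, so monotonicity holds without measurability. This spares the
measurability of losses as functions of the sample. *)
Lemma ge0_le_integral_nomeas (dT : measure_display) (T : measurableType dT)
    (R : realType) (mu : {measure set T -> \bar R}) (f g : T -> \bar R) :
  (forall x, 0 <= f x)%E -> (forall x, f x <= g x)%E ->
  (\int[mu]_x f x <= \int[mu]_x g x)%E.
Proof.
move=> f0 fg; have g0 x : (0 <= g x)%E by exact: le_trans (f0 x) (fg x).
rewrite !ge0_integralTE//; apply: ereal_sup_le => _ [h /= hf <-].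
by exists h => // x; exact: le_trans (hf x) (fg x).
Qed.

Lemma integral_le_ess_sup (R : realType) (d : nat) (D : set (Rn R d)) (W : R) (g : Rn R d -> R) :
  measurable D -> (0 < lebesgue R d D)%E -> (lebesgue R d D <= W%:E)%E -> measurable_fun setT g ->
  (\int[lebesgue R d]_x (\1_D x * `|g x|)%:E <= W%:E * Lp_norm +oo g)%E.
Proof.
move=> mD D0 DW mg.
have T0 : (0 < lebesgue R d setT)%E.
  by apply: (lt_le_trans D0); apply: le_measure; rewrite ?inE.
rewrite /Lp_norm unlock T0.
set s := ess_sup _ _.
have s0 : (0 <= s)%E by apply: ess_sup_gee => //; apply: nearW => x /=.
apply: (@le_trans _ _ (lebesgue R d D * s)%E); last exact: lee_wpmul2r.
have -> : (lebesgue R d D * s = \int[lebesgue R d]_x ((\1_D x)%:E * s))%E.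
  rewrite ge0_integralZr//; last by apply/measurable_EFinP.
  by rewrite integral_indic// setIT.
apply: ae_ge0_le_integral => //.
- by apply/measurable_EFinP; apply: measurable_funM => //; exact: measurableT_comp.
- by move=> x _; rewrite mule_ge0// lee_fin.
- by apply: emeasurable_funM => //; apply/measurable_EFinP.
have := @ess_sup_ge _ _ _ (lebesgue R d) (abse \o (EFin \o g)).
apply: filterS => x /= gs _.
by rewrite EFinM lee_wpmul2l// lee_fin.
Qed.

Section minimax.
Context (R : realType) (d k : nat) (psi : bump_profile R k).
Local Notation c0 := (profile_low psi).
Local Notation C := (profile_holder psi).
Context (beta L : 'I_d -> R) (r : 'I_d -> \bar R) (M : R).
Context (a A : R) (h : 'I_d -> R) (S K' n : nat) (tau : R).
Local Notation K := K'.+1.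
Local Notation V := (\prod_j h j).
Local Notation cg := ((2 / (c0 * a)) ^+ d).
Local Notation E := (k.+1%:R ^+ 2 * C).

(** What a choice of the parameters must satisfy: the boxes fit in the cube
([feasible_ha], [feasible_room]), the bumps carry at most half of the mass
([feasible_kappa]), base and bumps use up half of each radius each, and the sample
carries too little information for [K] hypotheses ([feasible_info]). The volume
[tau] only bounds [S * V], so that it can be chosen first and [S] rounded after. *)
Record feasible : Prop := Feasible {
  feasible_a : 0 < a ;
  feasible_A : 0 <= A ;
  feasible_h : forall j, 0 < h j ;
  feasible_ha : forall j, h j <= a / 2 ;
  feasible_room : (S * K)%:R * V <= (a / 4) ^+ d ;
  feasible_kappa : A * S%:R * V <= 1 / 2 ;
  feasible_beta : forall j, 0 < beta j < k%:R ;
  feasible_r : forall j, (1 <= r j)%E ;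
  feasible_tau : S%:R * V <= tau ;
  feasible_norm : forall j, (r j = 1%E /\ 1 <= L j) \/
    (cg * (a ^+ d) `^ rinv (r j) <= L j / 2 /\ A * tau `^ rinv (r j) <= L j / 2) ;
  feasible_base : forall j, cg * E * (a ^+ d) `^ rinv (r j) <= L j / 2 * a `^ beta j ;
  feasible_bumps : forall j, A * E * tau `^ rinv (r j) <= L j / 2 * h j `^ beta j ;
  feasible_sup : cg + A <= M ;
  feasible_info : (1 + A ^+ 2 / level d psi a * (2 * V)) ^+ n <= 5 / 8 * K%:R }.

Context (fe : feasible).

Let cells : exists z : 'I_S * 'I_K -> 'I_d -> R,
   (forall i j, a / 4 <= z i j /\ z i j + h j <= 3 / 4 * a) /\
   (forall m m' (x : Rn R d), box (z m) h x -> box (z m') h x -> m = m').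
Proof.
apply: lattice_cells; [exact: feasible_h fe|exact: feasible_ha fe|].
by rewrite card_prod !card_ord; exact: feasible_room fe.
Qed.

Let V0 : 0 < V. Proof. by apply: prodr_gt0 => j _; exact: feasible_h fe j. Qed.
Let c0_gt0 : 0 < c0. Proof. by have /andP[] := profile_low_itv psi. Qed.

(** The cells of distinct positions are disjoint, so the losses over the cells add up
to at most the whole loss. *)
Lemma minimax_Lp_lower p : 1 <= p ->
  ((c0 ^+ d / 2 * (2^-1 ^+ d / 16) * A * (S%:R * V) `^ p^-1)%:E <=
    minimax_Lp_risk p n (nikolskii_bounded r beta L M))%E.
Proof.
move=> p1; have [z [z_in z_disj]] := cells.
have p0 : 0 < p by exact: lt_le_trans p1.
have A0 := feasible_A fe; have h0 := feasible_h fe.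
apply: le_ereal_inf_tmp => _ [ft mft <-].
have [w Hw] := average_cell_loss (feasible_a fe) A0 h0 z_in z_disj
  (feasible_kappa fe) mft p1 (feasible_info fe).
set f := dens _ _ _ _ _ _ _ in Hw.
have fin_class : nikolskii_bounded r beta L M f.
  apply: (perturbed_nikolskii (feasible_a fe) A0 h0 z_disj (feasible_kappa fe) _ _
    (feasible_r fe) (feasible_tau fe) (feasible_norm fe) (feasible_base fe)
    (feasible_bumps fe) (feasible_sup fe)).
  - by move=> j; have /andP[b1 b2] := feasible_beta fe j; rewrite b1 ltW.
  - by move=> j; have /andP[] := feasible_beta fe j.
apply: (@le_trans _ _ ((\int[sample_law f n]_x (Lp_loss p%:E ft f x `^ p)) `^ p^-1)%E);
  last by apply: ereal_sup_ubound; exists f.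
have : ((S%:R * (separation psi A h p / 16))%:E <=
    \int[sample_law f n]_x (Lp_loss p%:E ft f x `^ p))%E.
  apply: le_trans Hw _.
  rewrite -ge0_integral_sum//; last 2 first.
  - by move=> m; exact: measurable_cell_loss.
  - by move=> m t _; exact: cell_loss_ge0.
  apply: ge0_le_integral_nomeas.
    by move=> t; apply: sume_ge0 => m _; exact: cell_loss_ge0.
  move=> t; rewrite /Lp_loss /Lp_norm poweR_Lnorm ?gt_eqF//.
  rewrite -ge0_integral_sum//; last first.
    move=> m.
    exact: (measurableT_comp (measurable_cell_error psi a A h z p mft m w) (pair1_measurable t)).
  apply: ge0_le_integral_nomeas.
    by move=> x; apply: sume_ge0 => m _; rewrite lee_fin mulr_ge0 ?powR_ge0.
  move=> x; rewrite sumEFin -mulr_suml /= lee_fin ler_piMl ?powR_ge0//.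
  apply: sum_indic_le1 => m m' [b _ xb] [b' _ xb'].
  by have [] := z_disj _ _ _ (mid_sub h0 xb) (mid_sub h0 xb').
move=> Hq; apply: (@le_trans _ _ ((S%:R * (separation psi A h p / 16))%:E `^ p^-1)%E).
  rewrite poweR_EFin lee_fin.
  have S0 : 0 <= S%:R :> R by [].
  have Ac : 0 <= A * c0 ^+ d / 2 by rewrite divr_ge0// mulr_ge0// exprn_ge0// ltW.
  have q0 : 0 <= 2^-1 ^+ d / 16 :> R by rewrite divr_ge0// exprn_ge0.
  have SV0 : 0 <= S%:R * V by rewrite mulr_ge0// ltW.
  have -> : S%:R * (separation psi A h p / 16) =
      (A * c0 ^+ d / 2) `^ p * ((2^-1 ^+ d / 16) * (S%:R * V)).
    by rewrite /separation; ring.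
  rewrite (powRM _ (powR_ge0 _ _) (mulr_ge0 q0 SV0)) -powRrM divff ?gt_eqF// powRr1//.
  rewrite (powRM _ q0 SV0) [leLHS](_ : _ = (A * c0 ^+ d / 2) *
     ((2^-1 ^+ d / 16) * (S%:R * V) `^ p^-1)); last by ring.
  apply: ler_wpM2l => //; apply: ler_wpM2r; first exact: powR_ge0.
  have q1 : 2^-1 ^+ d / 16 <= 1 :> R.
    by rewrite -[leRHS](mulr1 1) ler_pM ?exprn_ge0 ?exprn_ile1//; lra.
  rewrite -[leLHS]powRr1//.
  have [->|qn0] := eqVneq (2^-1 ^+ d / 16 : R) 0.
    by rewrite powRr1// powR_ge0.
  by rewrite ger_powR ?q1 ?andbT ?lt_neqAle ?q0 ?andbT 1?eq_sym// invf_le1.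
apply: gt0_ler_poweR => //.
- by rewrite invr_ge0 ltW.
- rewrite in_itv/= leey andbT lee_fin mulr_ge0// divr_ge0// separation_ge0//.
- by rewrite in_itv/= leey andbT; apply: integral_ge0 => t _; exact: poweR_ge0.
Qed.

(** The mean error over a cell is at most the essential supremum of the error, so the
bound for [p = 1], divided by the volume of the cell, carries over. *)
Lemma minimax_Linf_lower : S = 1%N -> K' = 1%N ->
  ((c0 ^+ d / 64 * A)%:E <= minimax_Linf_risk n (nikolskii_bounded r beta L M))%E.
Proof.
move=> S1 K1; have [z [z_in z_disj]] := cells.
have A0 := feasible_A fe; have h0 := feasible_h fe.
apply: le_ereal_inf_tmp => _ [ft mft <-].
have [w Hw] := average_cell_loss (feasible_a fe) A0 h0 z_in z_disj
  (feasible_kappa fe) mft (lexx 1) (feasible_info fe).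
set f := dens _ _ _ _ _ _ _ in Hw.
have fin_class : nikolskii_bounded r beta L M f.
  apply: (perturbed_nikolskii (feasible_a fe) A0 h0 z_disj (feasible_kappa fe) _ _
    (feasible_r fe) (feasible_tau fe) (feasible_norm fe) (feasible_base fe)
    (feasible_bumps fe) (feasible_sup fe)).
  - by move=> j; have /andP[b1 b2] := feasible_beta fe j; rewrite b1 ltW.
  - by move=> j; have /andP[] := feasible_beta fe j.
apply: (@le_trans _ _ (\int[sample_law f n]_x (Lp_loss +oo%E ft f x))%E);
  last by apply: ereal_sup_ubound; exists f.
pose W : R := 2^-1 ^+ d * V.
have W0 : 0 < W by rewrite mulr_gt0// exprn_gt0.
apply: (@le_trans _ _ (\int[sample_law f n]_t (((2 * W)^-1)%:E *
    \sum_(m < S) cell_loss psi a A h z ft 1 m w t))%E).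
  rewrite ge0_integralZl//; last 3 first.
  - by apply: emeasurable_sum => m; exact: measurable_cell_loss.
  - by move=> t _; apply: sume_ge0 => m _; exact: cell_loss_ge0.
  - by rewrite lee_fin invr_ge0 mulr_ge0// ltW.
  rewrite ge0_integral_sum//; last 2 first.
  - by move=> m; exact: measurable_cell_loss.
  - by move=> m t _; exact: cell_loss_ge0.
  apply: le_trans (lee_wpmul2l _ Hw); last by rewrite lee_fin invr_ge0 mulr_ge0// ltW.
  rewrite -EFinM lee_fin S1 mul1r /separation powRr1; last first.
    by rewrite divr_ge0// mulr_ge0// exprn_ge0// ltW.
  rewrite -/W le_eqVlt; apply/orP; left; apply/eqP; field.
  by rewrite gt_eqF.
apply: ge0_le_integral_nomeas.
  move=> t; apply: mule_ge0; first by rewrite lee_fin invr_ge0 mulr_ge0// ltW.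
  by apply: sume_ge0 => m _; exact: cell_loss_ge0.
move=> t.
set s := Lp_loss _ _ _ _.
have cellW m : (cell_loss psi a A h z ft 1 m w t <= (2 * W)%:E * s)%E.
  rewrite /cell_loss; under eq_integral do rewrite powRr1//.
  apply: integral_le_ess_sup.
  - exact: measurable_cell.
  - apply: (@lt_le_trans _ _ (lebesgue R d (box (mid (z (m, ord0)) h) (fun j => h j / 2)))).
      rewrite lebesgue_box; last by move=> j; rewrite divr_ge0// ltW.
      by rewrite lte_fin; apply: prodr_gt0 => j _; rewrite divr_gt0.
    apply: le_measure; rewrite ?inE; [exact: measurable_box|exact: measurable_cell|].
    by move=> x bx; exists ord0.
  - apply: le_trans (lebesgue_cell_le z h0 m) _; rewrite lee_fin -/W.
    by rewrite (_ : K%:R = 2 :> R)// K1.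
  - apply: measurable_funB; last exact: measurable_perturbed.
    exact: (measurableT_comp mft (pair1_measurable t)).
apply: (@le_trans _ _ (((2 * W)^-1)%:E * \sum_(m < S) ((2 * W)%:E * s))%E).
  by apply: lee_wpmul2l; [rewrite lee_fin invr_ge0 mulr_ge0// ltW|exact: lee_sum].
rewrite sumr_const card_ord S1 mulr1n muleA -EFinM mulVf ?mul1e//.
by rewrite gt_eqF// mulr_gt0.
Qed.

End minimax.

(** * Powers, limits and two-letter families *)

Lemma limn_einf_ge (R : realType) (u : (\bar R)^nat) (c : \bar R) :
  (\forall n \near \oo, c <= u n)%E -> (c <= limn_einf u)%E.
Proof.
move=> cu; rewrite limn_einf_lim; apply: lime_ge; first exact: is_cvg_einfs.
case: cu => N _ cu; exists N => // n /= Nn.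
by apply: le_ereal_inf_tmp => _ [m /= nm <-]; apply: cu; exact: leq_trans nm.
Qed.

Section powers.
Context (R : realType).
Implicit Types (y l e B : R).

Lemma powRDp y a b : 0 < y -> y `^ (a + b) = y `^ a * y `^ b.
Proof. by move=> y0; apply: powRD; apply/implyP => _; rewrite gt_eqF. Qed.

Lemma prod_powR (I : finType) y (f : I -> R) : 0 < y ->
  \prod_i y `^ f i = y `^ (\sum_i f i).
Proof.
move=> y0; elim/big_rec2: _ => [|i u v _ ->]; first by rewrite powRr0.
by rewrite powRDp.
Qed.

Lemma powRK y e : 0 <= y -> e != 0 -> (y `^ e^-1) `^ e = y.
Proof. by move=> y0 e0; rewrite -powRrM mulVf// powRr1. Qed.

Lemma powR_le1 y e : 0 <= y <= 1 -> 0 <= e -> y `^ e <= 1.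
Proof.
move=> /andP[y0 y1] e0; have <- : (1 : R) `^ e = 1 by rewrite powR1.
by apply: ge0_ler_powR; rewrite ?nnegrE.
Qed.

Lemma near_pinfty_powR e B : 0 < e -> \forall a \near +oo, B <= a `^ e.
Proof.
move=> e0; near=> a.
have Ba : Num.max B 0 `^ e^-1 <= a by near: a; apply: nbhs_pinfty_ge; rewrite num_real.
rewrite (@le_trans _ _ (Num.max B 0))//; first by rewrite le_max lexx.
rewrite -[leLHS](@powRK _ e) ?gt_eqF//; last by rewrite le_max lexx orbT.
by apply: ge0_ler_powR; rewrite ?nnegrE ?powR_ge0 ?(ltW e0)// (le_trans (powR_ge0 _ _) Ba).
Unshelve. all: by end_near. Qed.

Lemma near_infty_powR e B : 0 < e -> \forall n \near \oo, B <= (n%:R : R) `^ e.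
Proof.
move=> e0; near=> n.
have Ba : Num.max B 0 `^ e^-1 <= n%:R by near: n; apply: nbhs_infty_ger.
rewrite (@le_trans _ _ (Num.max B 0))//; first by rewrite le_max lexx.
rewrite -[leLHS](@powRK _ e) ?gt_eqF//; last by rewrite le_max lexx orbT.
by apply: ge0_ler_powR; rewrite ?nnegrE ?powR_ge0 ?(ltW e0).
Unshelve. all: by end_near. Qed.

Lemma near_infty_ratio_powR l e B : 0 < l -> 0 < e -> 0 < B ->
  \forall n \near \oo, (l / n%:R) `^ e <= B.
Proof.
move=> l0 e0 B0; near=> n.
have n0 : 0 < n%:R :> R by rewrite ltr0n; near: n; exact: nbhs_infty_gt.
rewrite -[leRHS](@powRK B e (ltW B0)) ?gt_eqF//.
apply: ge0_ler_powR; rewrite ?nnegrE ?powR_ge0 ?(ltW e0) ?divr_ge0 ?(ltW l0)//.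
rewrite ler_pdivrMr// mulrC -ler_pdivrMr ?powR_gt0//.
by near: n; exact: nbhs_infty_ger.
Unshelve. all: by end_near. Qed.

(** [(1 + u)^n <= exp (n u)], and [exp v <= 1 / (1 - v)]. *)
Lemma expr1D_le (u : R) n : 0 <= u -> n%:R * u <= 1 / 5 -> (1 + u) ^+ n <= 5 / 4.
Proof.
move=> u0 nu.
have H : (1 + u) ^+ n <= expR (n%:R * u).
  by rewrite expRM_natl lerXn2r ?nnegrE ?expR_ge0 ?addr_ge0// expR_ge1Dx.
apply: (le_trans H); have := expR_ge1Dx (- (n%:R * u)); rewrite expRN => e1.
have e0 : 0 < expR (n%:R * u) := expR_gt0 _.
have : (1 - n%:R * u) * expR (n%:R * u) <= 1 by rewrite -ler_pdivlMr// div1r.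
nra.
Qed.

End powers.

Section rate_conditions.
Context (R : realType) (d k : nat) (psi : bump_profile R k).
Local Notation c0 := (profile_low psi).
Local Notation C := (profile_holder psi).
Local Notation E := (k.+1%:R ^+ 2 * C).
Context (beta : 'I_d -> R) (r : 'I_d -> \bar R) (M : R).
Context (d_gt0 : (0 < d)%N) (beta_itv : forall j, 0 < beta j < k%:R)
  (r_ge1 : forall j, (1 <= r j)%E) (M_gt0 : 0 < M).
Local Notation rho j := (rinv (r j)).
Local Notation cg a := ((2 / (c0 * a)) ^+ d).
Local Notation x := (inv_beta beta).
Local Notation s1 := (inv_s beta r).

Let c0_gt0 : 0 < c0. Proof. by have /andP[] := profile_low_itv psi. Qed.
Let beta_gt0 j : 0 < beta j. Proof. by have /andP[] := beta_itv j. Qed.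
Let rho_ge0 j : 0 <= rho j. Proof. by have /andP[] := rinv_itv (r_ge1 j). Qed.
Let rho_le1 j : rho j <= 1. Proof. by have /andP[] := rinv_itv (r_ge1 j). Qed.
Let E_gt0 : 0 < E. Proof. by rewrite mulr_gt0 ?exprn_gt0 ?profile_holder_gt0. Qed.

Lemma rinv_lt1 (q : \bar R) : (1 <= q)%E -> q <> 1%E -> rinv q < 1.
Proof.
case: q => [q|_ _|//]; last by rewrite /rinv invey ltr01.
rewrite /rinv lee_fin => q1 qn1; have q0 : 0 < q := lt_le_trans ltr01 q1.
rewrite inver gt_eqF//= invf_lt1// lt_neqAle q1 andbT.
by apply/eqP => q1'; apply: qn1; rewrite -q1'.
Qed.

Lemma inv_beta_gt0 : 0 < x.
Proof.
rewrite /inv_beta (bigD1 (Ordinal d_gt0))//= ltr_pwDl ?invr_gt0//.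
by apply: sumr_ge0 => j _; rewrite invr_ge0 ltW.
Qed.

Lemma inv_s_ge0 : 0 <= s1.
Proof. by apply: sumr_ge0 => j _; rewrite mulr_ge0 ?invr_ge0 ?(ltW (beta_gt0 j))//; exact: rho_ge0. Qed.

Lemma inv_s_le : s1 <= x.
Proof.
by apply: ler_sum => j _; rewrite ler_piMr ?invr_ge0 ?(ltW (beta_gt0 j))//; exact: rho_le1.
Qed.

(** The side [a] of the cube is such that the base density uses up half of each
radius at most. *)
Definition base_ok (L : 'I_d -> R) (a : R) : Prop :=
  [/\ 8 <= a, cg a <= M / 2,
      forall j, r j <> 1%E -> cg a * (a ^+ d) `^ rho j <= L j / 2 &
      forall j, cg a * E * (a ^+ d) `^ rho j <= L j / 2 * a `^ beta j].

(** The base density has height of order [a^-d] on a set of volume [a^d]. So its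
[L_r] norm vanishes as [a] grows, unless [r = 1], and its differences are smaller by
a further factor [a^-beta_j]. *)
Lemma near_base_ok (L0 : R) : 0 < L0 -> \forall a \near +oo, base_ok (fun=> L0) a.
Proof.
move=> L00; pose G := (2 / c0) ^+ d.
have G0 : 0 < G by rewrite exprn_gt0// divr_gt0.
have cgE a : 0 < a -> cg a * a ^+ d = G.
  move=> a0; rewrite -exprMn; congr (_ ^+ d); field.
  by rewrite (gt_eqF a0) (gt_eqF c0_gt0).
have near1 : \forall a \near +oo, forall j, r j <> 1%E -> 2 * G / L0 <= (a ^+ d) `^ (1 - rho j).
  apply: filter_forall => j.
  have [rj1|rj1] := pselect (r j = 1%E); first by near=> a => /(_ rj1).
  have e0 : 0 < d%:R * (1 - rho j).
    by rewrite mulr_gt0 ?ltr0n// subr_gt0 rinv_lt1.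
  near=> a => _.
  have a0 : 0 <= a by near: a; apply: nbhs_pinfty_ge; rewrite num_real.
  rewrite -powR_mulrn// -powRrM; near: a; exact: near_pinfty_powR.
have near2 : \forall a \near +oo, forall j, 2 * G * E / L0 <= a `^ beta j.
  by apply: filter_forall => j; exact: near_pinfty_powR.
near=> a.
have a8 : 8 <= a by near: a; apply: nbhs_pinfty_ge; rewrite num_real.
have a0 : 0 < a by exact: lt_le_trans a8.
have X0 : 0 < a ^+ d by rewrite exprn_gt0.
have X1 : 1 <= a ^+ d by rewrite exprn_ege1// (le_trans _ a8)//; lra.
have cg0 : 0 <= cg a by rewrite exprn_ge0// divr_ge0// mulr_ge0// ltW.
have X : forall e, (a ^+ d) `^ (1 - e) * (a ^+ d) `^ e = a ^+ d.
  by move=> e; rewrite -powRDp// subrK powRr1// ltW.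
split => //.
- have : 2 * G / M <= a `^ d%:R by near: a; apply: near_pinfty_powR; rewrite ltr0n.
  rewrite powR_mulrn ?(ltW a0)// ler_pdivrMr// => H.
  by rewrite -(ler_pM2r X0) cgE//; lra.
- move=> j rj1.
  have : 2 * G / L0 <= (a ^+ d) `^ (1 - rho j) by move: j rj1; near: a.
  rewrite ler_pdivrMr// => H.
  have p0 : 0 < (a ^+ d) `^ (1 - rho j) by rewrite powR_gt0.
  by rewrite -(ler_pM2r p0) -mulrA [X in _ * X]mulrC X cgE//; lra.
- move=> j.
  have : 2 * G * E / L0 <= a `^ beta j by move: j; near: a.
  rewrite ler_pdivrMr// => H.
  apply: (@le_trans _ _ (cg a * E * a ^+ d)).
    apply: ler_wpM2l; first by rewrite mulr_ge0// ltW.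
    by rewrite -[leRHS]powRr1 ?(ltW X0)// ler_powR.
  by rewrite mulrAC cgE//; lra.
Unshelve. all: by end_near. Qed.

Lemma base_ok_le L L' a : (forall j, L j <= L' j) -> base_ok L a -> base_ok L' a.
Proof.
move=> LL' [a8 c1 c2 c3]; have a0 : 0 < a by exact: lt_le_trans a8.
split => // j; first by move=> /c2/le_trans; apply; rewrite ler_pM2r.
by apply: (le_trans (c3 j)); rewrite ler_wpM2r ?powR_ge0// ler_pM2r.
Qed.

Definition assouad_const : R := c0 ^+ d / 2 * (2^-1 ^+ d / 16) / 2.

Lemma assouad_const_gt0 : 0 < assouad_const.
Proof. by rewrite divr_gt0// mulr_gt0 ?divr_gt0 ?exprn_gt0. Qed.

(** The smallest side in direction [j] for which bumps of height [A] and total volume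
[tau] satisfy the smoothness condition. *)
Definition side (L : 'I_d -> R) (A tau : R) (j : 'I_d) : R :=
  (2 * E * A * tau `^ rho j / L j) `^ (beta j)^-1.

Lemma prod_anisotropic B tau : 0 < B -> 0 < tau ->
  \prod_j (B * tau `^ rho j) `^ (beta j)^-1 = B `^ x * tau `^ s1.
Proof.
move=> B0 t0; rewrite -!prod_powR// -big_split/=; apply: eq_bigr => j _.
by rewrite powRM ?powR_ge0 ?(ltW B0)// -powRrM [rho j * _]mulrC.
Qed.

Lemma prod_side L A tau : (forall j, 0 < L j) -> 0 < A -> 0 < tau ->
  \prod_j side L A tau j = (2 * E * A) `^ x * tau `^ s1 / L_beta beta L.
Proof.
move=> L0 A0 t0.
have EA0 : 0 < 2 * E * A by rewrite mulr_gt0// mulr_gt0.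
have Lb0 : 0 < L_beta beta L by apply: prodr_gt0 => j _; exact: powR_gt0.
apply: (@mulIf _ (L_beta beta L)); first by rewrite gt_eqF.
rewrite divfK ?gt_eqF// -prod_anisotropic// /L_beta -big_split/=.
apply: eq_bigr => j _.
have X0 : 0 <= 2 * E * A * tau `^ rho j / L j.
  by rewrite divr_ge0 ?(ltW (L0 j))// mulr_ge0 ?powR_ge0// ltW.
by rewrite /side -(powRM _ X0 (ltW (L0 j))) divfK ?gt_eqF.
Qed.

(** Two letters per position, and as many positions as the total volume [tau] allows.
The volume of a box is given by [prod_side], so [A], [tau] and [a] are the
only parameters left. *)
Lemma assouad_bound (L : 'I_d -> R) (a A tau : R) n p :
  (forall j, 0 < L j) -> (forall j, r j = 1%E -> 1 <= L j) ->
  base_ok L a -> 0 < A -> 0 < tau ->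
  (forall j, r j <> 1%E -> A * tau `^ rho j <= L j / 2) ->
  A <= M / 2 -> A * tau <= 1 / 2 -> 2 * tau <= (a / 4) ^+ d ->
  (forall j, side L A tau j <= a / 2) ->
  (2 * E * A) `^ x * tau `^ s1 / L_beta beta L <= tau ->
  n%:R * (A ^+ 2 * ((2 * E * A) `^ x * tau `^ s1 / L_beta beta L) * a ^+ d)
    <= c0 ^+ d / 20 ->
  1 <= p ->
  ((assouad_const * A * tau `^ p^-1)%:E <=
     minimax_Lp_risk p n (nikolskii_bounded r beta L M))%E.
Proof.
move=> L0 L1 [a8 b1 b2 b3] A0 tau0 norm AM Atau room ha Vtau info p1.
set V := _ / L_beta beta L in Vtau info.
have VE : \prod_j side L A tau j = V by exact: prod_side.
have h0 j : 0 < side L A tau j.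
  by rewrite powR_gt0// divr_gt0// mulr_gt0 ?powR_gt0// mulr_gt0// mulr_gt0.
have V0 : 0 < V by rewrite -VE; apply: prodr_gt0 => j _.
have a0 : 0 < a by exact: lt_le_trans a8.
have p0 : 0 < p by exact: lt_le_trans p1.
pose S := Num.truncn (tau / V).
have /andP[S1 S2] : S%:R <= tau / V < S.+1%:R.
  by apply: truncn_itv; rewrite divr_ge0// ltW.
have tV : 1 <= tau / V by rewrite ler_pdivlMr// mul1r.
have SV : S%:R * V <= tau by rewrite -ler_pdivlMr.
have Sge1 : 1 <= S%:R :> R.
  rewrite ler1n lt0n; apply/eqP => S0; move: S2; rewrite S0.
  by rewrite ltNge tV.
(* rounding the number of positions down loses a factor 2 at most *)
have SV2 : tau / 2 <= S%:R * V.
  rewrite -ler_pdivrMr//; move: S2; rewrite -(@natr1 R S) => /ltW S2.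
  by rewrite mulrAC; lra.
have fe : feasible psi beta L r M a A (side L A tau) S 1 n tau.
  split => //.
  - exact: ltW.
  - rewrite VE natrM; apply: le_trans room; rewrite mulrAC mulrC.
    by rewrite ler_pM2l.
  - rewrite VE -mulrA; apply: le_trans Atau.
    by rewrite ler_pM2l.
  - by rewrite VE.
  - move=> j; have [rj|rj] := pselect (r j = 1%E); first by left; split => //; exact: L1.
    by right; split; [exact: b2|exact: norm].
  - move=> j; rewrite /side powRK ?gt_eqF//; last first.
      by rewrite divr_ge0 ?(ltW (L0 j))// mulr_ge0 ?powR_ge0// ltW// mulr_gt0// mulr_gt0.
    rewrite le_eqVlt; apply/orP; left; apply/eqP; field.
    by rewrite gt_eqF.
  - lra.
  - rewrite VE (_ : 5 / 8 * 2%:R = 5 / 4 :> R); last by field.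
    have lev : level d psi a = (c0 / a) ^+ d / 2 by [].
    have lev0 : 0 < level d psi a by exact: level_gt0.
    apply: expr1D_le.
      by apply: mulr_ge0; [rewrite divr_ge0 ?sqr_ge0 ?(ltW lev0)|rewrite mulr_ge0 ?(ltW V0)].
    have X0 : 0 < a ^+ d by rewrite exprn_gt0.
    have c0d : 0 < c0 ^+ d by rewrite exprn_gt0.
    rewrite (_ : n%:R * _ = n%:R * (A ^+ 2 * V * a ^+ d) * 4 / c0 ^+ d); last first.
      rewrite lev expr_div_n; field.
      by rewrite (gt_eqF X0) (gt_eqF c0d).
    by rewrite ler_pdivrMr//; lra.
apply: le_trans (minimax_Lp_lower fe p1).
rewrite VE lee_fin /assouad_const.
have t2 : tau `^ p^-1 / 2 <= (S%:R * V) `^ p^-1.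
  apply: (@le_trans _ _ ((tau / 2) `^ p^-1)).
    rewrite powRM ?(ltW tau0)//; apply: ler_wpM2l; first exact: powR_ge0.
    rewrite -[leLHS]powRr1//; apply: ger_powR; last by rewrite invf_le1.
    by apply/andP; split; lra.
  by apply: ge0_ler_powR; rewrite ?nnegrE ?invr_ge0 ?divr_ge0 ?(ltW p0) ?(ltW tau0)// mulr_ge0// ltW.
rewrite (_ : _ * tau `^ p^-1 = c0 ^+ d / 2 * (2^-1 ^+ d / 16) * A * (tau `^ p^-1 / 2)); last by ring.
by apply: ler_wpM2l => //; rewrite !mulr_ge0 ?divr_ge0 ?exprn_ge0// ltW.
Qed.

End rate_conditions.

(** * The dense, sparse and tail regimes *)

(** Densities have [L_1] norm one. This is where the class has to be nonempty: in a
direction with [r j = 1] the norm cannot be lowered by enlarging the cube. *)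
Lemma nikolskii_norm1 (R : realType) (d : nat) (beta L : 'I_d -> R) (r : 'I_d -> \bar R)
    (M : R) : (exists f : density R d, nikolskii_bounded r beta L M f) ->
  forall j, r j = 1%E -> 1 <= L j.
Proof.
move=> [f [[_ fN] _]] j rj; have [+ _] := fN j; rewrite rj /Lp_norm Lnorm1.
under eq_integral do rewrite /= ger0_norm ?density_ge0//.
by rewrite density_integral lee_fin.
Qed.

Section zones.
Context (R : realType) (d k : nat) (psi : bump_profile R k).
Local Notation c0 := (profile_low psi).
Local Notation C := (profile_holder psi).
Local Notation E := (k.+1%:R ^+ 2 * C).
Context (beta : 'I_d -> R) (r : 'I_d -> \bar R) (M : R).
Context (d_gt0 : (0 < d)%N) (beta_itv : forall j, 0 < beta j < k%:R)
  (r_ge1 : forall j, (1 <= r j)%E) (M_gt0 : 0 < M).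
Local Notation rho j := (rinv (r j)).
Local Notation x := (inv_beta beta).
Local Notation s1 := (inv_s beta r).
Local Notation base_ok := (base_ok psi beta r M).
Local Notation side := (side psi beta r).
Local Notation cst := (assouad_const d psi).

Let c0_gt0 : 0 < c0. Proof. by have /andP[] := profile_low_itv psi. Qed.
Let c0_le1 : c0 <= 1. Proof. by have /andP[] := profile_low_itv psi. Qed.
Let beta_gt0 j : 0 < beta j. Proof. by have /andP[] := beta_itv j. Qed.
Let rho_ge0 j : 0 <= rho j. Proof. by have /andP[] := rinv_itv (r_ge1 j). Qed.
Let rho_le1 j : rho j <= 1. Proof. by have /andP[] := rinv_itv (r_ge1 j). Qed.
Let E_gt0 : 0 < E. Proof. by rewrite mulr_gt0 ?exprn_gt0 ?profile_holder_gt0. Qed.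
Let EE_gt0 : 0 < 2 * E. Proof. by rewrite mulr_gt0. Qed.
Let x_gt0 : 0 < x. Proof. exact: (inv_beta_gt0 d_gt0 beta_itv). Qed.
Let s1_ge0 : 0 <= s1. Proof. exact: (inv_s_ge0 beta_itv r_ge1). Qed.
Let s1_le : s1 <= x. Proof. exact: (inv_s_le beta_itv r_ge1). Qed.

(** How small the constant factor of the height must be. The radii enter through
their lower bound [L0] only, whence constants that are uniform in the radii. *)
Definition amplitude_ok (L0 a theta : R) : Prop :=
  [/\ 0 < theta <= 1 / 2, theta <= M / 2, theta <= L0 / 2, 2 * E * theta <= L0 &
      (2 * E) `^ x * theta * a ^+ d <= c0 ^+ d / 20].

Lemma amplitude_exists L0 a : 0 < L0 -> 0 < a -> exists theta, amplitude_ok L0 a theta.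
Proof.
move=> L00 a0.
have P0 : 0 < (2 * E) `^ x * a ^+ d by rewrite mulr_gt0 ?exprn_gt0// powR_gt0// mulr_gt0.
have cd0 : 0 < c0 ^+ d by rewrite exprn_gt0.
pose t := Num.min (Num.min (1 / 2) (M / 2)) (Num.min (L0 / 2)
  (Num.min (L0 / (2 * E)) (c0 ^+ d / 20 / ((2 * E) `^ x * a ^+ d)))).
have EE : 0 < 2 * E by rewrite mulr_gt0.
have t0 : 0 < t by rewrite !lt_min !divr_gt0.
have [t1 t2 t3 t4 t5] : [/\ t <= 1 / 2, t <= M / 2, t <= L0 / 2, t <= L0 / (2 * E) &
    t <= c0 ^+ d / 20 / ((2 * E) `^ x * a ^+ d)].
  by split; rewrite /t !ge_min lexx ?orbT.
exists t; split => //; first by rewrite t0.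
  by rewrite mulrC -ler_pdivlMr.
by rewrite mulrAC mulrC -ler_pdivlMr.
Qed.

Lemma near_ratio_le1 (l : R) : 0 < l -> \forall n \near \oo, 0 < l / n%:R <= 1.
Proof.
move=> l0; near=> n.
have n0 : 0 < n%:R :> R by rewrite ltr0n; near: n; exact: nbhs_infty_gt.
rewrite divr_gt0//= ler_pdivrMr// mul1r.
by near: n; exact: nbhs_infty_ger.
Unshelve. all: by end_near. Qed.

Section fixed_smoothness.
Context (L0 a theta : R) (L : 'I_d -> R) (p : R).
Context (L0_gt0 : 0 < L0) (L_ge : forall j, L0 <= L j)
  (L1 : forall j, r j = 1%E -> 1 <= L j) (p1 : 1 <= p)
  (a_ok : base_ok (fun=> L0) a) (theta_ok : amplitude_ok L0 a theta).
Local Notation l := (L_beta beta L).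

Let L_gt0 j : 0 < L j. Proof. exact: lt_le_trans (L_ge j). Qed.
Let l_gt0 : 0 < l. Proof. by apply: prodr_gt0 => j _; exact: powR_gt0. Qed.
Let a_okL : base_ok L a. Proof. exact: base_ok_le a_ok. Qed.
Let a_ge8 : 8 <= a. Proof. by case: a_ok. Qed.
Let a_gt0 : 0 < a. Proof. exact: lt_le_trans a_ge8. Qed.
Let theta_gt0 : 0 < theta. Proof. by case: theta_ok => /andP[]. Qed.
Let theta_le1 : theta <= 1 / 2. Proof. by case: theta_ok => /andP[]. Qed.

Let room2 : 2 <= (a / 4) ^+ d.
Proof.
have a4 : 2 <= a / 4 by move: a_ge8; lra.
rewrite (le_trans a4)// -[leLHS]expr1 ler_weXn2l//; lra.
Qed.

Let side_le1 A tau j : 0 <= A <= theta -> 0 < tau <= 1 -> side L A tau j <= 1.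
Proof.
move=> /andP[A0 At] /andP[t0 t1]; case: theta_ok => _ _ _ tE _.
apply: powR_le1; last by rewrite invr_ge0 ltW.
apply/andP; split.
  by rewrite divr_ge0 ?(ltW (L_gt0 j))// mulr_ge0 ?powR_ge0// mulr_ge0// ltW// mulr_gt0.
rewrite ler_pdivrMr// mul1r (le_trans _ (L_ge j))// (le_trans _ tE)//.
rewrite -[leRHS]mulr1 ler_pM ?powR_ge0//.
- by rewrite mulr_ge0// ltW// mulr_gt0.
- by rewrite ler_pM2l// mulr_gt0.
- by rewrite powR_le1// (ltW t0).
Qed.

Let norm_le A tau j : 0 <= A <= theta -> 0 < tau <= 1 -> A * tau `^ rho j <= L j / 2.
Proof.
move=> /andP[A0 At] /andP[t0 t1]; case: theta_ok => _ _ tL _ _.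
apply: (@le_trans _ _ (A * 1)).
  by rewrite ler_wpM2l// powR_le1// (ltW t0).
by rewrite mulr1 (le_trans At)// (le_trans tL)// ler_pM2r.
Qed.

Let theta_powR e : 1 <= e -> theta `^ e <= theta.
Proof. by move=> e1; apply: ge1r_powR => //; rewrite theta_gt0; move: theta_le1; lra. Qed.

Let info_le : (2 * E) `^ x * theta `^ (2 + x) * a ^+ d <= c0 ^+ d / 20.
Proof.
case: theta_ok => _ _ _ _ H; apply: le_trans H; rewrite ler_pM2r ?exprn_gt0//.
rewrite (ler_pM2l (powR_gt0 _ EE_gt0)); apply: theta_powR; move: x_gt0; lra.
Qed.

Let side_half A tau j : 0 <= A <= theta -> 0 < tau <= 1 -> side L A tau j <= a / 2.
Proof. by move=> hA ht; rewrite (le_trans (side_le1 j hA ht))//; move: a_ge8; lra. Qed.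

(** If the powers of [y] in [A ^ 2 V] combine to [y] itself, the sample size cancels. *)
Let info_identity n e T y : 0 < n%:R :> R -> y = l / n%:R -> 0 < y ->
  y `^ (e * (2 + x)) * T = y ->
  n%:R * ((theta * y `^ e) ^+ 2 * ((2 * E * (theta * y `^ e)) `^ x * T / l) * a ^+ d) =
  (2 * E) `^ x * theta `^ (2 + x) * a ^+ d.
Proof.
move=> n0 yE y0 yT; set A := theta * _.
have A0 : 0 < A by rewrite mulr_gt0 ?powR_gt0.
have AE : A ^+ 2 * A `^ x = theta `^ (2 + x) * y `^ (e * (2 + x)).
  rewrite -powR_mulrn ?(ltW A0)// -powRDp// /A powRM ?powR_ge0 ?(ltW theta_gt0)//.
  by rewrite -powRrM.
rewrite (powRM _ (ltW EE_gt0) (ltW A0)).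
have -> : n%:R * (A ^+ 2 * ((2 * E) `^ x * A `^ x * T / l) * a ^+ d) =
   (2 * E) `^ x * (A ^+ 2 * A `^ x * T) * a ^+ d * (n%:R / l) by ring.
rewrite AE -(mulrA (theta `^ _)) yT yE; field.
by rewrite !gt_eqF.
Qed.

(** The bumps fill a fixed cube, and their height is the largest one that [n]
observations cannot detect. *)
Lemma middle_zone : \forall n \near \oo,
  ((cst * theta * (l / n%:R) `^ (2 + x)^-1)%:E <=
     minimax_Lp_risk p n (nikolskii_bounded r beta L M))%E.
Proof.
have x2 : 0 < 2 + x by move: x_gt0; lra.
near=> n.
have /andP[y0 y1] : 0 < l / n%:R <= 1 by near: n; exact: near_ratio_le1.
have n0 : 0 < n%:R :> R by rewrite ltr0n; near: n; exact: nbhs_infty_gt.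
set y := l / n%:R in y0 y1 *.
pose A := theta * y `^ (2 + x)^-1.
have A0 : 0 < A by rewrite mulr_gt0 ?powR_gt0.
have At : A <= theta.
  by rewrite /A ler_piMr ?(ltW theta_gt0)// powR_le1 ?invr_ge0 ?(ltW x2)// (ltW y0).
have A01 : 0 <= A <= theta by rewrite At ltW.
have t11 : 0 < (1 : R) <= 1 by rewrite ltr01 lexx.
have := @assouad_bound R d k psi beta r M beta_itv r_ge1 L a A 1 n p L_gt0 L1 a_okL A0 ltr01.
rewrite !powR1 !mulr1 -(mulrA cst); apply => //.
- by move=> j _; have := norm_le j A01 t11; rewrite powR1 mulr1.
- by case: theta_ok => _ tM _ _ _; exact: le_trans tM.
- exact: le_trans theta_le1.
- by move=> j; exact: side_half.
- have := prod_side psi beta r L_gt0 A0 ltr01; rewrite powR1 mulr1 => <-.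
  by apply: prodr_ile1 => j _; rewrite powR_ge0 side_le1.
- have := @info_identity n (2 + x)^-1 1 y n0 erefl y0.
  by rewrite mulVf ?gt_eqF// powRr1 ?(ltW y0)// !mulr1 => ->//; exact: info_le.
Unshelve. all: by end_near. Qed.

(** The height stays constant while the volume of the union of the bumps shrinks.
Since [s1 > 1], the volume of one box, of order [tau ^ s1], is small compared with
[tau], so there are many of them. *)
Lemma sparse_zone : 1 < s1 -> \forall n \near \oo,
  ((cst * theta * (l / n%:R) `^ (s1^-1 / p))%:E <=
     minimax_Lp_risk p n (nikolskii_bounded r beta L M))%E.
Proof.
move=> s11.
have s10 : 0 < s1 by exact: lt_trans s11.
have T0 : 0 < (2 * E * theta) `^ x by exact: (powR_gt0 _ (mulr_gt0 EE_gt0 theta_gt0)).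
near=> n.
have /andP[y0 y1] : 0 < l / n%:R <= 1 by near: n; exact: near_ratio_le1.
have n0 : 0 < n%:R :> R by rewrite ltr0n; near: n; exact: nbhs_infty_gt.
have ysmall : (l / n%:R) `^ (1 - s1^-1) <= l / (2 * E * theta) `^ x.
  near: n; apply: near_infty_ratio_powR => //; last by rewrite divr_gt0.
  by rewrite subr_gt0 invf_lt1.
set y := l / n%:R in y0 y1 ysmall *.
pose tau := y `^ s1^-1.
have tau0 : 0 < tau by rewrite powR_gt0.
have tau1 : tau <= 1 by rewrite powR_le1 ?invr_ge0 ?(ltW s10)// (ltW y0).
have A01 : 0 <= theta <= theta by rewrite lexx ltW.
have t11 : 0 < tau <= 1 by rewrite tau0 tau1.
have tauE : tau `^ s1 = y by rewrite powRK ?gt_eqF// ltW.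
rewrite powRrM -/tau.
have := @assouad_bound R d k psi beta r M beta_itv r_ge1 L a theta tau n p L_gt0 L1 a_okL theta_gt0 tau0.
rewrite tauE; apply => //.
- by move=> j _; exact: norm_le.
- by case: theta_ok.
- by rewrite -[leRHS]mulr1 ler_pM// ltW.
- by apply: le_trans room2; rewrite ger_pMr.
- by move=> j; exact: side_half.
- have yE : y = tau * y `^ (1 - s1^-1).
    by rewrite /tau -powRDp// addrC subrK powRr1// ltW.
  rewrite (_ : _ / l = tau * ((2 * E * theta) `^ x * y `^ (1 - s1^-1) / l)); last first.
    by rewrite {1}yE; ring.
  by rewrite ger_pMr// ler_pdivrMr// mul1r mulrC -ler_pdivlMr.
- have := @info_identity n 0 y y n0 erefl y0.
  by rewrite mul0r powRr0 mul1r !mulr1 => ->//; exact: info_le.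
Unshelve. all: by end_near. Qed.

(** The cube grows with [n] so as to make the base density comparable to the height
[A] of the bumps, which then carry a fixed fraction of the mass. *)
Lemma tail_zone : \forall n \near \oo,
  ((cst * theta / 2 * (l / n%:R) `^ ((1 - 1 / p) / (1 - s1 + x)))%:E <=
     minimax_Lp_risk p n (nikolskii_bounded r beta L M))%E.
Proof.
set D := 1 - s1 + x.
have D1 : 1 <= D by rewrite /D; move: s1_le; lra.
have D0 : 0 < D by exact: lt_le_trans D1.
have [a1 [_ Ha1]] : \forall b \near +oo, base_ok (fun=> L0) b /\
    forall j, 2 * (2 * E / L0) `^ (beta j)^-1 <= b.
  near=> b; split; first by near: b; exact: near_base_ok.
  near: b; apply: filter_forall => j; apply: nbhs_pinfty_ge.
  by rewrite num_real.
(* once [y ^ D^-1] is below [g ^ d], the cube of side [b] below is so large that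
   [Ha1] applies to it *)
pose g := 4 / (`|a1| + 1).
have g0 : 0 < g by rewrite divr_gt0// ltr_wpDl.
near=> n.
have /andP[y0 y1] : 0 < l / n%:R <= 1 by near: n; exact: near_ratio_le1.
have n0 : 0 < n%:R :> R by rewrite ltr0n; near: n; exact: nbhs_infty_gt.
have n1 : 1 <= n%:R :> R by rewrite ler1n -(ltr0n R).
have yg : (l / n%:R) `^ D^-1 <= g ^+ d.
  near: n; apply: near_infty_ratio_powR => //; first by rewrite invr_gt0.
  by rewrite exprn_gt0.
have ynorm : forall j, r j <> 1%E -> (l / n%:R) `^ ((1 - rho j) / D) <= L0 / 2.
  near: n; apply: filter_forall => j.
  have [rj1|rj1] := pselect (r j = 1%E); first by apply: nearW => m /(_ rj1).
  have e0 : 0 < (1 - rho j) / D by rewrite divr_gt0// subr_gt0 rinv_lt1.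
  have B0 : 0 < L0 / 2 by rewrite divr_gt0.
  have := near_infty_ratio_powR l_gt0 e0 B0.
  by apply: filterS => m.
set y := l / n%:R in y0 y1 yg ynorm *.
have yD1 : y `^ D^-1 <= 1 by rewrite powR_le1 ?invr_ge0 ?(ltW D0)// (ltW y0).
pose A := theta * y `^ D^-1.
have A0 : 0 < A by rewrite mulr_gt0 ?powR_gt0.
have At : A <= theta by rewrite /A ler_piMr ?(ltW theta_gt0).
have theta1 : theta <= 1 by rewrite (le_trans theta_le1)// ler_pdivrMr// mul1r ler1n.
have A1 : A <= 1 by exact: le_trans theta1.
have Ay : A <= y `^ D^-1 by rewrite /A ler_piMl ?powR_ge0.
have dR : 0 < d%:R :> R by rewrite ltr0n.
pose b := 4 / A `^ d%:R^-1.
have Ad0 : 0 < A `^ d%:R^-1 by rewrite powR_gt0.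
have b0 : 0 < b by rewrite divr_gt0.
have b4d : (b / 4) ^+ d = A^-1.
  rewrite /b mulrAC divff ?gt_eqF// mul1r exprVn; congr (_^-1).
  by rewrite -powR_mulrn ?powR_ge0// powRK ?gt_eqF// ltW.
have bd : b ^+ d = 4 ^+ d / A.
  by rewrite -b4d -exprMn; congr (_ ^+ d); field.
have [b_ok bside] : base_ok (fun=> L0) b /\ forall j, 2 * (2 * E / L0) `^ (beta j)^-1 <= b.
  apply: Ha1; apply: (@lt_le_trans _ _ (`|a1| + 1)).
    by rewrite (le_lt_trans (ler_norm _))// ltrDl.
  rewrite /b ler_pdivlMr// mulrC -ler_pdivlMr; last by rewrite ltr_wpDl.
  rewrite -/g -(_ : (g ^+ d) `^ d%:R^-1 = g).
    apply: ge0_ler_powR; rewrite ?nnegrE ?invr_ge0 ?(ltW dR) ?(ltW A0)//.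
    - by rewrite exprn_ge0// ltW.
    - exact: le_trans yg.
  by rewrite -powR_mulrn ?(ltW g0)// -powRrM divff ?gt_eqF// powRr1// ltW.
have b_okL : base_ok L b by apply: base_ok_le b_ok.
(* the mass [A * tau] of the bumps is one half *)
pose tau := A^-1 / 2.
have tau0 : 0 < tau by rewrite divr_gt0// invr_gt0.
have tauA : tau <= A^-1 by rewrite /tau ler_pdivrMr// ler_peMr ?invr_ge0 ?(ltW A0)//; lra.
have AVe e : A^-1 `^ e = A `^ (- e).
  by rewrite -powR_inv1 ?(ltW A0)// -powRrM mulN1r.
have tauP e : 0 <= e -> tau `^ e <= A `^ (- e).
  move=> e0; rewrite -AVe; apply: ge0_ler_powR; rewrite ?nnegrE ?invr_ge0 ?(ltW A0)//.
  exact: ltW.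
have Arho j : A * tau `^ rho j <= A `^ (1 - rho j).
  rewrite powRDp// powRr1 ?(ltW A0)//; apply: ler_wpM2l; first exact: ltW.
  exact: tauP.
have thetaE : (2 * E) `^ x * theta <= 1 / 20.
  case: theta_ok => _ _ _ _ H; apply: (@le_trans _ _ ((2 * E) `^ x * theta * a ^+ d)).
    rewrite ler_peMr ?mulr_ge0 ?powR_ge0 ?(ltW theta_gt0)// exprn_ege1//.
    by rewrite (le_trans _ a_ge8)// ler1n.
  by apply: (le_trans H); rewrite ler_pM2r// exprn_ile1// ltW.
set V := (2 * E * A) `^ x * tau `^ s1 / l.
have V0 : 0 < V by rewrite divr_gt0// mulr_gt0// powR_gt0// mulr_gt0.
have nAV : n%:R * (A * V) <= (2 * E) `^ x * theta.
  apply: (@le_trans _ _ ((2 * E) `^ x * A `^ D * (n%:R / l))).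
    rewrite /V (powRM _ (ltW EE_gt0) (ltW A0)).
    rewrite (_ : n%:R * _ = (2 * E) `^ x * (A * A `^ x * tau `^ s1) * (n%:R / l)); last by ring.
    apply: ler_wpM2r; first by rewrite divr_ge0// ltW.
    apply: ler_wpM2l; first exact: powR_ge0.
    rewrite /D (_ : 1 - s1 + x = 1 + x + - s1) ?powRDp// ?powRr1 ?(ltW A0)//; last by ring.
    by apply: ler_wpM2l; [rewrite mulr_ge0 ?powR_ge0// ltW|exact: tauP].
  have -> : A `^ D = theta `^ D * y.
    rewrite /A powRM ?powR_ge0 ?(ltW theta_gt0)//; congr (_ * _).
    by rewrite powRK ?gt_eqF// ltW.
  rewrite (_ : _ * (n%:R / l) = (2 * E) `^ x * theta `^ D); last first.
    by rewrite /y; field; rewrite !gt_eqF.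
  by apply: ler_wpM2l; [exact: powR_ge0|exact: theta_powR].
have := @assouad_bound R d k psi beta r M beta_itv r_ge1 L b A tau n p L_gt0 L1 b_okL A0 tau0.
rewrite -/V => H; apply: le_trans (H _ _ _ _ _ _ _ p1).
- rewrite lee_fin.
  have p0 : 0 < p by exact: lt_le_trans p1.
  have ip1 : p^-1 <= 1 by rewrite invf_le1.
  have ip0 : 0 <= p^-1 by rewrite invr_ge0 ltW.
  have t1 : A `^ (- p^-1) / 2 <= tau `^ p^-1.
    rewrite /tau [leRHS]powRM ?invr_ge0 ?(ltW A0)// AVe.
    apply: ler_wpM2l; first exact: powR_ge0.
    by apply: ger1_powR => //; rewrite invr_gt0 ltr0n /= invf_le1 ?ler1n.
  apply: (@le_trans _ _ (cst * (A * (A `^ (- p^-1) / 2)))).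
    rewrite (_ : A * _ = A `^ (1 - 1 / p) / 2); last first.
      by rewrite powRDp// powRr1 ?(ltW A0)// mulrA div1r.
    rewrite /A powRM ?powR_ge0 ?(ltW theta_gt0)// -powRrM [D^-1 * _]mulrC.
    rewrite (_ : cst * theta / 2 * _ = cst * (theta * y `^ ((1 - 1 / p) / D) / 2)); last by ring.
    apply: ler_wpM2l; first by rewrite ltW// assouad_const_gt0.
    rewrite ler_pM2r//; apply: ler_wpM2r; first exact: powR_ge0.
    by apply: ger1_powR; rewrite ?theta_gt0// gerBl div1r.
  rewrite -mulrA; apply: ler_wpM2l; first by rewrite ltW// assouad_const_gt0.
  by apply: ler_wpM2l t1; exact: ltW.
- move=> j rj1; apply: (le_trans (Arho j)).
  apply: (@le_trans _ _ (L0 / 2)); last by rewrite ler_pM2r.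
  apply: le_trans (ynorm j rj1); rewrite [_ / D]mulrC powRrM.
  by apply: ge0_ler_powR; rewrite ?nnegrE ?subr_ge0 ?powR_ge0 ?(ltW A0).
- by case: theta_ok => _ tM _ _ _; exact: le_trans tM.
- by rewrite /tau mulrA divff ?gt_eqF.
- by rewrite b4d /tau mulrC divfK.
- move=> j; rewrite ler_pdivlMr// mulrC; apply: le_trans (bside j).
  rewrite ler_pM2l//; apply: ge0_ler_powR; rewrite ?nnegrE ?invr_ge0 ?(ltW (beta_gt0 j))//.
  + by rewrite divr_ge0 ?(ltW (L_gt0 j))// mulr_ge0 ?powR_ge0// ltW// mulr_gt0.
  + by rewrite divr_ge0 ?(ltW EE_gt0)// ltW.
  + apply: ler_pM.
    * by rewrite mulr_ge0 ?powR_ge0// ltW// mulr_gt0.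
    * by rewrite invr_ge0 ltW.
    * rewrite -(mulrA (2 * E)) ger_pMr//.
      apply: (le_trans (Arho j)); apply: powR_le1; last by rewrite subr_ge0.
      by rewrite (ltW A0).
    * by rewrite lef_pV2 ?posrE.
- rewrite /tau ler_pdivlMr// -[leRHS]mulr1 -ler_pdivrMl ?invr_gt0// invrK mulrA.
  apply: (@le_trans _ _ (n%:R * (A * V) * 2)).
    by rewrite ler_pM2r// ler_peMl// mulr_ge0 ?(ltW A0) ?(ltW V0).
  by move: nAV thetaE; lra.
- rewrite bd (_ : n%:R * _ = 4 ^+ d * (n%:R * (A * V))); last first.
    by field; rewrite gt_eqF.
  case: theta_ok => _ _ _ _ H'; apply: le_trans H'; rewrite mulrC.
  apply: ler_pM => //.
  + by rewrite mulr_ge0// mulr_ge0 ?(ltW A0) ?(ltW V0).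
  + by apply: lerXn2r; rewrite ?nnegrE ?(ltW a_gt0)// (le_trans _ a_ge8)// ler_nat.
Unshelve. all: by end_near. Qed.

End fixed_smoothness.
End zones.

(** * A single bump in an unknown place *)

Section needles.
Context (R : realType) (d k : nat) (psi : bump_profile R k).
Local Notation c0 := (profile_low psi).
Local Notation C := (profile_holder psi).
Local Notation E := (k.+1%:R ^+ 2 * C).
Context (beta : 'I_d -> R) (r : 'I_d -> \bar R) (M : R).
Context (d_gt0 : (0 < d)%N) (beta_itv : forall j, 0 < beta j < k%:R)
  (r_ge1 : forall j, (1 <= r j)%E) (M_gt0 : 0 < M).
Local Notation rho j := (rinv (r j)).
Local Notation x := (inv_beta beta).
Local Notation s1 := (inv_s beta r).

Let c0_gt0 : 0 < c0. Proof. by have /andP[] := profile_low_itv psi. Qed.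
Let beta_gt0 j : 0 < beta j. Proof. by have /andP[] := beta_itv j. Qed.
Let rho_ge0 j : 0 <= rho j. Proof. by have /andP[] := rinv_itv (r_ge1 j). Qed.
Let E_gt0 : 0 < E. Proof. by rewrite mulr_gt0 ?exprn_gt0 ?profile_holder_gt0. Qed.
Let x_gt0 : 0 < x. Proof. exact: (inv_beta_gt0 d_gt0 beta_itv). Qed.

Context (L0 a : R) (L : 'I_d -> R).
Context (L0_gt0 : 0 < L0) (L_ge : forall j, L0 <= L j)
  (L1 : forall j, r j = 1%E -> 1 <= L j) (a_ok : base_ok psi beta r M (fun=> L0) a).

Let a_ge8 : 8 <= a. Proof. by case: a_ok. Qed.
Let a_gt0 : 0 < a. Proof. exact: lt_le_trans a_ge8. Qed.
Let level0 : 0 < (c0 / a) ^+ d. Proof. by rewrite exprn_gt0// divr_gt0. Qed.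

Let room2 : 2 <= (a / 4) ^+ d.
Proof.
have a4 : 2 <= a / 4 by move: a_ge8; lra.
rewrite (le_trans a4)// -[leLHS]expr1 ler_weXn2l//; lra.
Qed.

(** For a bump of height [theta * B] on a box of volume [V], the last condition bounds
the divergence per observation by [q * (B ^ 2 * V)]. *)
Definition needle_ok (q theta : R) : Prop :=
  [/\ 0 < theta <= 1 / 2, theta <= M / 2, theta <= L0 / 2, theta * E <= L0 / 2 &
      4 * theta ^+ 2 / (c0 / a) ^+ d <= q].

Lemma needle_exists q : 0 < q -> exists theta, needle_ok q theta.
Proof.
move=> q0.
pose t := Num.min (Num.min (1 / 2) (M / 2)) (Num.min (L0 / 2)
  (Num.min (L0 / 2 / E) (q * (c0 / a) ^+ d / 4))).
have t0 : 0 < t by rewrite !lt_min !divr_gt0// mulr_gt0.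
have [t1 t2 t3 t4 t5] : [/\ t <= 1 / 2, t <= M / 2, t <= L0 / 2, t <= L0 / 2 / E &
    t <= q * (c0 / a) ^+ d / 4].
  by split; rewrite /t !ge_min lexx ?orbT.
exists t; split => //; first by rewrite t0.
  by rewrite -ler_pdivlMr.
rewrite ler_pdivrMr// mulrC -ler_pdivlMr// (le_trans _ t5)// expr2 ger_pMr//.
by rewrite (le_trans t1)// ler_pdivrMr// mul1r ler1n.
Qed.

(** A single position with many letters. The radii are absorbed by [theta] instead of
entering the sides of the boxes. *)
Lemma needle_feasible q theta B tau K' n : needle_ok q theta ->
  0 < B <= 1 -> 0 < tau <= 1 -> B `^ x * tau `^ s1 <= tau ->
  K'.+1%:R * (B `^ x * tau `^ s1) <= 2 ->
  (1 + 4 * (theta * B) ^+ 2 * (B `^ x * tau `^ s1) / (c0 / a) ^+ d) ^+ n <= 5 / 8 * K'.+1%:R ->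
  feasible psi beta L r M a (theta * B)
    (fun j => (B * tau `^ rho j) `^ (beta j)^-1) 1 K' n tau.
Proof.
move=> [/andP[th0 th1] thM thL thE _] /andP[B0 B1] /andP[tau0 tau1] Vtau KV info.
have [a8 b1 b2 b3] : base_ok psi beta r M L a by apply: base_ok_le a_ok.
have VE := prod_anisotropic beta r B0 tau0.
set V := B `^ x * tau `^ s1 in Vtau KV info VE.
have V0 : 0 < V by rewrite mulr_gt0 ?powR_gt0.
have A0 : 0 < theta * B by rewrite mulr_gt0.
have Ath : theta * B <= theta by rewrite ger_pMr.
have taur j : tau `^ rho j <= 1 by rewrite powR_le1// (ltW tau0).
split => //.
- exact: ltW.
- by move=> j; rewrite powR_gt0// mulr_gt0// powR_gt0.
- move=> j; apply: (@le_trans _ _ 1); last by move: a_ge8; lra.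
  apply: powR_le1; last by rewrite invr_ge0 ltW.
  rewrite mulr_ge0 ?powR_ge0 ?(ltW B0)//= -[leRHS](mulr1 1).
  by apply: ler_pM => //; rewrite ?powR_ge0// ltW.
- by rewrite VE mul1n (le_trans KV).
- rewrite VE mulr1; apply: le_trans th1; rewrite -[leRHS]mulr1.
  by apply: ler_pM => //; [exact: ltW|exact: ltW|exact: le_trans tau1].
- by rewrite VE mul1r.
- move=> j; have [rj|rj] := pselect (r j = 1%E); first by left; split => //; exact: L1.
  right; split; first exact: b2.
  apply: (@le_trans _ _ theta).
    by rewrite -[leRHS]mulr1; apply: ler_pM; rewrite ?powR_ge0// ltW.
  by rewrite (le_trans thL)// ler_pM2r.
- move=> j; rewrite powRK ?gt_eqF ?mulr_ge0 ?powR_ge0 ?(ltW B0)//.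
  rewrite (_ : _ * _ * _ = theta * E * (B * tau `^ rho j)); last by ring.
  apply: ler_wpM2r; first by rewrite mulr_ge0 ?powR_ge0// ltW.
  by rewrite (le_trans thE)// ler_pM2r.
- have := le_trans Ath thM; lra.
- rewrite VE; apply: le_trans info; rewrite le_eqVlt; apply/orP; left; apply/eqP.
  congr ((1 + _) ^+ _); rewrite /level; field.
  by rewrite gt_eqF.
Qed.

Definition needle_const : R := c0 ^+ d / 2 * (2^-1 ^+ d / 16).

Lemma needle_const_gt0 : 0 < needle_const.
Proof. by rewrite mulr_gt0 ?divr_gt0 ?exprn_gt0 ?invr_gt0. Qed.

Let D2 := 2 - 2 * s1 + x.

(** The exponents are chosen such that the box has volume [V = tau] and
[B ^ 2 * tau = ln n / n]. There is room for about [1 / tau] boxes, a power of [n],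
and for small [theta] the likelihoods compound to a smaller power of [n]. *)
Lemma log_zone theta p : needle_ok (x / (4 * D2)) theta -> s1 <= 1 -> 1 <= p ->
  \forall n \near \oo,
  ((needle_const * theta * (ln n%:R / n%:R) `^ ((1 - s1 + 1 / p * x) / D2))%:E <=
     minimax_Lp_risk p n (nikolskii_bounded r beta L M))%E.
Proof.
move=> th_ok s11 p1.
have arith1 (u v : R) : 16 / 5 * v <= u -> v <= 5 / 16 * u by lra.
have arith2 (t u : R) : t < u + 1 -> 1 <= u -> 5 / 16 * t <= 5 / 8 * u by lra.
have D20 : 0 < D2 by rewrite /D2; move: x_gt0; lra.
pose q0 := x / (4 * D2).
have q00 : 0 < q0 by rewrite divr_gt0// mulr_gt0.
near=> n.
have n1 : 1 < n%:R :> R by rewrite ltr1n; near: n; exact: nbhs_infty_gt.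
have n0 : 0 < n%:R :> R by exact: lt_trans n1.
have nq : 16 / 5 * 2 `^ (x / D2) <= n%:R `^ q0 by near: n; exact: near_infty_powR.
have ln0 : 0 < ln (n%:R : R) by exact: ln_gt0.
pose y := ln (n%:R : R) / n%:R.
have y0 : 0 < y by rewrite divr_gt0.
have y1 : y <= 1 by rewrite ler_pdivrMr// mul1r ltW// ln_sublinear.
pose B := y `^ ((1 - s1) / D2).
pose tau := y `^ (x / D2).
have B0 : 0 < B by rewrite powR_gt0.
have y01 : 0 <= y <= 1 by rewrite y1 ltW.
have B1 : B <= 1 by apply: powR_le1 => //; rewrite divr_ge0 ?subr_ge0 ?(ltW D20).
have tau0 : 0 < tau by rewrite powR_gt0.
have tau1 : tau <= 1 by apply: powR_le1 => //; rewrite divr_ge0 ?(ltW D20) ?(ltW x_gt0).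
have VE : B `^ x * tau `^ s1 = tau.
  rewrite /B /tau -!powRrM -powRDp//; congr (_ `^ _); field.
  by rewrite gt_eqF.
have B2tau : B ^+ 2 * tau = y.
  rewrite -powR_mulrn ?(ltW B0)// /B /tau -powRrM -powRDp//.
  rewrite -[RHS]powRr1 ?(ltW y0)//; congr (_ `^ _).
  by rewrite /D2; field; rewrite gt_eqF.
have tau_small : n%:R `^ q0 * tau <= 5 / 16.
  (* since [ln n <= 2 sqrt n], the number [1 / tau] of boxes grows at least like
     [n ^ (2 q0)], which leaves a factor [n ^ q0] over the likelihoods *)
  have ysq : y <= 2 * n%:R `^ (- 2^-1).
    have : ln (n%:R `^ 2^-1 : R) < n%:R `^ 2^-1 by rewrite ln_sublinear// powR_gt0.
    rewrite ln_powR => h; rewrite /y ler_pdivrMr// -mulrA.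
    rewrite -[X in _ * (_ * X)]powRr1 ?(ltW n0)// -powRDp//.
    rewrite (_ : - 2^-1 + 1 = 2^-1 :> R); last by field.
    by rewrite -ler_pdivrMl// ltW.
  have e0 : 0 <= x / D2 by rewrite divr_ge0 ?(ltW D20) ?(ltW x_gt0).
  have tau_le : tau <= 2 `^ (x / D2) * (n%:R `^ q0)^-1 * (n%:R `^ q0)^-1.
    apply: (@le_trans _ _ ((2 * n%:R `^ (- 2^-1)) `^ (x / D2))).
      by apply: ge0_ler_powR; rewrite ?nnegrE ?(ltW y0)// mulr_ge0 ?powR_ge0.
    rewrite powRM ?powR_ge0// -powRrM -mulrA -!powRN -powRDp//.
    rewrite le_eqVlt; apply/orP; left; apply/eqP; congr (_ * _ `^ _).
    by rewrite /q0; field; rewrite gt_eqF.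
  have N0 : 0 < n%:R `^ q0 :> R by rewrite powR_gt0.
  apply: (@le_trans _ _ (2 `^ (x / D2) / n%:R `^ q0)).
    apply: (le_trans (ler_wpM2l (ltW N0) tau_le)).
    by rewrite mulrCA divff ?gt_eqF// mulr1.
  by rewrite ler_pdivrMr// arith1.
pose K := Num.truncn tau^-1.
have /andP[K1 K2] : K%:R <= tau^-1 < K.+1%:R.
  by apply: truncn_itv; rewrite invr_ge0 ltW.
have Kge1 : 1 <= K%:R :> R.
  rewrite ler1n lt0n; apply/eqP => K0; move: K2; rewrite K0.
  by rewrite ltNge invf_ge1// tau1.
have KE : K.-1.+1 = K by rewrite prednK// -(ler1n R).
have fe : feasible psi beta L r M a (theta * B)
    (fun j => (B * tau `^ rho j) `^ (beta j)^-1) 1 K.-1 n tau.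
  apply: (needle_feasible th_ok); rewrite ?B0 ?tau0 ?VE ?KE//.
    rewrite (@le_trans _ _ 1)// ?ler1n// -ler_pdivlMr// mul1r.
    exact: K1.
  case: th_ok => /andP[th0 _] _ _ _ th5.
  have u0 : 0 <= 4 * (theta * B) ^+ 2 * tau / (c0 / a) ^+ d.
    by rewrite divr_ge0 ?(ltW level0)// mulr_ge0 ?(ltW tau0)// mulr_ge0 ?sqr_ge0.
  have uE : 4 * (theta * B) ^+ 2 * tau / (c0 / a) ^+ d =
      4 * theta ^+ 2 / (c0 / a) ^+ d * y by rewrite -B2tau; ring.
  apply: (@le_trans _ _ (n%:R `^ q0)).
    apply: (@le_trans _ _ (expR (n%:R * (4 * (theta * B) ^+ 2 * tau / (c0 / a) ^+ d)))).
      by rewrite expRM_natl lerXn2r ?nnegrE ?expR_ge0 ?addr_ge0// expR_ge1Dx.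
    have <- : expR (q0 * ln (n%:R : R)) = n%:R `^ q0.
      by rewrite [q0 * _]mulrC expRM lnK.
    rewrite ler_expR uE mulrCA (_ : n%:R * y = ln n%:R) ?ler_pM2r//.
    by rewrite /y mulrC divfK// gt_eqF.
  apply: (@le_trans _ _ (5 / 16 * tau^-1)).
    by rewrite ler_pdivlMr.
  by apply: arith2 => //; rewrite natr1.
apply: le_trans (minimax_Lp_lower fe p1).
rewrite lee_fin (prod_anisotropic beta r B0 tau0) VE mul1r.
rewrite -/y /needle_const le_eqVlt; apply/orP; left; apply/eqP.
rewrite mul1r.
have -> : y `^ ((1 - s1 + p^-1 * x) / D2) = B * tau `^ p^-1.
  rewrite /B /tau -powRrM -powRDp//; congr (_ `^ _); field.
  by rewrite !gt_eqF// (lt_le_trans _ p1).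
by ring.
Unshelve. all: by end_near. Qed.

(** As [s1 >= 1], a box of sides [(1 / n) ^ (1 / (r_j beta_j))] has volume at most
[1 / n], while the smoothness condition lets the bump on it keep a constant height. *)
Lemma sup_zone theta n : needle_ok (1 / 5) theta -> 1 <= s1 -> (0 < n)%N ->
  ((c0 ^+ d / 64 * theta)%:E <= minimax_Linf_risk n (nikolskii_bounded r beta L M))%E.
Proof.
move=> th_ok s11 n_gt0.
have n0 : 0 < n%:R :> R by rewrite ltr0n.
have n1 : 1 <= n%:R :> R by rewrite ler1n.
pose tau := (n%:R : R)^-1.
have tau0 : 0 < tau by rewrite invr_gt0.
have tau1 : tau <= 1 by rewrite invf_le1.
have Vtau : tau `^ s1 <= tau by rewrite ge1r_powR// tau0.
have fe : feasible psi beta L r M a (theta * 1)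
    (fun j => (1 * tau `^ rho j) `^ (beta j)^-1) 1 1 n tau.
  apply: (needle_feasible th_ok); rewrite ?ltr01 ?lexx ?tau0 ?powR1 ?mul1r//.
    have := le_trans Vtau tau1; lra.
  rewrite (_ : 5 / 8 * 2%:R = 5 / 4 :> R); last by field.
  case: th_ok => /andP[th0 _] _ _ _ th5.
  apply: expr1D_le.
    by rewrite mulr1 divr_ge0 ?(ltW level0)// mulr_ge0 ?powR_ge0// mulr_ge0 ?sqr_ge0.
  apply: le_trans th5; rewrite mulr1 mulrA ler_pM2r ?invr_gt0// mulrCA.
  rewrite ger_pMr; last by rewrite mulr_gt0// exprn_gt0.
  by rewrite -ler_pdivlMl// mulr1.
by have := minimax_Linf_lower fe erefl erefl; rewrite mulr1.
Qed.

End needles.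

(** * The exponent of the rate *)

Lemma smoothness_order (R : realType) (d : nat) (beta : 'I_d -> R) :
  (forall j, 0 < beta j) -> exists2 k, (0 < k)%N & forall j, 0 < beta j < k%:R.
Proof.
move=> beta_gt0; exists (\max_j (Num.truncn (beta j)).+1).+1 => // j.
rewrite beta_gt0; have /andP[_ h] := truncn_itv (ltW (beta_gt0 j)).
apply: (lt_le_trans h); rewrite ler_nat.
by apply: leqW; apply: leq_bigmax.
Qed.

Lemma limn_einf_normalized (R : realType) (c e : R) (y : R^nat) (risk : (\bar R)^nat) :
  (\forall n \near \oo, 0 < y n) ->
  (\forall n \near \oo, (c * y n `^ e)%:E <= risk n)%E ->
  (c%:E <= limn_einf (fun n => (y n `^ (- e))%:E * risk n))%E.
Proof.
move=> y0 bound; apply: limn_einf_ge; near=> n.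
have yn : 0 < y n by near: n.
apply: (@le_trans _ _ ((y n `^ (- e))%:E * (c * y n `^ e)%:E)%E).
  by rewrite -EFinM lee_fin mulrCA -powRDp// addNr powRr0 mulr1.
by apply: lee_wpmul2l; [rewrite lee_fin powR_ge0|near: n].
Unshelve. all: by end_near. Qed.

Section regimes.
Context (R : realType) (d : nat) (beta : 'I_d -> R) (r : 'I_d -> \bar R).
Context (d_gt0 : (0 < d)%N) (beta_gt0 : forall j, 0 < beta j)
  (r_ge1 : forall j, (1 <= r j)%E).
Local Notation x := (inv_beta beta).
Local Notation s1 := (inv_s beta r).

Let x_gt0 : 0 < x.
Proof. by have [k _ bk] := smoothness_order beta_gt0; exact: (inv_beta_gt0 d_gt0 bk). Qed.

Let s1_ge0 : 0 <= s1.
Proof. by have [k _ bk] := smoothness_order beta_gt0; exact: (inv_s_ge0 bk r_ge1). Qed.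

Lemma s_indexE : s_index beta r = if s1 == 0 then +oo%E else (s1^-1)%:E.
Proof. by rewrite /s_index inver. Qed.

Lemma s_index_lt1 : (s_index beta r < 1)%E = (1 < s1).
Proof.
rewrite s_indexE; have [->|s10] := eqVneq s1 0; first by rewrite ltNge leey ltNge ler01.
by rewrite lte_fin invf_lt1// lt_neqAle eq_sym s10.
Qed.

Lemma s_index_le1 : (s_index beta r <= 1)%E = (1 <= s1).
Proof.
rewrite s_indexE; have [->|s10] := eqVneq s1 0; first by rewrite leye_eq lt_geF.
by rewrite lee_fin invf_le1// lt_neqAle eq_sym s10.
Qed.

Lemma sparse_thresholdE : s1 != 0 -> sparse_threshold beta r = ((2 + x) / s1)%:E.
Proof.
by move=> s10; rewrite /sparse_threshold s_indexE (negbTE s10) -EFinM mulrC.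
Qed.

Lemma nu_sparse p : (2 + x) / (1 + s1) <= p -> ~~ (p%:E <= sparse_threshold beta r)%E ->
  1 < s1 -> nu beta r p = s1^-1 / p.
Proof.
move=> p1 p2 s11; rewrite /nu ltNge p1/= (negbTE p2) s_index_lt1 s11 s_indexE.
by rewrite gt_eqF// (lt_trans ltr01).
Qed.

Lemma nu_middle p : (2 + x) / (1 + s1) <= p -> (p%:E <= sparse_threshold beta r)%E ->
  nu beta r p = (2 + x)^-1.
Proof.
move=> p1 p2; rewrite /nu ltNge p1/= p2 /mean_beta.
have x2 : 2 + x != 0 by rewrite gt_eqF// addr_gt0.
by field; rewrite x2 (gt_eqF x_gt0).
Qed.

(** Beyond the sparse threshold [p] exceeds the threshold of the tail regime too, so
the last case of the definition of [nu] is the relevant one. The bounds on [nu] make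
constants uniform in [p]. *)
Lemma log_regime p : 1 <= p -> (sparse_threshold beta r < p%:E)%E -> (1 <= s_index beta r)%E ->
  [/\ s1 <= 1, nu beta r p = (1 - s1 + 1 / p * x) / (2 - 2 * s1 + x) & 0 <= nu beta r p <= 1].
Proof.
move=> p1 thr s_ge1.
have p0 : 0 < p := lt_le_trans ltr01 p1.
have s11 : s1 <= 1 by rewrite leNgt -s_index_lt1 -leNgt.
have s10 : s1 != 0.
  apply/eqP => s10; move: thr; rewrite /sparse_threshold s_indexE s10 eqxx.
  by rewrite gt0_mulye ?lte_fin ?addr_gt0//.
have s1_gt0 : 0 < s1 by rewrite lt_neqAle eq_sym s10.
have pthr : (2 + x) / s1 < p by move: thr; rewrite sparse_thresholdE.
have pmid : (2 + x) / (1 + s1) <= p.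
  apply: le_trans (ltW pthr); rewrite ler_pM2l ?addr_gt0// lef_pV2 ?posrE ?addr_gt0//.
  by rewrite lerDr.
have nuE : nu beta r p = (1 - s1 + 1 / p * x) / (2 - 2 * s1 + x).
  by rewrite /nu ltNge pmid/= leNgt thr/= ltNge s_ge1.
have px0 : 0 <= 1 / p * x by rewrite mulr_ge0 ?(ltW x_gt0)// divr_ge0// ltW.
have px1 : 1 / p * x <= x by rewrite ger_pMl// ler_pdivrMr// mul1r.
have D0 : 0 < 2 - 2 * s1 + x by move: s11 x_gt0; lra.
split => //; rewrite nuE ler_pdivrMr// mul1r divr_ge0 ?(ltW D0)//=.
  by move: s11 px1; lra.
by move: s11 px0; lra.
Qed.

Lemma alpha_poly p n : (p%:E <= sparse_threshold beta r)%E \/ (s_index beta r < 1)%E ->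
  alpha beta r p n = 1.
Proof. by rewrite /alpha => -[h|h]; rewrite [(1 <= _)%E]leNgt [(_ < p%:E)%E]ltNge h ?andbF. Qed.

End regimes.

Section lower_bounds.
Context (R : realType) (d : nat) (beta : 'I_d -> R) (r : 'I_d -> \bar R) (M : R).
Context (d_gt0 : (0 < d)%N) (beta_gt0 : forall j, 0 < beta j)
  (r_ge1 : forall j, (1 <= r j)%E) (M_gt0 : 0 < M).
Local Notation x := (inv_beta beta).
Local Notation s1 := (inv_s beta r).

Let L_beta_gt0 L : (forall j, 0 < L j) -> 0 < L_beta beta L.
Proof. by move=> L0; apply: prodr_gt0 => j _; exact: powR_gt0. Qed.

Lemma base_ok_exists k (psi : bump_profile R k) L0 : (forall j, 0 < beta j < k%:R) ->
  0 < L0 -> exists2 a, 8 <= a & base_ok psi beta r M (fun=> L0) a.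
Proof.
move=> bk L00; have [N [_ H]] := near_base_ok psi d_gt0 bk r_ge1 M_gt0 L00.
have /H ok : N < N + 1 by rewrite ltrDl.
by exists (N + 1) => //; case: ok.
Qed.

(** Cube, profile and height are chosen from [L0] before [L] and [p] are given. *)
Lemma polynomial_lower_bound L0 : 0 < L0 ->
  exists c : R, 0 < c /\ forall L : 'I_d -> R, (forall j, L0 <= L j) ->
    (exists f : density R d, nikolskii_bounded r beta L M f) ->
    forall p : R, 1 <= p ->
      (p%:E <= sparse_threshold beta r)%E \/ (s_index beta r < 1)%E ->
      (c%:E <= limn_einf (fun n =>
         ((L_beta beta L * alpha beta r p n / n%:R) `^ (- nu beta r p))%:E *
         minimax_Lp_risk p n (nikolskii_bounded r beta L M)))%E.
Proof.
move=> L0_gt0; have [k k0 bk] := smoothness_order beta_gt0.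
have [psi] := bump_profile_exists R k0.
have [a a8 a_ok] := base_ok_exists psi bk L0_gt0.
have a0 : 0 < a by exact: lt_le_trans a8.
have [theta th_ok] := amplitude_exists psi beta M_gt0 L0_gt0 a0.
have th0 : 0 < theta by case: th_ok => /andP[].
have cst0 := assouad_const_gt0 d psi.
exists (assouad_const d psi * theta / 2); split; first by rewrite divr_gt0// mulr_gt0.
move=> L L_ge nonempty p p1 regime.
have L1 := nikolskii_norm1 nonempty.
have l0 : 0 < L_beta beta L by apply: L_beta_gt0 => j; exact: lt_le_trans (L_ge j).
have half n e : ((assouad_const d psi * theta / 2 * (L_beta beta L / n%:R) `^ e)%:E <=
    (assouad_const d psi * theta * (L_beta beta L / n%:R) `^ e)%:E)%E.
  rewrite lee_fin ler_wpM2r ?powR_ge0// ler_pdivrMr//.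
  by rewrite ler_peMr ?ler1n// mulr_ge0 ?ltW.
under eq_fun do rewrite alpha_poly// mulr1.
apply: limn_einf_normalized.
  by apply: filterS (near_ratio_le1 l0) => n /andP[].
have [p_tail|p_mid] := ltP p ((2 + x) / (1 + s1)).
  by rewrite /nu p_tail; exact: (tail_zone d_gt0 bk r_ge1 M_gt0 L0_gt0 L_ge L1 p1 a_ok th_ok).
have [p_thr|p_thr] := boolP (p%:E <= sparse_threshold beta r)%E.
  rewrite nu_middle//; apply: filterS (middle_zone d_gt0 bk r_ge1 L0_gt0 L_ge L1 p1 a_ok th_ok) => n.
  exact: le_trans.
have s11 : 1 < s1.
  by rewrite -s_index_lt1//; case: regime => // h; rewrite h in p_thr.
rewrite nu_sparse//; apply: filterS (sparse_zone d_gt0 bk r_ge1 L0_gt0 L_ge L1 p1 a_ok th_ok s11) => n.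
exact: le_trans.
Qed.

Lemma least_radius (L : 'I_d -> R) : (forall j, 0 < L j) ->
  exists2 L0, 0 < L0 & forall j, L0 <= L j.
Proof.
move=> L_gt0; exists (\big[Num.min/1]_j L j); last by move=> j; exact: bigmin_le.
by apply: lt_bigmin.
Qed.

(** The bound of [log_zone] lacks the factor [L_beta ^ nu]; as [0 <= nu <= 1], the
constant [1 / max(1, L_beta)] makes up for it for all [p] at once. *)
Lemma log_lower_bound L : (forall j, 0 < L j) ->
  (exists f : density R d, nikolskii_bounded r beta L M f) ->
  exists c : R, 0 < c /\ forall p : R, 1 <= p ->
    (sparse_threshold beta r < p%:E)%E -> (1 <= s_index beta r)%E ->
    (c%:E <= limn_einf (fun n =>
       ((L_beta beta L * alpha beta r p n / n%:R) `^ (- nu beta r p))%:E *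
       minimax_Lp_risk p n (nikolskii_bounded r beta L M)))%E.
Proof.
move=> L_gt0 nonempty; have L1 := nikolskii_norm1 nonempty.
have [L0 L0_gt0 L_ge] := least_radius L_gt0.
have [k k0 bk] := smoothness_order beta_gt0.
have [psi] := bump_profile_exists R k0.
have [a a8 a_ok] := base_ok_exists psi bk L0_gt0.
have l0 := L_beta_gt0 L_gt0; set l := L_beta beta L in l0 *.
have [s11|s11] := leP s1 1; last first.
  by exists 1; split => // p _ _; rewrite leNgt s_index_lt1// s11.
have x0 : 0 < x by exact: (inv_beta_gt0 d_gt0 bk).
have D20 : 0 < 2 - 2 * s1 + x by move: s11 x0; lra.
have q0 : 0 < x / (4 * (2 - 2 * s1 + x)) by rewrite divr_gt0// mulr_gt0.
have [theta th_ok] := needle_exists M_gt0 L0_gt0 a_ok q0.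
have th0 : 0 < theta by case: th_ok => /andP[].
have cst0 := needle_const_gt0 d psi.
have max0 : 0 < Num.max 1 l by rewrite lt_max ltr01.
exists (needle_const d psi * theta / Num.max 1 l); split.
  by rewrite divr_gt0// mulr_gt0.
move=> p p1 thr s_ge1.
have [_ nuE /andP[nu0 nu1]] := log_regime d_gt0 beta_gt0 r_ge1 p1 thr s_ge1.
rewrite /alpha thr s_ge1/=; apply: limn_einf_normalized.
  near=> n.
  have n1 : 1 < n%:R :> R by rewrite ltr1n; near: n; exact: nbhs_infty_gt.
  by rewrite divr_gt0 ?(lt_trans ltr01 n1)// mulr_gt0// ln_gt0.
have := log_zone d_gt0 bk r_ge1 L_ge L1 a_ok th_ok s11 p1.
rewrite -nuE; apply: filterS2 (nbhs_infty_gt 0) => n /= n0.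
apply: le_trans; rewrite lee_fin.
have y0 : 0 <= ln (n%:R : R) / n%:R by rewrite divr_ge0// ln_ge0// ler1n.
rewrite -[l * _ / _]mulrA powRM ?(ltW l0)// mulrA ler_wpM2r ?powR_ge0//.
rewrite -mulrA ger_pMr; last by rewrite mulr_gt0.
rewrite mulrC ler_pdivrMr// mul1r.
apply: (@le_trans _ _ (Num.max 1 l `^ nu beta r p)).
  by apply: ge0_ler_powR; rewrite ?nnegrE ?(ltW l0) ?(ltW max0)// le_max lexx orbT.
rewrite -[leRHS]powRr1 ?(ltW max0)//; apply: ler_powR => //.
by rewrite le_max lexx.
Unshelve. all: by end_near. Qed.

Lemma sup_lower_bound L : (forall j, 0 < L j) ->
  (exists f : density R d, nikolskii_bounded r beta L M f) -> (s_index beta r <= 1)%E ->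
  exists c : R, 0 < c /\
    (c%:E < limn_einf (fun n => minimax_Linf_risk n (nikolskii_bounded r beta L M)))%E.
Proof.
move=> L_gt0 nonempty; rewrite s_index_le1// => s11.
have L1 := nikolskii_norm1 nonempty.
have [L0 L0_gt0 L_ge] := least_radius L_gt0.
have [k k0 bk] := smoothness_order beta_gt0.
have [psi] := bump_profile_exists R k0.
have [a a8 a_ok] := base_ok_exists psi bk L0_gt0.
have q0 : 0 < 1 / 5 :> R by rewrite divr_gt0.
have [theta th_ok] := needle_exists M_gt0 L0_gt0 a_ok q0.
have th0 : 0 < theta by case: th_ok => /andP[].
have /andP[c00 _] := profile_low_itv psi.
pose c := profile_low psi ^+ d / 64 * theta.
have c_gt0 : 0 < c by rewrite mulr_gt0// divr_gt0// exprn_gt0.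
exists (c / 2); split; first by rewrite divr_gt0.
apply: (@lt_le_trans _ _ c%:E).
  by rewrite lte_fin ltr_pdivrMr// ltr_pMr// ltr1n.
apply: limn_einf_ge; near=> n.
apply: (sup_zone d_gt0 bk r_ge1 L_ge L1 a_ok th_ok s11).
by near: n; exact: nbhs_infty_gt.
Unshelve. all: by end_near. Qed.

End lower_bounds.

Theorem theorem3 (R : realType) (d : nat) (beta : 'I_d -> R) (r : 'I_d -> \bar R)
    (M : R) (d_gt0 : (0 < d)%N) (beta_gt0 : forall j, 0 < beta j)
    (r_ge1 : forall j, (1 <= r j)%E) (M_gt0 : 0 < M) :
  [/\ forall L : 'I_d -> R, (forall j, 0 < L j) ->
        (exists f : density R d, nikolskii_bounded r beta L M f) ->
        exists c : R, 0 < c /\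
          forall p : R, 1 <= p ->
            (c%:E <= limn_einf (fun n =>
               ((L_beta beta L * alpha beta r p n / n%:R) `^ (- nu beta r p))%:E *
               minimax_Lp_risk p n (nikolskii_bounded r beta L M)))%E,
      forall L0 : R, 0 < L0 ->
        exists c : R, 0 < c /\
          forall L : 'I_d -> R, (forall j, L0 <= L j) ->
            (exists f : density R d, nikolskii_bounded r beta L M f) ->
            forall p : R, 1 <= p ->
              (p%:E <= sparse_threshold beta r)%E \/
              ((sparse_threshold beta r <= p%:E)%E /\ (s_index beta r < 1)%E) ->
              (c%:E <= limn_einf (fun n =>
                 ((L_beta beta L * alpha beta r p n / n%:R) `^ (- nu beta r p))%:E *
                 minimax_Lp_risk p n (nikolskii_bounded r beta L M)))%E
    & forall L : 'I_d -> R, (forall j, 0 < L j) ->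
        (exists f : density R d, nikolskii_bounded r beta L M f) ->
        (s_index beta r <= 1)%E ->
        exists c : R, 0 < c /\
          (c%:E < limn_einf (fun n =>
             minimax_Linf_risk n (nikolskii_bounded r beta L M)))%E].
Proof.
split.
- move=> L L_gt0 nonempty; have [L0 L0_gt0 L_ge] := least_radius L_gt0.
  have [c1 [c1_gt0 c1P]] := polynomial_lower_bound d_gt0 beta_gt0 r_ge1 M_gt0 L0_gt0.
  have [c2 [c2_gt0 c2P]] := log_lower_bound d_gt0 beta_gt0 r_ge1 M_gt0 L_gt0 nonempty.
  exists (Num.min c1 c2); split; first by rewrite lt_min c1_gt0.
  move=> p p1; have [poly|] :=
    pselect ((p%:E <= sparse_threshold beta r)%E \/ (s_index beta r < 1)%E).
    by apply: le_trans (c1P L L_ge nonempty p p1 poly); rewrite lee_fin ge_min lexx.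
  move=> /not_orP[/negP + /negP]; rewrite -ltNge -leNgt => thr s_ge1.
  by apply: le_trans (c2P p p1 thr s_ge1); rewrite lee_fin ge_min lexx orbT.
- move=> L0 L0_gt0.
  have [c [c_gt0 cP]] := polynomial_lower_bound d_gt0 beta_gt0 r_ge1 M_gt0 L0_gt0.
  exists c; split => // L L_ge nonempty p p1 regime.
  by apply: cP => //; case: regime => [|[_]]; [left|right].
- by move=> L L_gt0 nonempty; exact: sup_lower_bound.
Qed.
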